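(* \textsc{Isometric Path Partition} admits an algorithm running in time $\mathsf{diam}^{O(\mathsf{tw}^2)}\cdot n^{O(1)}$, where $\mathsf{diam}$ is the diameter of the input graph $G$, $\mathsf{tw}$ its treewidth, and $n$ its number of vertices.
   Context: All graphs are finite, simple and undirected. A path in a graph $G$ is isometric if it is a shortest path in $G$ between its two endpoints. In the problem \textsc{Isometric Path Partition}, the input is a graph $G$ and an integer $k$, and the question is whether the vertex set of $G$ can be partitioned into $k$ sets, each of which is the vertex set of an isometric path of $G$. *)

(* Defs.v *)
From mathcomp Require Import all_boot.
From mathcomp Require Import boolp.
Set Implicit Arguments.
Unset Strict Implicit.
Unset Printing Implicit Defensive.

Record sgraph (T : finType) := SGraph {
  adj :> rel T;
  adj_sym : symmetric adj;
  adj_irr : irreflexive adj }.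

Section Graphs.
Variables (T : finType) (G : sgraph T).

(* A path is given by its first vertex x and the sequence s of the following
   ones; its length is size s and its other endpoint is last x s. *)
Definition gpath (x : T) (s : seq T) : bool := path G x s && uniq (x :: s).

Definition isometric (x : T) (s : seq T) : Prop :=
  gpath x s /\
  forall s' : seq T, gpath x s' -> last x s' = last x s -> size s <= size s'.

Definition isometric_path_partition (k : nat) : Prop :=
  exists P : {set {set T}},
    [/\ partition P [set: T], #|P| = k &
        forall A : {set T}, A \in P ->
          exists (x : T) (s : seq T),
            isometric x s /\ A = [set y | y \in x :: s]].

(* The least length of a path from x to y (a path has fewer than #|T| edges);
   the value is #|T| when there is no such path. *)
Definition dist (x y : T) : nat :=
  find (fun d : nat => [exists s : d.-tuple T, gpath x s && (last x s == y)])
       (iota 0 #|T|).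

(* The largest distance inside a connected component: the usual diameter of a
   connected graph, and a finite number for a disconnected one. *)
Definition diam : nat := \max_(x : T) \max_(y : T | connect G x y) dist x y.

Definition is_tree : Prop :=
  [/\ 0 < #|T|, forall x y : T, connect G x y &
      forall c : seq T, 2 < size c -> ~ ucycle G c].

End Graphs.

Record tree_decomposition (T : finType) (G : sgraph T)
    (U : finType) (F : sgraph U) (bag : U -> {set T}) : Prop := TreeDec {
  td_tree : is_tree F;
  td_vertex : forall v : T, exists u : U, v \in bag u;
  td_edge : forall v w : T, adj G v w ->
    exists u : U, (v \in bag u) && (w \in bag u);
  td_connected : forall (v : T) (u1 u2 : U), v \in bag u1 -> v \in bag u2 ->
    connect [rel a b | [&& adj F a b, v \in bag a & v \in bag b]] u1 u2 }.

(* Truncation in the predecessor only matters for the graph without vertices,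
   whose treewidth is thus 0 rather than -1. *)
Definition width (T U : finType) (bag : U -> {set T}) : nat :=
  (\max_(u : U) #|bag u|).-1.

Definition has_width (T : finType) (G : sgraph T) (w : nat) : Prop :=
  exists (U : finType) (F : sgraph U) (bag : U -> {set T}),
    tree_decomposition G F bag /\ width bag = w.

Lemma has_width_ex (T : finType) (G : sgraph T) :
  exists w : nat, `[< has_width G w >].
Proof.
have sy : symmetric (fun _ _ : unit => false) by [].
have ir : irreflexive (fun _ _ : unit => false) by [].
exists (width (fun _ : unit => [set: T])); apply/asboolP.
exists unit, (SGraph sy ir), (fun=> [set: T]); split=> //.
split=> [|v|v w _|v [] [] _ _]; last exact: connect0.
- split=> [|[] []|]; [by rewrite card_unit | exact: connect0 |].
  by case=> [|[] [|[] c]] //= _; rewrite /ucycle.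
- by exists tt; rewrite inE.
- by exists tt; rewrite !inE.
Qed.

Definition treewidth (T : finType) (G : sgraph T) : nat :=
  ex_minn (has_width_ex G).

(* Random access machines with unit-cost instructions and unbounded cells; the
   memory is addressed indirectly, the registers directly.  The arithmetic is
   limited to addition and truncated subtraction: numbers grow by at most one
   bit per step, so that running times are polynomially related to those of
   Turing machines.  Programs are structured; each construct stands for O(1)
   instructions with jumps. *)
Inductive com : Type :=
| Const (i c : nat)         (* R_i := c *)
| Add (i j l : nat)         (* R_i := R_j + R_l *)
| Sub (i j l : nat)         (* R_i := R_j - R_l *)
| Read (i j : nat)          (* R_i := M[R_j] *)
| Write (i j : nat)         (* M[R_i] := R_j *)
| Seq (p q : com)
| If (i : nat) (p q : com)  (* if R_i <> 0 then p else q *)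
| While (i : nat) (p : com) (* while R_i <> 0 do p *).

Record state := State { reg : nat -> nat; mem : nat -> nat }.

Definition upd (f : nat -> nat) (a v : nat) : nat -> nat :=
  fun b => if b == a then v else f b.

Definition set_reg (s : state) (i v : nat) : state :=
  State (upd (reg s) i v) (mem s).

Definition set_mem (s : state) (a v : nat) : state :=
  State (reg s) (upd (mem s) a v).

(* exec p s t s': p started in s halts in s' after exactly t steps. *)
Inductive exec : com -> state -> nat -> state -> Prop :=
| ExecConst i c s : exec (Const i c) s 1 (set_reg s i c)
| ExecAdd i j l s : exec (Add i j l) s 1 (set_reg s i (reg s j + reg s l))
| ExecSub i j l s : exec (Sub i j l) s 1 (set_reg s i (reg s j - reg s l))
| ExecRead i j s : exec (Read i j) s 1 (set_reg s i (mem s (reg s j)))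
| ExecWrite i j s : exec (Write i j) s 1 (set_mem s (reg s i) (reg s j))
| ExecSeq p q s1 s2 s3 t1 t2 :
    exec p s1 t1 s2 -> exec q s2 t2 s3 -> exec (Seq p q) s1 (t1 + t2) s3
| ExecIfTrue i p q s s' t :
    reg s i != 0 -> exec p s t s' -> exec (If i p q) s t.+1 s'
| ExecIfFalse i p q s s' t :
    reg s i = 0 -> exec q s t s' -> exec (If i p q) s t.+1 s'
| ExecWhileTrue i p s1 s2 s3 t1 t2 :
    reg s1 i != 0 -> exec p s1 t1 s2 -> exec (While i p) s2 t2 s3 ->
    exec (While i p) s1 (t1 + t2).+1 s3
| ExecWhileFalse i p s : reg s i = 0 -> exec (While i p) s 1 s.

(* Row-major adjacency matrix: address i * n + j holds the entry (i, j). *)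
Definition adj_matrix (n : nat) (G : sgraph 'I_n) (a : nat) : nat :=
  [exists i : 'I_n, exists j : 'I_n, (a == i * n + j) && G i j].

Definition input (n : nat) (G : sgraph 'I_n) (k : nat) : state :=
  State (fun i => if i == 0 then n else if i == 1 then k else 0)
        (adj_matrix G).

(* The answer is read off register 0: 1 for yes, 0 for no. *)
Definition decides_in (p : com) (s : state) (Q : Prop) (t : nat) : Prop :=
  exists s' : state, exec p s t s' /\ reg s' 0 = `[< Q >].

(* Main.v *)
Require Import Defs.
From mathcomp Require Import all_boot.
From mathcomp Require Import boolp.
From mathcomp Require Import zify.

(* A path u_0, ..., u_l is isometric iff some 1-Lipschitz potential takes the
   value i at u_i.  Inside a bag of a tree decomposition, a partition into
   isometric paths is thus described by the values, at the vertices of the bag,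
   of the potentials of the paths through the bag, by the relation of lying on
   the same path, by the arcs already realized at each vertex and by the number
   of completed paths: O(w^2) digits in base diam + 2 and a number at most n.
   Local descriptions that agree along the tree glue to a global solution,
   because Lipschitz potentials extend (McShane).

   Instead of a tree decomposition, the program uses an elimination order whose
   bags have O(w) vertices.  It repeatedly places the first unplaced vertex v
   and a minimum vertex cut between the two sides of some bipartition of v and
   the placed neighbours of its component: bounded treewidth provides a
   bipartition with a small cut, and flows find the cut.  The order is verified
   before it is used, so soundness does not depend on its construction.

   The program knows neither diam nor w: it runs with a budget Z = 2, 4, 8, ...
   which caps all loops and the size of all tables, so that a run takes time
   polynomial in Z + n, and it stops at the first Z for which everything fits.
   When diam <= 1, diam + 2 is not bounded by a power of diam; then all
   components are cliques and the answer is explicit. *)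
Set Implicit Arguments.
Unset Strict Implicit.
Unset Printing Implicit Defensive.

(** * Register programs for numerical functions *)

(** Instructions only add and subtract, so every computed quantity is a bounded sum: maxima,
    quotients and searches become counts of thresholds, and the number of codes is never formed,
    only compared by dividing [Z - 1] repeatedly. [Ecomp] certifies that such an expression is
    computed by one program for all inputs, in time polynomial in [n + Z]. Bipartitions are
    enumerated as digit strings. These are shorter than the codes, so a budget that admits the
    tables also admits this search. The sizes reproduce themselves: a component with at most 3w+3
    placed neighbours, plus one vertex of its own, gives a set of 3w+4 vertices, which a bag of w+1
    vertices splits into sides of at most 2w+2. A side and the cut have again at most 3w+3 vertices,
    and two sides with the cut counted twice at most 6w+6. A path is counted at its first vertex,
    which has in-degree 0 and must have potential 0. The Lipschitz condition uses distances of the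
    whole graph, computed beforehand, which makes isometry a condition on bags. Soundness holds for
    every budget; diameter and treewidth enter only through the first budget that is certain to
    suffice. *)

Local Notation dmem := Defs.mem.

(** Running times are kept in the form [b ^ D]; this charges two consecutive phases to a single
    power. *)
Lemma expn_sum2 b x y : 1 < b -> b ^ x + b ^ y <= b ^ (x + y + 1).
Proof.
move=> b1; have hx : 0 < b ^ x by rewrite expn_gt0; lia.
have hy : 0 < b ^ y by rewrite expn_gt0; lia.
rewrite !expnD expn1; move: (b ^ x) (b ^ y) hx hy => u v hu hv.
apply: (@leq_trans (u * v * 2)); last by rewrite leq_mul2l b1 orbT.
by nia.
Qed.

Lemma leq_exp_self b k : 1 < b -> k <= b ^ k.
Proof. by move=> b1; apply/ltnW/ltn_expl. Qed.

(** The stack discipline of compiled code: a fragment compiled at level [d] may overwrite only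
    registers from [d] on. *)
Definition eqr (d : nat) (s s' : state) := forall r, r < d -> reg s' r = reg s r.

Lemma eqr_trans d s1 s2 s3 : eqr d s1 s2 -> eqr d s2 s3 -> eqr d s1 s3.
Proof. by move=> h1 h2 r rd; rewrite h2 // h1. Qed.

Lemma eqrW d d' s s' : d' <= d -> eqr d s s' -> eqr d' s s'.
Proof. by move=> h e r rd; apply: e; apply: leq_trans h. Qed.

Lemma eqr_set d i s v : d <= i -> eqr d s (set_reg s i v).
Proof. by move=> h r rd /=; rewrite /upd; case: eqP => // E; lia. Qed.

Lemma eqr_setr d i s s' v : d <= i -> eqr d s s' -> eqr d s (set_reg s' i v).
Proof. by move=> h e; apply: (eqr_trans e); apply: eqr_set. Qed.

Lemma reg_set s i v : reg (set_reg s i v) i = v.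
Proof. by rewrite /= /upd eqxx. Qed.

Lemma reg_setN s i v r : r != i -> reg (set_reg s i v) r = reg s r.
Proof. by rewrite /= /upd => /negbTE->. Qed.

(** Register [d] is the counter and [d.+1] the number of rounds left, so truncated subtraction is
    the loop test. Between rounds [d.+1] also serves as the constant 1, hence the body is free to
    overwrite it. *)
Definition forc d b p :=
  Seq (Const d 0) (Seq (Defs.Sub d.+1 b d)
    (While d.+1 (Seq p (Seq (Const d.+1 1) (Seq (Add d d d.+1) (Defs.Sub d.+1 b d)))))).

(** The stability hypothesis makes [I] depend only on the memory and the registers below [d], so the
    loop control cannot destroy it. The 4 extra steps per round are the three control instructions
    and the test. *)
Lemma exec_for (I : nat -> state -> Prop) d b p m T s :
  b < d -> reg s b = m ->
  (forall i s1 s2, I i s1 -> dmem s2 = dmem s1 -> eqr d s1 s2 -> I i s2) ->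
  I 0 s ->
  (forall i s1, i < m -> I i s1 -> reg s1 d = i -> reg s1 b = m ->
     exists s2 t, [/\ exec p s1 t s2, I i.+1 s2, reg s2 d = i, reg s2 b = m & t <= T]) ->
  exists s' t, [/\ exec (forc d b p) s t s', I m s' & t <= m * (T + 4) + 3].
Proof.
move=> bd rb Ist I0 Istep.
have loop : forall k i s1, i + k = m -> I i s1 -> reg s1 d = i -> reg s1 b = m ->
    reg s1 d.+1 = m - i ->
    exists s' t, [/\ exec (While d.+1 (Seq p (Seq (Const d.+1 1)
      (Seq (Add d d d.+1) (Defs.Sub d.+1 b d))))) s1 t s', I m s' & t <= k * (T + 4) + 1].
  elim=> [|k IH] i s1 ikm Ii r1 r2 r3.
    exists s1, 1; split=> //; last by move: Ii; rewrite -ikm addn0.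
    by apply: ExecWhileFalse; rewrite r3; lia.
  have im : i < m by lia.
  have [s2 [t [e2 I2 rd2 rb2 t2]]] := Istep i s1 im Ii r1 r2.
  pose s3 := set_reg s2 d.+1 1.
  pose s4 := set_reg s3 d (reg s3 d + reg s3 d.+1).
  pose s5 := set_reg s4 d.+1 (reg s4 b - reg s4 d).
  have E4 : reg s4 d = i.+1.
    by rewrite /s4 reg_set /s3 reg_set reg_setN ?rd2; lia.
  have E4b : reg s4 b = m by rewrite /s4 reg_setN ?/s3 ?reg_setN //; lia.
  have [|||||s' [t' [e' I' le']]] := IH i.+1 s5.
  - lia.
  - apply: (Ist _ s2) => //.
    by do 2 (apply: eqr_setr; first lia); apply: eqr_set.
  - by rewrite /s5 reg_setN ?E4 //; lia.
  - by rewrite /s5 reg_setN ?E4b //; lia.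
  - by rewrite /s5 reg_set E4 E4b.
  exists s', ((t + (1 + (1 + 1))) + t').+1; split=> //; last by nia.
  apply: ExecWhileTrue e'; first by rewrite r3; lia.
  do !apply: ExecSeq; first exact: e2; constructor.
pose s1 := set_reg s d 0.
pose s2 := set_reg s1 d.+1 (reg s1 b - reg s1 d).
have E1d : reg s1 d = 0 by rewrite reg_set.
have E1b : reg s1 b = m by rewrite reg_setN //; lia.
have [|||||s' [t' [e' I' le']]] := loop m 0 s2.
- by [].
- apply: (Ist _ s) => //; apply: eqr_setr; first lia.
  exact: eqr_set.
- by rewrite /s2 reg_setN ?E1d //; lia.
- by rewrite /s2 reg_setN ?E1b //; lia.
- by rewrite /s2 reg_set E1d E1b.
exists s', (1 + (1 + t')); split=> //; last by lia.
apply: ExecSeq; first by constructor.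
apply: ExecSeq; [by constructor | exact: e'].
Qed.

(* Contexts: the number of vertices, the second input, the input matrix, the cap
   on the loops, and the working arrays, which vanish outside [0, cZ)^2. *)
Record ctx := Ctx {
  cn : nat; ck : nat; cG : nat -> nat -> bool; cZ : nat;
  cA : nat -> nat -> nat -> nat }.

Definition narr := 32.
(** The arrays are interleaved behind the input matrix, so an address needs one product by [Z] and
    one by a fixed stride. The stride is [narr.+1] because slot [narr] is a scratch array. *)
Definition addr (n Z a i j : nat) := n * n + ((i * Z + j) * narr.+1 + a).

Record rep (c : ctx) (s : state) : Prop := Rep {
  rep_n : reg s 0 = cn c;
  rep_k : reg s 1 = ck c;
  rep_N : reg s 2 = cn c * cn c;
  rep_Z : reg s 3 = cZ c;
  rep_in : forall i j, i < cn c -> j < cn c -> dmem s (i * cn c + j) = cG c i j;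
  rep_in0 : forall i j, ~~ ((i < cn c) && (j < cn c)) -> cG c i j = false;
  rep_arr : forall a i j, a < narr -> i < cZ c -> j < cZ c ->
    dmem s (addr (cn c) (cZ c) a i j) = cA c a i j;
  rep_arr0 : forall a i j, ~~ [&& a < narr, i < cZ c & j < cZ c] -> cA c a i j = 0 }.

Lemma rep_eqr c s s' d : 4 <= d -> rep c s -> dmem s' = dmem s -> eqr d s s' -> rep c s'.
Proof.
by move=> d4 [r0 r1 r2 r3 ri ri0 ra ra0] em er; split; rewrite ?em // er //; lia.
Qed.

Definition bnd c := cn c + cZ c + 2.

Lemma bnd_gt1 c : 1 < bnd c. Proof. by rewrite /bnd; lia. Qed.

Definition vals (s : state) (rho : seq nat) := map (reg s) rho.

Lemma vals_eqr d s s' rho : all (fun r => r < d) rho -> eqr d s s' -> vals s' rho = vals s rho.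
Proof. by move=> /allP al er; apply/eq_in_map => r /al; apply: er. Qed.

(** The exponent is chosen before the registers and the program before the context, so one program
    serves all graphs and budgets. The sequence [rho] lists the registers of the enclosing loop
    indices. *)
Definition Ecomp (f : ctx -> seq nat -> nat) := exists D, forall rho d,
  4 <= d -> all (fun r => r < d) rho -> exists p, forall c s, rep c s ->
  exists s' t, [/\ exec p s t s', dmem s' = dmem s, eqr d s s',
    reg s' d = f c (vals s rho) & t <= bnd c ^ D].

Definition Bcomp (P : ctx -> seq nat -> bool) := Ecomp (fun c v => nat_of_bool (P c v)).

Lemma Ecomp_ext f g : (forall c v, f c v = g c v) -> Ecomp f -> Ecomp g.
Proof. by move=> e; suff -> : f = g by []; apply/funext=> c; apply/funext=> v; apply: e. Qed.

Lemma all_ltS d e (rho : seq nat) : d <= e -> all (fun r => r < d) rho -> all (fun r => r < e) rho.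
Proof. by move=> h; apply: sub_all => r rd; apply: leq_trans h. Qed.

Lemma Ecomp_const k : Ecomp (fun _ _ => k).
Proof.
exists 1 => rho d d4 al; exists (Const d k) => c s rc.
exists (set_reg s d k), 1; split=> //; [by constructor | exact: eqr_set | by rewrite reg_set |].
by have := bnd_gt1 c; rewrite expn1; lia.
Qed.

(** There is no move instruction: a register is copied by adding it to a cleared one. *)
Lemma Ecomp_reg r (f : ctx -> seq nat -> nat) : r < 4 ->
  (forall c s v, rep c s -> reg s r = f c v) -> Ecomp f.
Proof.
move=> r4 h; exists 2 => rho d d4 al.
exists (Seq (Const d 0) (Add d d r)) => c s rc.
pose s1 := set_reg s d 0.
exists (set_reg s1 d (reg s1 d + reg s1 r)), (1 + 1); split=> //.
- by apply: ExecSeq; constructor.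
- by apply: eqr_setr => //; exact: eqr_set.
- by rewrite reg_set /s1 reg_set reg_setN ?(h c s (vals s rho)) //; lia.
- by have := bnd_gt1 c; rewrite expnS expn1; nia.
Qed.

Lemma Ecomp_n : Ecomp (fun c _ => cn c).
Proof. by apply: (@Ecomp_reg 0) => // c s v []. Qed.
Lemma Ecomp_k : Ecomp (fun c _ => ck c).
Proof. by apply: (@Ecomp_reg 1) => // c s v []. Qed.
Lemma Ecomp_N : Ecomp (fun c _ => cn c * cn c).
Proof. by apply: (@Ecomp_reg 2) => // c s v []. Qed.
Lemma Ecomp_Z : Ecomp (fun c _ => cZ c).
Proof. by apply: (@Ecomp_reg 3) => // c s v []. Qed.

Lemma Ecomp_var : Ecomp (fun _ v => head 0 v).
Proof.
exists 2 => [[|r rho]] d d4 al.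
  exists (Const d 0) => c s rc; exists (set_reg s d 0), 1.
  split=> //; [by constructor | exact: eqr_set | by rewrite reg_set |].
  by rewrite expn_gt0; have := bnd_gt1 c; lia.
exists (Seq (Const d 0) (Add d d r)) => c s rc.
pose s1 := set_reg s d 0.
have /= /andP[rd _] := al.
exists (set_reg s1 d (reg s1 d + reg s1 r)), (1 + 1); split=> //.
- by apply: ExecSeq; constructor.
- by apply: eqr_setr => //; exact: eqr_set.
- by rewrite reg_set /s1 reg_set reg_setN //; lia.
- by have := bnd_gt1 c; rewrite expnS expn1; nia.
Qed.

Lemma Ecomp_behead f : Ecomp f -> Ecomp (fun c v => f c (behead v)).
Proof.
case=> D h; exists D => rho d d4 al.
have al' : all (fun r => r < d) (behead rho) by case: rho al => //= r rho /andP[].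
have [p hp] := h (behead rho) d d4 al'.
by exists p => c s rc; have := hp c s rc; rewrite /vals behead_map.
Qed.

Lemma Ecomp_op2 (op : nat -> nat -> nat -> com) (g : nat -> nat -> nat) f1 f2 :
  (forall i j l s, exec (op i j l) s 1 (set_reg s i (g (reg s j) (reg s l)))) ->
  Ecomp f1 -> Ecomp f2 -> Ecomp (fun c v => g (f1 c v) (f2 c v)).
Proof.
move=> hop [D1 h1] [D2 h2]; exists ((D1 + D2 + 1) + 1 + 1) => rho d d4 al.
have [p1 hp1] := h1 rho d d4 al.
have d4' : 4 <= d.+1 by lia.
have [p2 hp2] := h2 rho d.+1 d4' (all_ltS (leqnSn _) al).
exists (Seq p1 (Seq p2 (op d d d.+1))) => c s rc.
have [s1 [t1 [e1 m1 q1 r1 le1]]] := hp1 c s rc.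
have [s2 [t2 [e2 m2 q2 r2 le2]]] := hp2 c s1 (rep_eqr d4 rc m1 q1).
exists (set_reg s2 d (g (reg s2 d) (reg s2 d.+1))), (t1 + (t2 + 1)); split.
- by apply: ExecSeq e1 _; apply: ExecSeq e2 _.
- by rewrite /= m2.
- by apply: eqr_setr => //; apply: eqr_trans q1 _; exact: eqrW q2.
- by rewrite reg_set r2 q2 // r1 (vals_eqr al q1).
- have b1 := bnd_gt1 c; apply: leq_trans (expn_sum2 _ _ b1).
  have := expn_sum2 D1 D2 b1; rewrite expn1; lia.
Qed.

Lemma Ecomp_add f1 f2 : Ecomp f1 -> Ecomp f2 -> Ecomp (fun c v => f1 c v + f2 c v).
Proof. by apply: (@Ecomp_op2 Add addn) => i j l s; constructor. Qed.

Lemma Ecomp_sub f1 f2 : Ecomp f1 -> Ecomp f2 -> Ecomp (fun c v => f1 c v - f2 c v).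
Proof. by apply: (@Ecomp_op2 Defs.Sub subn) => i j l s; constructor. Qed.

Lemma Bcomp_leq f1 f2 : Ecomp f1 -> Ecomp f2 -> Bcomp (fun c v => f1 c v <= f2 c v).
Proof.
move=> h1 h2; apply: (@Ecomp_ext (fun c v => 1 - (f1 c v - f2 c v))).
  by move=> c v; case: leqP; lia.
by apply: (@Ecomp_sub (fun _ _ => 1) (fun c v => f1 c v - f2 c v));
  [exact: Ecomp_const | exact: Ecomp_sub].
Qed.

Lemma Bcomp_neg P : Bcomp P -> Bcomp (fun c v => ~~ P c v).
Proof.
move=> h; apply: (@Ecomp_ext (fun c v => 1 - P c v)); first by move=> c v; case: (P c v).
by apply: (@Ecomp_sub (fun _ _ => 1) (fun c v => P c v)); [exact: Ecomp_const|].
Qed.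

Lemma Bcomp_or P Q : Bcomp P -> Bcomp Q -> Bcomp (fun c v => P c v || Q c v).
Proof.
move=> h1 h2; apply: (@Ecomp_ext (fun c v => 1 <= P c v + Q c v)).
  by move=> c v; case: (P c v); case: (Q c v).
by apply: (@Bcomp_leq (fun _ _ => 1) (fun c v => P c v + Q c v));
  [exact: Ecomp_const | exact: Ecomp_add].
Qed.

Lemma Bcomp_and P Q : Bcomp P -> Bcomp Q -> Bcomp (fun c v => P c v && Q c v).
Proof.
move=> h1 h2; apply: (@Ecomp_ext (fun c v => 2 <= P c v + Q c v)).
  by move=> c v; case: (P c v); case: (Q c v).
by apply: (@Bcomp_leq (fun _ _ => 2) (fun c v => P c v + Q c v));
  [exact: Ecomp_const | exact: Ecomp_add].
Qed.

Lemma Bcomp_imp P Q : Bcomp P -> Bcomp Q -> Bcomp (fun c v => P c v ==> Q c v).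
Proof.
move=> h1 h2; apply: (@Ecomp_ext (fun c v => ~~ P c v || Q c v)).
  by move=> c v; rewrite implybE.
exact: (Bcomp_or (Bcomp_neg h1) h2).
Qed.

Lemma Bcomp_eq f1 f2 : Ecomp f1 -> Ecomp f2 -> Bcomp (fun c v => f1 c v == f2 c v).
Proof.
move=> h1 h2; apply: (@Ecomp_ext (fun c v => (f1 c v <= f2 c v) && (f2 c v <= f1 c v))).
  by move=> c v; rewrite eqn_leq.
exact: (Bcomp_and (Bcomp_leq h1 h2) (Bcomp_leq h2 h1)).
Qed.

Lemma Bcomp_eqb P Q : Bcomp P -> Bcomp Q -> Bcomp (fun c v => P c v == Q c v).
Proof.
move=> h1 h2; apply: (@Ecomp_ext (fun c v => (P c v : nat) == Q c v)).
  by move=> c v; case: (P c v); case: (Q c v).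
exact: (Bcomp_eq h1 h2).
Qed.

Lemma Bcomp_const (b : bool) : Bcomp (fun _ _ => b).
Proof. exact: Ecomp_const. Qed.

Lemma Ecomp_if P f1 f2 : Bcomp P -> Ecomp f1 -> Ecomp f2 ->
  Ecomp (fun c v => if P c v then f1 c v else f2 c v).
Proof.
move=> [D0 h0] [D1 h1] [D2 h2]; exists ((D0 + (D1 + D2 + 1) + 1) + 1 + 1) => rho d d4 al.
have [p0 hp0] := h0 rho d d4 al.
have [p1 hp1] := h1 rho d d4 al.
have [p2 hp2] := h2 rho d d4 al.
exists (Seq p0 (If d p1 p2)) => c s rc.
have [s0 [t0 [e0 m0 q0 r0 le0]]] := hp0 c s rc.
have rc0 := rep_eqr d4 rc m0 q0.
have b1 := bnd_gt1 c.
have lt12 := expn_sum2 D1 D2 b1.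
have lt := expn_sum2 D0 (D1 + D2 + 1) b1.
case EP : (P c (vals s rho)).
  have [s1 [t1 [e1 m1 q1 r1 le1]]] := hp1 c s0 rc0.
  exists s1, (t0 + t1.+1); split.
  - by apply: ExecSeq e0 _; apply: ExecIfTrue e1; rewrite r0 EP.
  - by rewrite m1.
  - exact: eqr_trans q1.
  - by rewrite r1 (vals_eqr al q0).
  - apply: leq_trans (expn_sum2 _ _ b1); rewrite expn1; lia.
have [s1 [t1 [e1 m1 q1 r1 le1]]] := hp2 c s0 rc0.
exists s1, (t0 + t1.+1); split.
- by apply: ExecSeq e0 _; apply: ExecIfFalse e1; rewrite r0 EP.
- by rewrite m1.
- exact: eqr_trans q1.
- by rewrite r1 (vals_eqr al q0).
- apply: leq_trans (expn_sum2 _ _ b1); rewrite expn1; lia.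
Qed.

(** Memory outside the matrix and the arrays is arbitrary, hence the guard [P]: the default 0 is
    produced by the program, not found in memory. *)
Lemma Ecomp_read g P f : Ecomp g -> Bcomp P ->
  (forall c s v, rep c s -> f c v = if P c v then dmem s (g c v) else 0) -> Ecomp f.
Proof.
move=> [D1 h1] [D0 h0] hf; exists ((D0 + (D1 + 1 + 1) + 1) + 1 + 1) => rho d d4 al.
have [p0 hp0] := h0 rho d d4 al.
have [p1 hp1] := h1 rho d d4 al.
exists (Seq p0 (If d (Seq p1 (Read d d)) (Const d 0))) => c s rc.
have [s0 [t0 [e0 m0 q0 r0 le0]]] := hp0 c s rc.
have rc0 := rep_eqr d4 rc m0 q0.
have b1 := bnd_gt1 c.
have lt12 := expn_sum2 D1 1 b1.
have lt := expn_sum2 D0 (D1 + 1 + 1) b1.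
case EP : (P c (vals s rho)).
  have [s1 [t1 [e1 m1 q1 r1 le1]]] := hp1 c s0 rc0.
  exists (set_reg s1 d (dmem s1 (reg s1 d))), (t0 + (t1 + 1).+1); split.
  - apply: ExecSeq e0 _; apply: ExecIfTrue; first by rewrite r0 EP.
    by apply: ExecSeq e1 _; constructor.
  - by rewrite /= m1.
  - by apply: eqr_setr => //; exact: eqr_trans q1.
  - by rewrite reg_set r1 m1 m0 (vals_eqr al q0) (hf c s) // EP.
  - apply: leq_trans (expn_sum2 _ _ b1); move: lt lt12; rewrite !expn1; lia.
exists (set_reg s0 d 0), (t0 + 1.+1); split.
- by apply: ExecSeq e0 _; apply: ExecIfFalse; [rewrite r0 EP | constructor].
- by [].
- exact: eqr_setr.
- by rewrite reg_set (hf c s) // EP.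
- apply: leq_trans (expn_sum2 _ _ b1); move: lt lt12; rewrite !expn1; lia.
Qed.

Definition Sm (m : nat) (f : nat -> nat) := \sum_(i < m) f i.
Definition Ex (m : nat) (P : nat -> bool) := [exists i : 'I_m, P i].
Definition Al (m : nat) (P : nat -> bool) := [forall i : 'I_m, P i].

(** The loop index is passed as the head of the environment, in de Bruijn style. The bound on the
    number of rounds keeps the time polynomial in [n + Z]; its factor leaves room for ranges such as
    the nodes of the flow network. *)
Lemma Ecomp_Sm (m : ctx -> seq nat -> nat) (F : ctx -> nat -> seq nat -> nat) :
  Ecomp m -> (forall c v, m c v <= 4 * bnd c) ->
  Ecomp (fun c v => F c (head 0 v) (behead v)) ->
  Ecomp (fun c v => Sm (m c v) (fun i => F c i v)).
Proof.
move=> [D1 h1] mb [D2 h2].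
exists (D1 + (3 + (D2 + 5 + 1)) + 1 + 8 + 1) => rho d d4 al.
have [p1 hp1] := h1 rho d d4 al.
have d4' : 4 <= d.+4 by lia.
have al' : all (fun r => r < d.+4) (d.+2 :: rho).
  by rewrite /= (all_ltS _ al) ?andbT; lia.
have [p2 hp2] := h2 (d.+2 :: rho) d.+4 d4' al'.
pose body := Seq p2 (Add d.+1 d.+1 d.+4).
exists (Seq p1 (Seq (Const d.+1 0) (Seq (forc d.+2 d body)
  (Seq (Const d.+2 0) (Add d d.+1 d.+2))))) => c s rc.
have [s1 [t1 [e1 m1 q1 r1 le1]]] := hp1 c s rc.
pose s2 := set_reg s1 d.+1 0.
set v := vals s rho in r1 *.
pose I i st := [/\ dmem st = dmem s, eqr d s st &
   reg st d.+1 = \sum_(j < i) F c j v].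
have b1 := bnd_gt1 c.
have [|||||s3 [t3 [e3 I3 le3]]] := @exec_for I d.+2 d body (m c v) (bnd c ^ D2 + 1) s2.
- lia.
- by rewrite reg_setN ?r1 //; lia.
- move=> i st1 st2 [ms er rg] em er2; split; first by rewrite em.
    by apply: eqr_trans er (eqrW _ er2); lia.
  by rewrite er2.
- split; rewrite ?reg_set ?big_ord0 //.
  by apply: eqr_setr; first lia.
- move=> i st1 im [ms er rg] rd rb.
  have rc1 : rep c st1 by apply: rep_eqr d4 rc ms er.
  have [st2 [t2 [e2 ms2 q2 r2 le2]]] := hp2 c st1 rc1.
  exists (set_reg st2 d.+1 (reg st2 d.+1 + reg st2 d.+4)), (t2 + 1); split.
  - by apply: ExecSeq e2 _; constructor.
  - split; first by rewrite /= ms2.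
      apply: eqr_setr; first lia.
      by apply: eqr_trans er (eqrW _ q2); lia.
    rewrite reg_set r2 q2; last lia.
    by rewrite rg big_ord_recr /= rd -/(vals _ _) (vals_eqr al er).
  - by rewrite reg_setN ?q2 //; lia.
  - by rewrite reg_setN ?q2 //; lia.
  - lia.
pose s4 := set_reg s3 d.+2 0.
case: I3 => ms3 q3 r3.
exists (set_reg s4 d (reg s4 d.+1 + reg s4 d.+2)), (t1 + (1 + (t3 + (1 + 1)))); split.
- do 2 (apply: ExecSeq; [by eassumption || by constructor |]).
  apply: ExecSeq e3 _; apply: ExecSeq; constructor.
- by [].
- by do 2 (apply: eqr_setr; first lia).
- by rewrite reg_set /s4 reg_set reg_setN ?r3 ?addn0 //; lia.
- have hm := mb c v.
  have k8 := leq_exp_self 8 b1.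
  have k5 : 5 <= bnd c ^ 5 by apply: leq_exp_self.
  have k3 : 4 * bnd c <= bnd c ^ 3 by rewrite !expnS expn0; nia.
  have h25 := expn_sum2 D2 5 b1.
  have step3 : t3 <= bnd c ^ (3 + (D2 + 5 + 1)) + 3.
    by apply: leq_trans le3 _; rewrite leq_add2r expnD leq_mul //; lia.
  have hh := expn_sum2 D1 (3 + (D2 + 5 + 1)) b1.
  apply: leq_trans (expn_sum2 _ _ b1); lia.
Qed.

Lemma Bcomp_Ex (m : ctx -> seq nat -> nat) (F : ctx -> nat -> seq nat -> bool) :
  Ecomp m -> (forall c v, m c v <= 4 * bnd c) ->
  Bcomp (fun c v => F c (head 0 v) (behead v)) ->
  Bcomp (fun c v => Ex (m c v) (fun i => F c i v)).
Proof.
move=> hm mb hF.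
apply: (@Ecomp_ext (fun c v => 0 < Sm (m c v) (fun i => F c i v))); last first.
  apply: (@Bcomp_leq (fun _ _ => 1) (fun c v => Sm (m c v) (fun i => F c i v))).
    exact: Ecomp_const.
  exact: (@Ecomp_Sm m (fun c i v => F c i v)).
move=> c v; congr nat_of_bool; rewrite /Sm /Ex lt0n sum_nat_eq0 negb_forall.
by apply: eq_existsb => i /=; rewrite eqb0 negbK.
Qed.

Lemma Bcomp_Al (m : ctx -> seq nat -> nat) (F : ctx -> nat -> seq nat -> bool) :
  Ecomp m -> (forall c v, m c v <= 4 * bnd c) ->
  Bcomp (fun c v => F c (head 0 v) (behead v)) ->
  Bcomp (fun c v => Al (m c v) (fun i => F c i v)).
Proof.
move=> hm mb hF.
apply: (@Ecomp_ext (fun c v => ~~ Ex (m c v) (fun i => ~~ F c i v))); last first.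
  exact: (Bcomp_neg (@Bcomp_Ex m (fun c i v => ~~ F c i v) hm mb (Bcomp_neg hF))).
move=> c v; congr nat_of_bool; rewrite /Ex /Al negb_exists.
by apply: eq_forallb => i /=; rewrite negbK.
Qed.

Lemma Ecomp_muln f g : Ecomp f -> Ecomp g -> (forall c v, f c v <= 4 * bnd c) ->
  Ecomp (fun c v => f c v * g c v).
Proof.
move=> hf hg fb.
apply: (@Ecomp_ext (fun c v => Sm (f c v) (fun _ => g c v))).
  by move=> c v; rewrite /Sm sum_nat_const card_ord.
by apply: (@Ecomp_Sm f (fun c _ v => g c v)) => //; exact: Ecomp_behead.
Qed.

Lemma Ecomp_cG f g : Ecomp f -> Ecomp g -> Bcomp (fun c v => cG c (f c v) (g c v)).
Proof.
move=> hf hg.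
apply: (@Ecomp_read (fun c v => cn c * f c v + g c v)
  (fun c v => (f c v < cn c) && (g c v < cn c))).
- apply: Ecomp_add => //; apply: Ecomp_muln => //; first exact: Ecomp_n.
  by move=> c v; rewrite /bnd; lia.
- exact: (Bcomp_and (Bcomp_leq (Ecomp_add (Ecomp_const 1) hf) Ecomp_n)
    (Bcomp_leq (Ecomp_add (Ecomp_const 1) hg) Ecomp_n)).
- move=> c s v [r0 r1 r2 r3 ri ri0 ra ra0].
  case: ifP => [/andP[h1 h2]|/negbT/ri0->//].
  by rewrite mulnC ri.
Qed.

Lemma Ecomp_addr a f g : Ecomp f -> Ecomp g ->
  Ecomp (fun c v => addr (cn c) (cZ c) a (f c v) (g c v)).
Proof.
move=> hf hg; apply: Ecomp_add; first exact: Ecomp_N.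
apply: Ecomp_add; last exact: Ecomp_const.
apply: (@Ecomp_ext (fun c v => narr.+1 * (cZ c * f c v + g c v))).
  by move=> c v; rewrite mulnC [cZ c * _]mulnC.
have hZ : Ecomp (fun c v => cZ c * f c v + g c v).
  apply: Ecomp_add => //; apply: Ecomp_muln => //; first exact: Ecomp_Z.
  by move=> c v; rewrite /bnd; lia.
(* The stride may exceed [4 * bnd c], so it is unfolded into that many additions instead of a
   loop. *)
elim: narr => [|k IH].
  by apply: (Ecomp_ext _ hZ) => c v; rewrite mul1n.
by apply: (Ecomp_ext _ (Ecomp_add hZ IH)) => c v; rewrite [RHS]mulSn.
Qed.

Lemma Ecomp_cA a f g : Ecomp f -> Ecomp g -> Ecomp (fun c v => cA c a (f c v) (g c v)).
Proof.
move=> hf hg.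
apply: (@Ecomp_read (fun c v => addr (cn c) (cZ c) a (f c v) (g c v))
  (fun c v => [&& a < narr, f c v < cZ c & g c v < cZ c])).
- exact: Ecomp_addr.
- exact: (Bcomp_and (Bcomp_const (a < narr))
    (Bcomp_and (Bcomp_leq (Ecomp_add (Ecomp_const 1) hf) Ecomp_Z)
    (Bcomp_leq (Ecomp_add (Ecomp_const 1) hg) Ecomp_Z))).
- move=> c s v [r0 r1 r2 r3 ri ri0 ra ra0].
  by case: ifP => [/and3P[h1 h2 h3]|/negbT/ra0->//]; rewrite ra.
Qed.

(** * Programs that fill arrays *)

Definition fill (c : ctx) (a : nat) (f : nat -> nat -> nat) : ctx :=
  Ctx (cn c) (ck c) (cG c) (cZ c) (fun b i j =>
    if b == a then (if (i < cZ c) && (j < cZ c) then f i j else 0) else cA c b i j).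

(* rep for all arrays but a, and with the scratch array narr. *)
Record repx (a : nat) (c : ctx) (A : nat -> nat -> nat -> nat) (s : state) : Prop := Repx {
  repx_n : reg s 0 = cn c;
  repx_k : reg s 1 = ck c;
  repx_N : reg s 2 = cn c * cn c;
  repx_Z : reg s 3 = cZ c;
  repx_in : forall i j, i < cn c -> j < cn c -> dmem s (i * cn c + j) = cG c i j;
  repx_in0 : forall i j, ~~ ((i < cn c) && (j < cn c)) -> cG c i j = false;
  repx_arr : forall b i j, b < narr.+1 -> b != a -> i < cZ c -> j < cZ c ->
    dmem s (addr (cn c) (cZ c) b i j) = A b i j }.

(** Whatever the arrays contain at this moment, the memory represents some context, and so code
    compiled for address computations may be run in the middle of an update. *)
Lemma repx_rep a c A s : repx a c A s ->
  rep (Ctx (cn c) (ck c) (cG c) (cZ c) (fun b i j =>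
    if [&& b < narr, i < cZ c & j < cZ c] then dmem s (addr (cn c) (cZ c) b i j) else 0)) s.
Proof.
by case=> r0 r1 r2 r3 ri ri0 ra; split=> //= b i j; [move=> -> -> -> | move=> /negbTE->].
Qed.

Lemma repx_eqr a c A s s' d : 4 <= d -> repx a c A s -> dmem s' = dmem s -> eqr d s s' ->
  repx a c A s'.
Proof. by move=> d4 [r0 r1 r2 r3 ri ri0 ra] em er; split; rewrite ?em // er //; lia. Qed.

Lemma addr_inj n Z a i j a' i' j' : a < narr.+1 -> a' < narr.+1 -> j < Z -> j' < Z ->
  addr n Z a i j = addr n Z a' i' j' -> [/\ a = a', i = i' & j = j'].
Proof.
rewrite /addr => ha ha' hj hj' /addnI E.
have Ea : a = a'.
  have := congr1 (modn^~ narr.+1) E.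
  by rewrite !modnMDl !modn_small.
have Eq : i * Z + j = i' * Z + j'.
  have := congr1 (divn^~ narr.+1) E.
  by rewrite !divnMDl // !divn_small // !addn0.
have Ej : j = j'.
  by have := congr1 (modn^~ Z) Eq; rewrite !modnMDl !modn_small.
split=> //; move: Eq; rewrite Ej => /addIn /eqP; rewrite eqn_pmul2r; [by move/eqP | lia].
Qed.

Lemma addr_in n Z a i j x y : x < n -> y < n -> x * n + y == addr n Z a i j = false.
Proof. by move=> hx hy; apply/eqP; rewrite /addr; nia. Qed.

Definition slotA (a : nat) (A : nat -> nat -> nat -> nat) g : nat -> nat -> nat -> nat :=
  fun b i j => if b == a then g i j else A b i j.

(** A double loop over the entries of one array; [p] finds the indices in registers [d] and [d.+2]
    and leaves the value in [d.+4]. In the conclusion [narr.+1] excludes no array, since array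
    numbers are below it. *)
Lemma exec_slots a : a < narr.+1 -> exists D', forall d p, 4 <= d -> exists q, forall c A g D s,
  (forall i j st, i < cZ c -> j < cZ c -> repx a c A st -> reg st d = i -> reg st d.+2 = j ->
    eqr d s st -> exists st' t, [/\ exec p st t st', dmem st' = dmem st, eqr d.+4 st st',
      reg st' d.+4 = g i j & t <= bnd c ^ D]) ->
  repx a c A s ->
  exists s' t, [/\ exec q s t s', repx narr.+1 c (slotA a A g) s', eqr d s s' &
    t <= bnd c ^ (D + D')].
Proof.
move=> aN.
have [DA hA] := Ecomp_addr a (Ecomp_behead Ecomp_var) Ecomp_var.
exists (DA + 13) => d p d4.
have d45 : 4 <= d.+4.+1 by lia.
have ald : all (fun r => r < d.+4.+1) [:: d.+2; d] by rewrite /= andbT; lia.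
have [pa hpa] := hA [:: d.+2; d] d.+4.+1 d45 ald.
pose body := Seq p (Seq pa (Write d.+4.+1 d.+4)).
exists (forc d 3 (forc d.+2 3 body)) => c A g D s hb rs.
pose I2 i j st := [/\ repx a c A st, eqr d s st & forall i' j', i' < cZ c -> j' < cZ c ->
  (i' < i) || ((i' == i) && (j' < j)) -> dmem st (addr (cn c) (cZ c) a i' j') = g i' j'].
pose T2 := bnd c ^ D + bnd c ^ DA + 1.
have b1 := bnd_gt1 c.
have inner i s1 : i < cZ c -> I2 i 0 s1 -> reg s1 d = i -> reg s1 3 = cZ c ->
   exists s2 t, [/\ exec (forc d.+2 3 body) s1 t s2, I2 i.+1 0 s2, reg s2 d = i,
    reg s2 3 = cZ c & t <= cZ c * (T2 + 4) + 3].
  move=> iZ I1 rd r3.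
  pose J j st := I2 i j st /\ reg st d = i.
  have [|||||s2 [t [e2 [J2 rd2] le2]]] := @exec_for J d.+2 3 body (cZ c) T2 s1.
  - lia.
  - by [].
  - move=> j st1 st2 [[rx er hm] rdi] em er2; split; last by rewrite er2.
    split; [by apply: repx_eqr rx em er2; lia | | by rewrite em].
    by apply: eqr_trans er (eqrW _ er2); lia.
  - by [].
  - move=> j st jZ [[rx er hm] rdi] rj rb3.
    have [st1 [t1 [e1 m1 q1 r1 le1]]] := hb i j st iZ jZ rx rdi rj er.
    have rx1 : repx a c A st1 by apply: repx_eqr rx m1 q1; lia.
    have [st2 [t2 [e2 m2 q2 r2 le2]]] := hpa _ st1 (repx_rep rx1).
    have Ead : reg st2 d.+4.+1 = addr (cn c) (cZ c) a i j.
      rewrite r2 /= !q1; [|lia|lia]; by rewrite rdi rj.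
    have Ev : reg st2 d.+4 = g i j by rewrite q2 ?r1; lia.
    exists (set_mem st2 (reg st2 d.+4.+1) (reg st2 d.+4)), (t1 + (t2 + 1)); split.
    + by apply: ExecSeq e1 _; apply: ExecSeq e2 _; constructor.
    + split; last by rewrite /= q2 ?q1 //; lia.
      have rx2 : repx a c A st2 by apply: repx_eqr rx1 m2 q2; lia.
      split.
      * case: rx2 => r0' r1' r2' r3' ri ri0 ra; split=> //=.
          by move=> x y hx hy; rewrite /upd Ead addr_in // ri.
        move=> b i' j' hb' ba hi hj; rewrite /upd Ead; case: eqP => [E|_]; last exact: ra.
        by have [Eb] := addr_inj hb' aN hj jZ E; rewrite Eb eqxx in ba.
      * move=> r rd' /=; rewrite q2 ?q1 ?er //; lia.
      move=> i' j' hi' hj' hor /=; rewrite /upd Ead Ev; case: eqP => [E|NE].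
        by have [_ -> ->] := addr_inj aN aN hj' jZ E.
      rewrite m2 m1; apply: hm => //.
      case/orP: hor => [-> //|/andP[/eqP ii jj]]; rewrite ii eqxx.
      have : j' != j by apply/eqP => jE; case: NE; rewrite ii jE.
      by move=> jn; rewrite ltnn /= ltn_neqAle jn.
    + by rewrite /= q2 ?q1 //; lia.
    + by rewrite /= q2 ?q1 ?rb3 //; lia.
    + rewrite /T2; have : bnd (Ctx (cn c) (ck c) (cG c) (cZ c) (fun b i j =>
    if [&& b < narr, i < cZ c & j < cZ c] then dmem st1 (addr (cn c) (cZ c) b i j) else 0)) = bnd c.
        by [].
      by move: le2 => /[swap] ->; lia.
  exists s2, t; split=> //.
    case: J2 => rx er hm; split=> // i' j' hi' hj'; rewrite ltnS ltn0 andbF orbF => hle.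
    by apply: hm => //; rewrite hj' andbT orbC -leq_eqVlt.
  by case: J2 => -[].
have [|||||s2 [t [e2 [rx2 er2 hm2] le2]]] :=
    @exec_for (fun i st => I2 i 0 st) d 3 (forc d.+2 3 body) (cZ c) (cZ c * (T2 + 4) + 3) s.
- lia.
- by case: rs.
- move=> i st1 st2 [rx er hm] em er'; split.
  + exact: repx_eqr rx em er'.
  + exact: eqr_trans er er'.
  + by rewrite em.
- by split=> // i' j'; rewrite ltn0 andbF.
- by move=> i st; apply: inner.
exists s2, t; split=> //.
- case: rx2 => r0 r1 r2 r3 ri ri0 ra; split=> //.
  move=> b i j hb' hbn hi hj; rewrite /slotA; case: eqP => [->|/eqP bna]; last exact: ra.
  by apply: hm2 => //; rewrite hi.
- have k4 := leq_exp_self 4 b1.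
  apply: leq_trans le2 _.
  have hZ : cZ c <= bnd c ^ 1 by rewrite expn1 /bnd; lia.
  have h1 := expn_sum2 D DA b1.
  have h2 : T2 + 4 <= bnd c ^ (D + DA + 1 + 5 + 1).
    apply: leq_trans (expn_sum2 _ _ b1); have k5 := leq_exp_self 5 b1; rewrite /T2.
    move: h1 k5; move: (bnd c ^ _) (bnd c ^ _) (bnd c ^ _) (bnd c ^ 5) => *; lia.
  set E := D + DA + 1 + 5 + 1 in h2.
  have h3 : cZ c * (T2 + 4) + 3 + 4 <= bnd c ^ (E + 4).
    have h : cZ c * (T2 + 4) <= bnd c ^ (1 + E) by rewrite expnD leq_mul.
    have u1 : 0 < bnd c ^ E by rewrite expn_gt0; lia.
    have u8 : bnd c + 7 <= bnd c ^ 4.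
      rewrite !expnS expn0 muln1; move: (bnd c) b1 => B b1.
      have e4 : 2 * B <= B * B by rewrite leq_mul2r b1 orbT.
      have e5 : 4 * (B * B) <= B * (B * (B * B)).
        by rewrite [in leqRHS]mulnA; apply: leq_mul => //; lia.
      lia.
    rewrite expnD; move: h u1 u8; rewrite expnD expn1.
    move: (bnd c ^ 4) (bnd c ^ E) (cZ c * (T2 + 4)) (bnd c) => B4 U V B; nia.
  have h4 : cZ c * (cZ c * (T2 + 4) + 3 + 4) <= bnd c ^ (1 + (E + 4)) by rewrite expnD leq_mul.
  have -> : D + (DA + 13) = 1 + (E + 4) + 1 by rewrite /E; lia.
  rewrite [_ ^ (_ + 1)]expnD expn1.
  have u1 : 4 <= bnd c ^ (1 + (E + 4)).
    apply: (@leq_trans (bnd c ^ 2)); last by rewrite leq_pexp2l //; lia.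
    by rewrite -[4]/(2 ^ 2) leq_exp2r.
  by nia.
Qed.

(** The first clause keeps [bnd] constant along a program, so that the exponents of successive
    phases can be added. *)
Definition Scomp (F : ctx -> seq nat -> ctx) :=
  (forall c v, [/\ cn (F c v) = cn c, ck (F c v) = ck c, cG (F c v) = cG c & cZ (F c v) = cZ c])
  /\ exists D, forall rho d, 4 <= d -> all (fun r => r < d) rho -> exists p,
  forall c s, rep c s -> exists s' t,
    [/\ exec p s t s', rep (F c (vals s rho)) s', eqr d s s' & t <= bnd c ^ D].

Lemma rep_repx c s : rep c s -> repx narr c (cA c) s.
Proof.
case=> r0 r1 r2 r3 ri ri0 ra ra0; split=> // b i j.
by rewrite ltnS leq_eqVlt => /orP[->//|bn _ hi hj]; apply: ra.
Qed.

(** The function [f] may read the very array that is being filled. All new values therefore go to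
    the scratch array first and are copied afterwards: the assignment is simultaneous. *)
Lemma Scomp_fill a (f : ctx -> nat -> nat -> seq nat -> nat) : a < narr ->
  Ecomp (fun c v => f c (head 0 (behead v)) (head 0 v) (behead (behead v))) ->
  Scomp (fun c v => fill c a (fun i j => f c i j v)).
Proof.
move=> aN [D h]; split=> //.
have [D1 h1] := exec_slots (ltnSn narr).
have [D2 h2] := @exec_slots a (leqW aN).
have [D3 h3] : Ecomp (fun c v => addr (cn c) (cZ c) narr (head 0 (behead v)) (head 0 v)).
  exact: (Ecomp_addr narr (Ecomp_behead Ecomp_var) Ecomp_var).
exists ((D + D1) + (D3 + 2 + D2) + 1) => rho d d4 al.
have d44 : 4 <= d.+4 by lia.
have al1 : all (fun r => r < d.+4) [:: d.+2, d & rho].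
  by rewrite /= (all_ltS _ al) ?andbT; lia.
have al2 : all (fun r => r < d.+4) [:: d.+2; d] by rewrite /= andbT; lia.
have [p1 hp1] := h _ _ d44 al1.
have [p2 hp2] := h3 _ _ d44 al2.
have [q1 hq1] := h1 d p1 d4.
have [q2 hq2] := h2 d (Seq p2 (Read d.+4 d.+4)) d4.
exists (Seq q1 q2) => c s rc.
have b1 := bnd_gt1 c.
set v := vals s rho.
have [||s1 [t1 [e1 rx1 er1 le1]]] := hq1 c (cA c) (fun i j => f c i j v) D s.
- move=> i j st iZ jZ rx rd rd2 er.
  have rcst : rep c st.
    case: rc rx => _ _ _ _ _ ri0 _ ra0 [u0 u1 u2 u3 ui ui0 ua]; split=> //.
    by move=> b i' j' hb; apply: ua; lia.
  have [st' [t [e m q r le]]] := hp1 c st rcst.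
  by exists st', t; split=> //; rewrite r /= rd rd2 -/(vals _ _) (vals_eqr al er).
- exact: rep_repx.
have rxa : repx a c (slotA narr (cA c) (fun i j => f c i j v)) s1.
  by case: rx1 => u0 u1 u2 u3 ui ui0 ua; split=> // b i j hb _; apply: ua; lia.
have [||s2 [t2 [e2 rx2 er2 le2]]] := hq2 c (slotA narr (cA c) (fun i j => f c i j v))
   (fun i j => f c i j v) (D3 + 2) s1.
- move=> i j st iZ jZ rx rd rd2 er.
  have [st' [t [e m q r le]]] := hp2 _ st (repx_rep rx).
  exists (set_reg st' d.+4 (dmem st' (reg st' d.+4))), (t + 1); split.
  + by apply: ExecSeq e _; constructor.
  + by rewrite /= m.
  + exact: eqr_setr.
  + rewrite reg_set r m /= rd rd2; case: rx => u0 u1 u2 u3 ui ui0 -> //; last lia.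
  + apply: leq_trans (_ : bnd c ^ (D3 + 1 + 1) <= _); last by rewrite -addnA.
    apply: leq_trans (expn_sum2 _ _ b1); rewrite expn1; move: le; rewrite /bnd /=; lia.
- exact: rxa.
exists s2, (t1 + t2); split.
- exact: ExecSeq e1 e2.
- case: rx2 => u0 u1 u2 u3 ui ui0 ua; case: rc => _ _ _ _ _ _ ra ra0; split=> //=.
    move=> b i j hb hi hj; rewrite ua //; try lia; rewrite /slotA hi hj.
    by case: eqP => // _; case: eqP => // bE; lia.
  move=> b i j hb; case: eqP => [bE|_]; last exact: ra0.
  by move: hb; rewrite bE aN /= => /negbTE->.
- exact: eqr_trans er2.
- apply: leq_trans (expn_sum2 _ _ b1); lia.
Qed.

Lemma Scomp_seq F1 F2 : Scomp F1 -> Scomp F2 -> Scomp (fun c v => F2 (F1 c v) v).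
Proof.
move=> [sh1 [D1 h1]] [sh2 [D2 h2]]; split.
  by move=> c v; have [<- <- <- <-] := sh1 c v; apply: sh2.
exists (D1 + D2 + 1) => rho d d4 al.
have [p1 hp1] := h1 _ _ d4 al; have [p2 hp2] := h2 _ _ d4 al.
exists (Seq p1 p2) => c s rc.
have [s1 [t1 [e1 r1 q1 le1]]] := hp1 c s rc.
have [s2 [t2 [e2 r2 q2 le2]]] := hp2 _ s1 r1.
exists s2, (t1 + t2); split.
- exact: ExecSeq e1 e2.
- by rewrite (vals_eqr al q1) in r2.
- exact: eqr_trans q2.
- have [E1 E2 E3 E4] := sh1 c (vals s rho).
  have b1 := bnd_gt1 c; apply: leq_trans (expn_sum2 _ _ b1).
  by apply: leq_add => //; move: le2; rewrite /bnd E1 E4.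
Qed.

Lemma Scomp_iter (m : ctx -> seq nat -> nat) (F : ctx -> nat -> seq nat -> ctx) :
  Ecomp m -> (forall c v, m c v <= 4 * bnd c) ->
  Scomp (fun c v => F c (head 0 v) (behead v)) ->
  Scomp (fun c v => iteri (m c v) (fun i c' => F c' i v) c).
Proof.
move=> [D1 h1] mb [sh [D2 h2]].
have shi c v k : let c' := iteri k (fun i c' => F c' i v) c in
    [/\ cn c' = cn c, ck c' = ck c, cG c' = cG c & cZ c' = cZ c].
  elim: k => //= k [<- <- <- <-].
  exact: (sh _ (k :: v)).
split; first by move=> c v; apply: shi.
exists (D1 + (3 + (D2 + 5 + 1)) + 1 + 8 + 1) => rho d d4 al.
have [p1 hp1] := h1 rho d d4 al.
have d4' : 4 <= d.+3 by lia.
have al' : all (fun r => r < d.+3) (d.+1 :: rho).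
  by rewrite /= (all_ltS _ al) ?andbT; lia.
have [p2 hp2] := h2 (d.+1 :: rho) d.+3 d4' al'.
exists (Seq p1 (forc d.+1 d p2)) => c s rc.
have [s1 [t1 [e1 m1 q1 r1 le1]]] := hp1 c s rc.
set v := vals s rho in r1 *.
have b1 := bnd_gt1 c.
pose I i st := rep (iteri i (fun i c' => F c' i v) c) st /\ eqr d s st.
have [|||||s3 [t3 [e3 [I3 q3] le3]]] := @exec_for I d.+1 d p2 (m c v) (bnd c ^ D2) s1.
- lia.
- by [].
- move=> i st1 st2 [rx er] em er2; split; first by apply: rep_eqr rx em er2; lia.
  by apply: eqr_trans er (eqrW _ er2); lia.
- by split=> //; apply: rep_eqr rc m1 q1.
- move=> i st im [rx er] rd rb.
  have [st2 [t2 [e2 r2 q2 le2]]] := hp2 _ st rx.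
  exists st2, t2; split=> //.
  + split; last by apply: eqr_trans er (eqrW _ q2); lia.
    by move: r2; rewrite /= rd -/(vals _ _) (vals_eqr al er).
  + by rewrite q2 //; lia.
  + by rewrite q2 ?rb //; lia.
  + by have [E1 _ _ E4] := shi c v i; move: le2; rewrite /bnd E1 E4.
exists s3, (t1 + t3); split=> //.
- exact: ExecSeq e1 e3.
- have hm := mb c v.
  have k8 := leq_exp_self 8 b1.
  have k5 : 5 <= bnd c ^ 5 by apply: leq_exp_self.
  have k3 : 4 * bnd c <= bnd c ^ 3 by rewrite !expnS expn0; nia.
  have h25 := expn_sum2 D2 5 b1.
  have step3 : t3 <= bnd c ^ (3 + (D2 + 5 + 1)) + 3.
    by apply: leq_trans le3 _; rewrite leq_add2r expnD leq_mul //; lia.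
  have hh := expn_sum2 D1 (3 + (D2 + 5 + 1)) b1.
  apply: leq_trans (expn_sum2 _ _ b1); lia.
Qed.

(** * The algorithm *)

Definition fillc (a : nat) (f : ctx -> nat -> nat -> nat) (c : ctx) := fill c a (f c).
Definition seqc (F G : ctx -> ctx) (c : ctx) := G (F c).
Definition loopc (m : ctx -> nat) (F : nat -> ctx -> ctx) (c : ctx) := iteri (m c) F c.
Notation "F ;; G" := (seqc F G) (at level 61, right associativity).

Lemma Scomp_seqc F G : Scomp (fun c v => F v c) -> Scomp (fun c v => G v c) ->
  Scomp (fun c v => seqc (F v) (G v) c).
Proof. exact: Scomp_seq. Qed.

Lemma Scomp_loopc (m : seq nat -> ctx -> nat) F :
  Ecomp (fun c v => m v c) -> (forall c v, m v c <= 4 * bnd c) ->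
  Scomp (fun c v => F (behead v) (head 0 v) c) ->
  Scomp (fun c v => loopc (m v) (F v) c).
Proof.
move=> hm mb hF.
exact: (@Scomp_iter (fun c v => m v c) (fun c i v => F v i c)).
Qed.

Lemma Scomp_fillc a f : a < narr ->
  Ecomp (fun c v => f (behead (behead v)) c (head 0 (behead v)) (head 0 v)) ->
  Scomp (fun c v => fillc a (f v) c).
Proof. exact: (@Scomp_fill a (fun c i j v => f v c i j)). Qed.

(** Weakening: a compiled expression can be used under [k] further loop indices. *)
Lemma Ecomp_beheadn k f : Ecomp f -> Ecomp (fun c v => f c (iter k behead v)).
Proof.
move=> h; elim: k => // k IH.
apply: (@Ecomp_ext (fun c v => f c (iter k behead (behead v)))).
  by move=> c v; rewrite -iterSr.
exact: (Ecomp_behead IH).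
Qed.

(** A conditional with a head symbol that the syntax-directed tactics below can match. *)
Definition ite (b : bool) (x y : nat) := if b then x else y.

Ltac ec_beheads h :=
  first [ exact h | exact (Ecomp_beheadn 1 h) | exact (Ecomp_beheadn 2 h)
        | exact (Ecomp_beheadn 3 h) | exact (Ecomp_beheadn 4 h) | exact (Ecomp_beheadn 5 h)
        | exact (Ecomp_beheadn 6 h) | exact (Ecomp_beheadn 7 h) | exact (Ecomp_beheadn 8 h) ].

Ltac ec_user := fail.

Ltac ec_bound := by move=> *; cbv beta; rewrite ?/bnd; lia.

Ltac ec_step :=
  lazymatch goal with
  | |- Ecomp (fun _ _ => nat_of_bool true) => exact (Ecomp_const 1)
  | |- Ecomp (fun _ _ => nat_of_bool false) => exact (Ecomp_const 0)
  | |- Ecomp (fun c v => nat_of_bool (@?P c v)) => change (Bcomp P)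
  | |- Bcomp (fun c v => @?P c v && @?Q c v) => refine (@Bcomp_and P Q _ _)
  | |- Bcomp (fun c v => @?P c v || @?Q c v) => refine (@Bcomp_or P Q _ _)
  | |- Bcomp (fun c v => @?P c v ==> @?Q c v) => refine (@Bcomp_imp P Q _ _)
  | |- Bcomp (fun c v => ~~ @?P c v) => refine (@Bcomp_neg P _)
  | |- Bcomp (fun c v => @?f c v <= @?g c v) => refine (@Bcomp_leq f g _ _)
  | |- Bcomp (fun c v => @eq_op _ (@?f c v) (@?g c v)) =>
      first [refine (@Bcomp_eq f g _ _) | refine (@Bcomp_eqb f g _ _)]
  | |- Bcomp (fun c v => Ex (@?m c v) (@?F c v)) =>
      refine (@Bcomp_Ex m (fun c i v => F c v i) _ _ _); [ | ec_bound | ]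
  | |- Bcomp (fun c v => Al (@?m c v) (@?F c v)) =>
      refine (@Bcomp_Al m (fun c i v => F c v i) _ _ _); [ | ec_bound | ]
  | |- Ecomp (fun c v => Sm (@?m c v) (@?F c v)) =>
      refine (@Ecomp_Sm m (fun c i v => F c v i) _ _ _); [ | ec_bound | ]
  | |- Bcomp (fun c v => cG _ (@?f c v) (@?g c v)) => refine (@Ecomp_cG f g _ _)
  | |- Ecomp (fun c v => cA _ ?a (@?f c v) (@?g c v)) => refine (@Ecomp_cA a f g _ _)
  | |- Ecomp (fun c v => cn _) => exact Ecomp_n
  | |- Ecomp (fun c v => ck _) => exact Ecomp_k
  | |- Ecomp (fun c v => cZ _) => exact Ecomp_Z
  | |- Ecomp (fun c v => ite (@?P c v) (@?f c v) (@?g c v)) => refine (@Ecomp_if P f g _ _ _)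
  | |- Ecomp (fun c v => addn (@?f c v) (@?g c v)) => refine (@Ecomp_add f g _ _)
  | |- Ecomp (fun c v => subn (@?f c v) (@?g c v)) => refine (@Ecomp_sub f g _ _)
  | |- Ecomp (fun c v => muln (@?f c v) (@?g c v)) => refine (@Ecomp_muln f g _ _ _); [ | | ec_bound]
  | |- Ecomp (fun _ _ => ?k) => exact (Ecomp_const k)
  | |- Ecomp (fun c v => S (@?f c v)) => refine (@Ecomp_add (fun _ _ => 1) f _ _)
  | |- Ecomp (fun c v => head 0 _) => ec_beheads Ecomp_var
  end; cbv beta.

Ltac ec_hyp := match goal with
  | h : Ecomp _ |- Ecomp _ => ec_beheads h
  | h : Bcomp _ |- Bcomp _ => ec_beheads h end.

Ltac ecomp := cbv beta; repeat first [ec_step | ec_user | ec_hyp].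

Ltac sc_user := fail.

Ltac sc_step :=
  lazymatch goal with
  | |- Scomp (fun c v => seqc (@?F v) (@?G v) c) => refine (@Scomp_seqc F G _ _)
  | |- Scomp (fun c v => loopc (@?m v) (@?F v) c) =>
      refine (@Scomp_loopc m F _ _ _); [ | ec_bound | ]
  | |- Scomp (fun c v => fillc ?a (@?f v) c) => refine (@Scomp_fillc a f _ _); [by [] | ]
  end; cbv beta.

Ltac scomp := cbv beta; repeat first [sc_step | sc_user | ec_step | ec_user | ec_hyp].

Definition bexp (b : bool) : nat := b.

(* Array 1: a relation; array 3, after apsp m: its distances on [0, m). *)
Definition apsp (m : ctx -> nat) : ctx -> ctx :=
  fillc 2 (fun c i j => i == j) ;;
  fillc 3 (fun c i j => 0) ;;
  loopc m (fun _ =>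
    fillc 3 (fun c i j => cA c 3 i j + (cA c 2 i j == 0)) ;;
    fillc 2 (fun c i j => (cA c 2 i j != 0) ||
      Ex (m c) (fun l => (cA c 2 i l != 0) && (cA c 1 l j != 0)))).

Lemma Scomp_apsp m : Ecomp (fun c _ => m c) -> (forall c, m c <= 4 * bnd c) ->
  Scomp (fun c v => apsp m c).
Proof.
move=> hm mb; rewrite /apsp; scomp.
apply: (@Scomp_loopc (fun _ => m) (fun _ _ => _)) => //; scomp.
apply: (@Bcomp_Ex (fun c _ => m c)) => //; ecomp.
Qed.

(* Least i < m with P i, or m if there is none. *)
Definition first (m : nat) (P : nat -> bool) :=
  Sm m (fun i => Al m (fun j => (j <= i) ==> ~~ P j)).

(** * Distances, digits and the widths that fit the budget *)

Definition apsp_graph : ctx -> ctx :=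
  fillc 1 (fun c i j => cG c i j) ;; apsp cn ;; fillc 4 (fun c i j => cA c 3 i j).

(** A maximum written as the number of thresholds below it. Entries equal to [cn c] mean
    unreachable, so only distances inside components count. *)
Definition dm (c : ctx) := Sm (cn c) (fun t => Ex (cn c) (fun i => Ex (cn c) (fun j =>
  (cA c 4 i j < cn c) && (t < cA c 4 i j)))).
(** Potentials are at most the diameter; the base must also be at least 2 in every graph, because
    digits 0 and 1 encode relations and degrees. *)
Definition bb (c : ctx) := dm c + 2.
Definition divb (c : ctx) (x : nat) := Sm (cZ c) (fun i => bb c * i.+1 <= x).
(* Array 5: x / bb^j at (j, x). *)
Definition digits : ctx -> ctx :=
  fillc 5 (fun c j x => 0) ;;
  loopc cZ (fun _ => fillc 5 (fun c j x => ite (j == 0) x (divb c (cA c 5 (j - 1) x)))).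
Definition dg (c : ctx) (x j : nat) := cA c 5 j x - bb c * cA c 5 j.+1 x.
(** A product whose first factor has no a priori bound: the sum is cut off at [cZ c], and is exact
    when [x <= cZ c]. *)
Definition mulz (c : ctx) (x y : nat) := Sm (cZ c) (fun i => ite (i < x) y 0).

(* 6 i + 8, a bound on the sizes of the bags when the treewidth is i. *)
Definition slots (i : nat) := i + i + (i + i) + (i + i) + 8.
Definition ndig (c : ctx) (i : nat) :=
  mulz c (slots i) (slots i) + mulz c (slots i) (slots i) + (slots i + slots i).
(** Tests whether n+1 times the number of digit strings is below the budget. The power itself could
    exceed every cap, so [cZ c - 1] divided by it is looked up in the table of quotients. *)
Definition okw (c : ctx) (i : nat) :=
  (slots i <= cZ c) && ((cn c).+1 <= cA c 5 (ndig c i) (cZ c - 1)).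
(** The treewidth is unknown; the program works with [ww], the last width before the first one whose
    codes do not fit. The value 0 of [nw] means that no width fits. *)
Definition nw (c : ctx) := first (cn c) (fun i => ~~ okw c i).
Definition ww (c : ctx) := nw c - 1.

(** * Cuts and the elimination order *)

Definition fvx (c : ctx) := first (cn c) (fun i => cA c 6 i 0 == 0).
Definition rankW (c : ctx) (u : nat) := Sm (cn c) (fun y => (y < u) && (cA c 8 y 0 != 0)).
Definition inA (c : ctx) (u : nat) := cA c 9 u 0 != 0.
Definition inB (c : ctx) (u : nat) := (cA c 8 u 0 != 0) && (cA c 9 u 0 == 0).

Definition nnode (c : ctx) := cn c + cn c + 2.
(** Vertex splitting: [u] and [n + u] are the two copies of a vertex, [2n] is the source and [2n+1]
    the sink. Arcs between different vertices have capacity one as well; since every cut arc can be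
    charged to a vertex, minimum cuts still give minimum vertex separators. *)
Definition cap (c : ctx) (x y : nat) :=
  [|| (x < cn c) && (y == cn c + x),
      [&& cn c <= x, x < cn c + cn c, y < cn c & cG c (x - cn c) y],
      [&& x == cn c + cn c, y < cn c & inA c y] |
      [&& cn c <= x, x < cn c + cn c, y == (cn c + cn c).+1 & inB c (x - cn c)]].
Definition resid (c : ctx) (x y : nat) :=
  (cap c x y && (cA c 10 x y == 0)) || (cA c 10 y x != 0).
Definition src (c : ctx) := cn c + cn c.
Definition snk (c : ctx) := (cn c + cn c).+1.
Definition nxt (c : ctx) (x : nat) := first (nnode c) (fun y =>
  (cA c 1 x y != 0) && (cA c 3 y (snk c) < cA c 3 x (snk c))).
Definition onp (c : ctx) (x y : nat) := Ex (nnode c) (fun i =>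
  [&& i < cA c 3 (src c) (snk c), cA c 11 i 0 == x & cA c 11 i.+1 0 == y]).

(** The path follows strictly decreasing residual distances to the sink, so it repeats no node.
    Without an augmenting path the flow is left as it is, which makes a fixed number of rounds
    safe. *)
Definition augment : ctx -> ctx :=
  fillc 1 (fun c x y => resid c x y) ;; apsp nnode ;;
  fillc 11 (fun c i j => src c) ;;
  loopc nnode (fun i => fillc 11 (fun c k j =>
    ite (k == i.+1) (nxt c (cA c 11 i 0)) (cA c 11 k j))) ;;
  fillc 10 (fun c x y => ite (cA c 3 (src c) (snk c) < nnode c)
    (ite (onp c x y && (cA c 10 y x == 0)) 1
      (ite (onp c y x && (cA c 10 x y != 0)) 0 (cA c 10 x y)))
    (cA c 10 x y)).

Definition rch (c : ctx) (x : nat) := cA c 3 (src c) x < nnode c.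
Definition incut (c : ctx) (u : nat) := (u < cn c) &&
  [|| rch c u && ~~ rch c (cn c + u),
      rch c (cn c + u) && Ex (cn c) (fun y => cG c u y && ~~ rch c y),
      [&& rch c (cn c + u), inB c u & ~~ rch c (snk c)] |
      inA c u && ~~ rch c u].

(* Arrays 8 and 9: W and A; array 10: a flow; array 12: a minimum vertex cut
   between A and W - A. *)
Definition mincut : ctx -> ctx :=
  fillc 10 (fun c x y => 0) ;;
  loopc (fun c => (cn c).+1) (fun _ => augment) ;;
  fillc 1 (fun c x y => resid c x y) ;; apsp nnode ;;
  fillc 12 (fun c u j => incut c u).

(** A cut of at most w+1 vertices plus a side of at most 2w+2, as provided by [balanced_split]. *)
Definition w3 (c : ctx) := ww c + ww c + ww c + 3.
Definition goodcut (c : ctx) :=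
  let x := Sm (cn c) (fun u => cA c 12 u 0) in
  (x + Sm (cn c) (fun u => inA c u) <= w3 c) && (x + Sm (cn c) (fun u => inB c u) <= w3 c).

(** The side A is read off the digits of [mu]: the vertex of W with rank j belongs to A when digit j
    is 1. Running through all [mu] below the budget reaches every subset of W as soon as the strings
    of length |W| fit. *)
Definition trymask (mu : nat) : ctx -> ctx :=
  fillc 9 (fun c u j => (cA c 8 u 0 != 0) && (dg c mu (rankW c u) == 1)) ;;
  mincut ;;
  fillc 13 (fun c u j => ite (goodcut c) (cA c 12 u 0) (cA c 13 u j)).

(* Array 6: 0, or the key of a placed vertex; 7: the component of the first
   unplaced vertex; 13: the cut. *)
Definition round (r : nat) : ctx -> ctx :=
  fillc 1 (fun c i j => [&& cG c i j, cA c 6 i 0 == 0 & cA c 6 j 0 == 0]) ;; apsp cn ;;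
  fillc 7 (fun c u j => [&& u < cn c, cA c 6 u 0 == 0, fvx c < cn c & cA c 3 (fvx c) u < cn c]) ;;
  fillc 8 (fun c u j => (u < cn c) && ((u == fvx c) ||
    (cA c 6 u 0 != 0) && Ex (cn c) (fun y => (cA c 7 y 0 != 0) && cG c y u))) ;;
  fillc 13 (fun c u j => 0) ;;
  loopc cZ trymask ;;
  fillc 6 (fun c u j => ite (cA c 6 u 0 != 0) (cA c 6 u 0)
    (ite ((u == fvx c) || ((cA c 7 u 0 != 0) && (cA c 13 u 0 != 0))) (cn c * r + u).+1 0)).

Definition ordering : ctx -> ctx := fillc 6 (fun c u j => 0) ;; loopc cn round.

(* Array 14: ranks; array 15: the sets S_v. *)
Definition elim : ctx -> ctx :=
  fillc 14 (fun c u j => Sm (cn c) (fun y => cA c 6 y 0 < cA c 6 u 0)) ;;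
  fillc 15 (fun c v u => 0) ;;
  loopc cn (fun v =>
    fillc 1 (fun c i j => [&& cG c i j, cA c 14 v 0 <= cA c 14 i 0 & cA c 14 v 0 <= cA c 14 j 0]) ;;
    apsp cn ;;
    fillc 15 (fun c x u => ite (x == v)
      [&& u < cn c, cA c 14 u 0 < cA c 14 v 0 &
          Ex (cn c) (fun y => (cA c 3 v y < cn c) && cG c y u)]
      (cA c 15 x u))).

(** * Codes and their dynamic programming *)

Definition sc (c : ctx) := slots (ww c).
Definition inS (c : ctx) (v u : nat) := cA c 15 v u != 0.
Definition inBag (c : ctx) (v u : nat) := (u == v) || inS c v u.
Definition rk (c : ctx) (v : nat) := cA c 14 v 0.
Definition checks (c : ctx) := [&& 0 < nw c,
  Al (cn c) (fun u => Al (cn c) (fun v => (u != v) ==> (rk c u != rk c v))) &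
  Al (cn c) (fun v => Sm (cn c) (fun u => inS c v u) < sc c)].

Definition ix (c : ctx) (v u : nat) := Sm (cn c) (fun y => (y < u) && inBag c v y).
Definition sq (c : ctx) := mulz c (sc c) (sc c).
(* A code consists of sc^2 digits for the potentials, sc^2 for the relation of
   lying on the same path, sc for the in-degrees and sc for the out-degrees; the
   quotient dK by the corresponding power of bb counts the completed paths. *)
Definition dX (c : ctx) (tau v u z : nat) := dg c tau (mulz c (ix c v u) (sc c) + ix c v z).
Definition dE (c : ctx) (tau v u z : nat) :=
  dg c tau (sq c + (mulz c (ix c v u) (sc c) + ix c v z)) != 0.
Definition dI (c : ctx) (tau v u : nat) := dg c tau (sq c + sq c + ix c v u).
Definition dO (c : ctx) (tau v u : nat) := dg c tau (sq c + sq c + (sc c + ix c v u)).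
Definition dK (c : ctx) (tau : nat) := cA c 5 (sq c + sq c + (sc c + sc c)) tau.

Definition AlB (c : ctx) (v : nat) (P : nat -> bool) := Al (cn c) (fun u => inBag c v u ==> P u).
Definition localv (c : ctx) (v tau : nat) := AlB c v (fun u => dE c tau v u u && AlB c v (fun z =>
  (dE c tau v u z ==> dE c tau v z u) && AlB c v (fun y =>
  [&& (dE c tau v u z && dE c tau v z y) ==> dE c tau v u y,
      dE c tau v u z ==> (dX c tau v u y == dX c tau v z y) &
      dX c tau v u y <= dX c tau v u z + cA c 4 z y]))).
(** The candidates [p] and [q] are the predecessor and the successor of [v] inside its bag; the
    value [cn c] stands for none. An arc contributes to the out-degree of its tail and to the
    in-degree of its head. *)
Definition initv (c : ctx) (v tau : nat) := localv c v tau &&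
  Ex (cn c).+1 (fun p => Ex (cn c).+1 (fun q =>
    [&& (p < cn c) ==> [&& inS c v p, cG c v p, dE c tau v p v & dX c tau v v v == (dX c tau v p p).+1],
        (q < cn c) ==> [&& inS c v q, cG c v q, dE c tau v v q & dX c tau v q q == (dX c tau v v v).+1] &
        AlB c v (fun u => (dI c tau v u == bexp ((u == v) && (p < cn c)) + bexp (u == q)) &&
                          (dO c tau v u == bexp ((u == v) && (q < cn c)) + bexp (u == p)))])).

(** Decreasing rank: a vertex is merged into its parent only after all its own children were merged
    into it. *)
Definition cur (c : ctx) (t : nat) := first (cn c) (fun i => rk c i == cn c - t.+1).
Definition isroot (c : ctx) (v : nat) := Al (cn c) (fun u => ~~ inS c v u).
Definition isparent (c : ctx) (v p : nat) :=
  [&& p < cn c, inS c v p & Al (cn c) (fun u => inS c v u ==> (rk c u <= rk c p))] ||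
  (p == cn c) && isroot c v.
Definition samedigits (c : ctx) (x y : nat) :=
  Al (cZ c) (fun j => (j < sq c + sq c) ==> (dg c x j == dg c y j)).
Definition compat (c : ctx) (v p tv tp : nat) := Al (cn c) (fun u => inS c v u ==>
  Al (cn c) (fun z => inS c v z ==>
    (dX c tv v u z == dX c tp p u z) && (dE c tv v u z == dE c tp p u z))).
(** What is asked of a vertex when it leaves the bags: its arcs are all known by then, and one
    without predecessor begins a path and so must have potential 0. The term [dI = 0] in [merge]
    counts the path at this moment. *)
Definition closed1 (c : ctx) (v tv : nat) :=
  [&& dI c tv v v <= 1, dO c tv v v <= 1 & (dI c tv v v == 0) ==> (dX c tv v v v == 0)].
Definition flags (c : ctx) (v p tv tp tau : nat) := Al (cn c) (fun u => inBag c p u ==>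
  [&& dI c tau p u == dI c tp p u + ite (inS c v u) (dI c tv v u) 0, dI c tau p u <= 1,
      dO c tau p u == dO c tp p u + ite (inS c v u) (dO c tv v u) 0 & dO c tau p u <= 1]).
Definition merge (c : ctx) (v p tau : nat) := Ex (cZ c) (fun tp => Ex (cZ c) (fun tv =>
  [&& cA c 16 p tp != 0, cA c 16 v tv != 0, samedigits c tau tp, compat c v p tv tp,
      closed1 c v tv, flags c v p tv tp tau &
      dK c tau == dK c tp + dK c tv + bexp (dI c tv v v == 0)])).

(* Array 16: the realizable codes at each vertex, and in row cn those of the
   empty bag above all roots. *)
Definition dynprog : ctx -> ctx :=
  fillc 16 (fun c v tau => (dK c tau == 0) &&
    (((v < cn c) && initv c v tau) || (v == cn c))) ;;
  loopc cn (fun t => fillc 16 (fun c p tau =>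
    ite (isparent c (cur c t) p) (merge c (cur c t) p tau) (cA c 16 p tau))).

(** * Clique components and the verdict *)

Definition leader (c : ctx) (v : nat) := Al (cn c) (fun u => (u < v) ==> (cn c <= cA c 4 v u)).
Definition clsize (c : ctx) (v : nat) := Sm (cn c) (fun u => cA c 4 v u < cn c).
(** The inner sum is half the size of the component, rounded up; in a clique an isometric path has
    at most two vertices. Each component is represented by its least vertex. *)
Definition cliques (c : ctx) := Sm (cn c) (fun v =>
  ite (leader c v) (Sm (cn c) (fun i => i + i < clsize c v)) 0).

(** Every array index, the nodes of the flow network included, has to lie below the budget. *)
Definition big (c : ctx) := nnode c < cZ c.
Definition done (c : ctx) := big c && ((dm c <= 1) || checks c).
Definition answer (c : ctx) := ite (dm c <= 1) ((cliques c <= ck c) && (ck c <= cn c))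
  (Ex (cZ c) (fun tau => (cA c 16 (cn c) tau != 0) && (dK c tau == ck c))).

(* Entry (0, 0) tells whether entry (0, 1) is the answer. *)
Definition verdict : ctx -> ctx :=
  fillc 0 (fun c i j => ite ((i == 0) && (j == 0)) (done c)
                       (ite ((i == 0) && (j == 1)) (answer c) 0)).
Definition solve : ctx -> ctx := apsp_graph ;; digits ;; ordering ;; elim ;; dynprog.
Definition run : ctx -> ctx := solve ;; verdict.

(** * Compilation of the algorithm *)

Lemma Ecomp_dm : Ecomp (fun c _ => dm c).
Proof. by rewrite /dm; ecomp. Qed.
Ltac ec_user ::= lazymatch goal with
  | |- Ecomp (fun c v => dm _) => exact Ecomp_dm
  end.
Lemma Ecomp_bb : Ecomp (fun c _ => bb c).
Proof. by rewrite /bb; ecomp. Qed.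

Lemma Sm_bool_le m (P : nat -> bool) : Sm m (fun i => P i) <= m.
Proof.
rewrite /Sm -[leqRHS]card_ord -sum1_card; apply: leq_sum => i _; exact: leq_b1.
Qed.

Lemma bb_bnd c : bb c <= 4 * bnd c.
Proof. by have h : dm c <= cn c by [apply: Sm_bool_le]; rewrite /bb /bnd; lia. Qed.

Lemma Ecomp_mulbb f : Ecomp f -> Ecomp (fun c v => bb c * f c v).
Proof.
by move=> h; apply: (@Ecomp_muln (fun c _ => bb c) f Ecomp_bb h) => c _; apply: bb_bnd.
Qed.
Lemma Ecomp_divb f : Ecomp f -> Ecomp (fun c v => divb c (f c v)).
Proof.
move=> h; rewrite /divb.
apply: (@Ecomp_Sm (fun c _ => cZ c) (fun c i v => bb c * i.+1 <= f c v)); [ecomp | ec_bound |].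
apply: (@Bcomp_leq (fun c v => bb c * (head 0 v).+1) (fun c v => f c (behead v))); last by ecomp.
by apply: (@Ecomp_mulbb (fun c v => (head 0 v).+1)); ecomp.
Qed.
Lemma Ecomp_dg f g : Ecomp f -> Ecomp g -> Ecomp (fun c v => dg c (f c v) (g c v)).
Proof.
move=> hf hg; rewrite /dg; apply: (@Ecomp_sub _ (fun c v => bb c * cA c 5 (g c v).+1 (f c v))).
  by ecomp.
by apply: (@Ecomp_mulbb (fun c v => cA c 5 (g c v).+1 (f c v))); ecomp.
Qed.
Lemma Ecomp_mulz f g : Ecomp f -> Ecomp g -> Ecomp (fun c v => mulz c (f c v) (g c v)).
Proof. by move=> hf hg; rewrite /mulz; ecomp. Qed.
Ltac ec_user ::= lazymatch goal with
  | |- Ecomp (fun c v => dm _) => exact Ecomp_dm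
  | |- Ecomp (fun c v => bb _) => exact Ecomp_bb
  | |- Ecomp (fun c v => divb _ (@?f c v)) => refine (@Ecomp_divb f _)
  | |- Ecomp (fun c v => dg _ (@?f c v) (@?g c v)) => refine (@Ecomp_dg f g _ _)
  | |- Ecomp (fun c v => mulz _ (@?f c v) (@?g c v)) => refine (@Ecomp_mulz f g _ _)
  end.

Lemma Ecomp_slots f : Ecomp f -> Ecomp (fun c v => slots (f c v)).
Proof. by move=> h; rewrite /slots; ecomp. Qed.
Ltac ec_user ::= lazymatch goal with
  | |- Ecomp (fun c v => dm _) => exact Ecomp_dm
  | |- Ecomp (fun c v => bb _) => exact Ecomp_bb
  | |- Ecomp (fun c v => divb _ (@?f c v)) => refine (@Ecomp_divb f _)
  | |- Ecomp (fun c v => dg _ (@?f c v) (@?g c v)) => refine (@Ecomp_dg f g _ _)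
  | |- Ecomp (fun c v => mulz _ (@?f c v) (@?g c v)) => refine (@Ecomp_mulz f g _ _)
  | |- Ecomp (fun c v => slots (@?f c v)) => refine (@Ecomp_slots f _)
  end; cbv beta.

Lemma Ecomp_nw : Ecomp (fun c _ => nw c).
Proof. by rewrite /nw /first /okw /ndig; ecomp. Qed.

Lemma Ecomp_ww : Ecomp (fun c _ => ww c).
Proof. exact: (Ecomp_sub Ecomp_nw (Ecomp_const 1)). Qed.
Lemma Ecomp_fvx : Ecomp (fun c _ => fvx c).
Proof. by rewrite /fvx /first; ecomp. Qed.
Lemma Ecomp_rankW f : Ecomp f -> Ecomp (fun c v => rankW c (f c v)).
Proof. by move=> h; rewrite /rankW; ecomp. Qed.
Lemma Bcomp_resid f g : Ecomp f -> Ecomp g -> Bcomp (fun c v => resid c (f c v) (g c v)).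
Proof. by move=> hf hg; rewrite /resid /cap /inA /inB; ecomp. Qed.
Lemma Ecomp_nxt f : Ecomp f -> Ecomp (fun c v => nxt c (f c v)).
Proof. by move=> h; rewrite /nxt /first /nnode /snk; ecomp. Qed.
Lemma Bcomp_onp f g : Ecomp f -> Ecomp g -> Bcomp (fun c v => onp c (f c v) (g c v)).
Proof. by move=> hf hg; rewrite /onp /nnode /src /snk; ecomp. Qed.
Lemma Bcomp_incut f : Ecomp f -> Bcomp (fun c v => incut c (f c v)).
Proof. by move=> h; rewrite /incut /rch /inA /inB /nnode /src /snk; ecomp. Qed.
Ltac ec_user ::= lazymatch goal with
  | |- Ecomp (fun c v => dm _) => exact Ecomp_dm
  | |- Ecomp (fun c v => bb _) => exact Ecomp_bb
  | |- Ecomp (fun c v => divb _ (@?f c v)) => refine (@Ecomp_divb f _)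
  | |- Ecomp (fun c v => dg _ (@?f c v) (@?g c v)) => refine (@Ecomp_dg f g _ _)
  | |- Ecomp (fun c v => mulz _ (@?f c v) (@?g c v)) => refine (@Ecomp_mulz f g _ _)
  | |- Ecomp (fun c v => slots (@?f c v)) => refine (@Ecomp_slots f _)
  | |- Ecomp (fun c v => nw _) => exact Ecomp_nw
  | |- Ecomp (fun c v => ww _) => exact Ecomp_ww
  | |- Ecomp (fun c v => fvx _) => exact Ecomp_fvx
  | |- Ecomp (fun c v => rankW _ (@?f c v)) => refine (@Ecomp_rankW f _)
  | |- Ecomp (fun c v => nxt _ (@?f c v)) => refine (@Ecomp_nxt f _)
  | |- Bcomp (fun c v => resid _ (@?f c v) (@?g c v)) => refine (@Bcomp_resid f g _ _)
  | |- Bcomp (fun c v => onp _ (@?f c v) (@?g c v)) => refine (@Bcomp_onp f g _ _)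
  | |- Bcomp (fun c v => incut _ (@?f c v)) => refine (@Bcomp_incut f _)
  end; cbv beta.

Lemma Bcomp_goodcut : Bcomp (fun c _ => goodcut c).
Proof. by rewrite /goodcut /w3 /inA /inB; ecomp. Qed.

Lemma Scomp_apspn : Scomp (fun c _ => apsp cn c).
Proof. by apply: Scomp_apsp; [exact: Ecomp_n | rewrite /bnd; lia]. Qed.
Lemma Scomp_apspnode : Scomp (fun c _ => apsp nnode c).
Proof. by apply: Scomp_apsp; rewrite /nnode; [ecomp | rewrite /bnd; lia]. Qed.
Ltac sc_user ::= lazymatch goal with
  | |- Scomp (fun c v => apsp cn _) => exact Scomp_apspn
  | |- Scomp (fun c v => apsp nnode _) => exact Scomp_apspnode
  | |- Bcomp (fun c v => goodcut _) => exact Bcomp_goodcut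
  end.

Lemma Scomp_augment : Scomp (fun c _ => augment c).
Proof. by rewrite /augment /src /snk {2 3}/nnode; scomp. Qed.
Lemma Scomp_mincut : Scomp (fun c _ => mincut c).
Proof.
rewrite /mincut; scomp; first exact: Scomp_augment.
Qed.
Lemma Scomp_trymask : Scomp (fun c v => trymask (head 0 v) c).
Proof. by rewrite /trymask; scomp; exact: Scomp_mincut. Qed.
Lemma Scomp_round : Scomp (fun c v => round (head 0 v) c).
Proof. by rewrite /round; scomp; exact: Scomp_trymask. Qed.
Lemma Scomp_ordering : Scomp (fun c _ => ordering c).
Proof. by rewrite /ordering; scomp; exact: Scomp_round. Qed.
Lemma Scomp_elim : Scomp (fun c _ => elim c).
Proof. by rewrite /elim; scomp. Qed.

Lemma Ecomp_sc : Ecomp (fun c _ => sc c).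
Proof. by rewrite /sc; ecomp. Qed.
Lemma Bcomp_inS f g : Ecomp f -> Ecomp g -> Bcomp (fun c v => inS c (f c v) (g c v)).
Proof. by move=> hf hg; rewrite /inS; ecomp. Qed.
Lemma Bcomp_inBag f g : Ecomp f -> Ecomp g -> Bcomp (fun c v => inBag c (f c v) (g c v)).
Proof. by move=> hf hg; rewrite /inBag /inS; ecomp. Qed.
Lemma Ecomp_ix f g : Ecomp f -> Ecomp g -> Ecomp (fun c v => ix c (f c v) (g c v)).
Proof. by move=> hf hg; rewrite /ix /inBag /inS; ecomp. Qed.
Lemma Ecomp_sq : Ecomp (fun c _ => sq c).
Proof. by apply: (Ecomp_mulz Ecomp_sc Ecomp_sc). Qed.
Ltac ec_user ::= lazymatch goal with
  | |- Ecomp (fun c v => dm _) => exact Ecomp_dm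
  | |- Ecomp (fun c v => bb _) => exact Ecomp_bb
  | |- Ecomp (fun c v => dg _ (@?f c v) (@?g c v)) => refine (@Ecomp_dg f g _ _)
  | |- Ecomp (fun c v => mulz _ (@?f c v) (@?g c v)) => refine (@Ecomp_mulz f g _ _)
  | |- Ecomp (fun c v => nw _) => exact Ecomp_nw
  | |- Ecomp (fun c v => sc _) => exact Ecomp_sc
  | |- Ecomp (fun c v => sq _) => exact Ecomp_sq
  | |- Ecomp (fun c v => ix _ (@?f c v) (@?g c v)) => refine (@Ecomp_ix f g _ _)
  | |- Bcomp (fun c v => inS _ (@?f c v) (@?g c v)) => refine (@Bcomp_inS f g _ _)
  | |- Bcomp (fun c v => inBag _ (@?f c v) (@?g c v)) => refine (@Bcomp_inBag f g _ _)
  end; cbv beta.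
Lemma Ecomp_dX f1 f2 f3 f4 : Ecomp f1 -> Ecomp f2 -> Ecomp f3 -> Ecomp f4 ->
  Ecomp (fun c v => dX c (f1 c v) (f2 c v) (f3 c v) (f4 c v)).
Proof. by move=> h1 h2 h3 h4; rewrite /dX; ecomp. Qed.
Lemma Bcomp_dE f1 f2 f3 f4 : Ecomp f1 -> Ecomp f2 -> Ecomp f3 -> Ecomp f4 ->
  Bcomp (fun c v => dE c (f1 c v) (f2 c v) (f3 c v) (f4 c v)).
Proof. by move=> h1 h2 h3 h4; rewrite /dE; ecomp. Qed.
Lemma Ecomp_dI f1 f2 f3 : Ecomp f1 -> Ecomp f2 -> Ecomp f3 ->
  Ecomp (fun c v => dI c (f1 c v) (f2 c v) (f3 c v)).
Proof. by move=> h1 h2 h3; rewrite /dI; ecomp. Qed.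
Lemma Ecomp_dO f1 f2 f3 : Ecomp f1 -> Ecomp f2 -> Ecomp f3 ->
  Ecomp (fun c v => dO c (f1 c v) (f2 c v) (f3 c v)).
Proof. by move=> h1 h2 h3; rewrite /dO; ecomp. Qed.
Lemma Ecomp_dK f : Ecomp f -> Ecomp (fun c v => dK c (f c v)).
Proof. by move=> h; rewrite /dK; ecomp. Qed.
Ltac ec_user ::= lazymatch goal with
  | |- Ecomp (fun c v => bexp (@?P c v)) => change (Bcomp P)
  | |- Ecomp (fun c v => dm _) => exact Ecomp_dm
  | |- Ecomp (fun c v => dg _ (@?f c v) (@?g c v)) => refine (@Ecomp_dg f g _ _)
  | |- Ecomp (fun c v => nw _) => exact Ecomp_nw
  | |- Ecomp (fun c v => sc _) => exact Ecomp_sc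
  | |- Ecomp (fun c v => sq _) => exact Ecomp_sq
  | |- Bcomp (fun c v => inS _ (@?f c v) (@?g c v)) => refine (@Bcomp_inS f g _ _)
  | |- Bcomp (fun c v => inBag _ (@?f c v) (@?g c v)) => refine (@Bcomp_inBag f g _ _)
  | |- Ecomp (fun c v => dX _ (@?f c v) (@?g c v) (@?h c v) (@?k c v)) =>
      refine (@Ecomp_dX f g h k _ _ _ _)
  | |- Bcomp (fun c v => dE _ (@?f c v) (@?g c v) (@?h c v) (@?k c v)) =>
      refine (@Bcomp_dE f g h k _ _ _ _)
  | |- Ecomp (fun c v => dI _ (@?f c v) (@?g c v) (@?h c v)) => refine (@Ecomp_dI f g h _ _ _)
  | |- Ecomp (fun c v => dO _ (@?f c v) (@?g c v) (@?h c v)) => refine (@Ecomp_dO f g h _ _ _)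
  | |- Ecomp (fun c v => dK _ (@?f c v)) => refine (@Ecomp_dK f _)
  end; cbv beta.
Lemma Bcomp_initv f g : Ecomp f -> Ecomp g -> Bcomp (fun c v => initv c (f c v) (g c v)).
Proof. by move=> hf hg; rewrite /initv /localv /AlB; ecomp. Qed.
Lemma Ecomp_cur f : Ecomp f -> Ecomp (fun c v => cur c (f c v)).
Proof. by move=> hf; rewrite /cur /first /rk; ecomp. Qed.
Lemma Bcomp_isparent f g : Ecomp f -> Ecomp g -> Bcomp (fun c v => isparent c (f c v) (g c v)).
Proof. by move=> hf hg; rewrite /isparent /isroot /rk; ecomp. Qed.
Lemma Bcomp_merge f1 f2 f3 : Ecomp f1 -> Ecomp f2 -> Ecomp f3 ->
  Bcomp (fun c v => merge c (f1 c v) (f2 c v) (f3 c v)).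
Proof.
by move=> h1 h2 h3; rewrite /merge /samedigits /compat /closed1 /flags; ecomp.
Qed.
Ltac ec_user ::= lazymatch goal with
  | |- Ecomp (fun c v => bexp (@?P c v)) => change (Bcomp P)
  | |- Ecomp (fun c v => dm _) => exact Ecomp_dm
  | |- Ecomp (fun c v => divb _ (@?f c v)) => refine (@Ecomp_divb f _)
  | |- Ecomp (fun c v => nw _) => exact Ecomp_nw
  | |- Ecomp (fun c v => sc _) => exact Ecomp_sc
  | |- Bcomp (fun c v => inS _ (@?f c v) (@?g c v)) => refine (@Bcomp_inS f g _ _)
  | |- Ecomp (fun c v => dK _ (@?f c v)) => refine (@Ecomp_dK f _)
  | |- Ecomp (fun c v => cur _ (@?f c v)) => refine (@Ecomp_cur f _)
  | |- Bcomp (fun c v => initv _ (@?f c v) (@?g c v)) => refine (@Bcomp_initv f g _ _)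
  | |- Bcomp (fun c v => isparent _ (@?f c v) (@?g c v)) => refine (@Bcomp_isparent f g _ _)
  | |- Bcomp (fun c v => merge _ (@?f c v) (@?g c v) (@?h c v)) => refine (@Bcomp_merge f g h _ _ _)
  end; cbv beta.
Lemma Bcomp_done : Bcomp (fun c _ => done c).
Proof. by rewrite /done /big /nnode /checks /rk; ecomp. Qed.
Lemma Ecomp_answer : Ecomp (fun c _ => answer c).
Proof. by rewrite /answer /cliques /leader /clsize; ecomp. Qed.

Lemma Scomp_run : Scomp (fun c _ => run c).
Proof.
rewrite /run /solve /verdict /apsp_graph /digits /dynprog; scomp; first exact: Scomp_ordering.
- exact: Scomp_elim.
- exact: Bcomp_done.
- exact: Ecomp_answer.
Qed.

(** * Doubling the budget *)

Definition adjn (n : nat) (G : sgraph 'I_n) (i j : nat) : bool :=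
  [exists a : 'I_n, exists b : 'I_n, [&& val a == i, val b == j & G a b]].

Lemma adjnE n (G : sgraph 'I_n) (a b : 'I_n) : adjn G a b = G a b.
Proof.
apply/existsP/idP => [[a' /existsP[b' /and3P[/eqP/val_inj<- /eqP/val_inj<-]]]//|h].
by exists a; apply/existsP; exists b; rewrite !eqxx.
Qed.

Lemma adjn_out n (G : sgraph 'I_n) i j : ~~ ((i < n) && (j < n)) -> adjn G i j = false.
Proof.
move=> h; apply/negbTE/existsP => -[a /existsP[b /and3P[/eqP ai /eqP bj _]]].
by move: h; rewrite -ai -bj !ltn_ord.
Qed.

Lemma adj_matrixE n (G : sgraph 'I_n) i j : i < n -> j < n ->
  adj_matrix G (i * n + j) = adjn G i j.
Proof.
move=> hi hj; rewrite -[i]/(val (Ordinal hi)) -[j]/(val (Ordinal hj)) adjnE.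
congr nat_of_bool; apply/existsP/idP => [[a /existsP[b /andP[/eqP E ab]]]|h].
  have nj : val b = j.
    have := congr1 (modn^~ n) E; rewrite /= !modnMDl !modn_small //.
  have ni : val a = i.
    move: E; rewrite /= nj => /addIn /eqP; rewrite eqn_pmul2r; last by apply: leq_trans hj.
    by move/eqP.
  suff [<- <-] : a = Ordinal hi /\ b = Ordinal hj by [].
  by split; apply: val_inj.
by exists (Ordinal hi); apply/existsP; exists (Ordinal hj); rewrite eqxx.
Qed.

Record based (n k : nat) (G : sgraph 'I_n) (s : state) : Prop := Based {
  based_n : reg s 0 = n;
  based_k : reg s 1 = k;
  based_N : reg s 2 = n * n;
  based_in : forall i j, i < n -> j < n -> dmem s (i * n + j) = adjn G i j }.

(** When the budget changes, the memory behind the input is reinterpreted with a new stride, so the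
    arrays hold arbitrary values. This is why [ram_main] quantifies over all [A]. *)
Lemma based_rep n k (G : sgraph 'I_n) s : based k G s ->
  exists A, rep (Ctx n k (adjn G) (reg s 3) A) s.
Proof.
case=> b0 b1 b2 b3; exists (fun a i j => if [&& a < narr, i < reg s 3 & j < reg s 3] then
  dmem s (addr n (reg s 3) a i j) else 0).
split=> //= [i j|a i j -> -> ->//|a i j /negbTE->//]; exact: adjn_out.
Qed.

Definition main_loop (prun pflag : com) : com :=
  While 4 (Seq (Add 3 3 3) (Seq prun (Seq pflag (Seq (Const 4 0) (Add 4 4 5))))).

(** The final budget is at most about [2 * Z0], and a crude count of [Z0 + 1] rounds is enough for a
    polynomial bound. Correct answers are required of every budget that reports success, success
    only of those from [Z0] on. *)
Theorem ram_main (F : ctx -> ctx) : Scomp (fun c _ => F c) -> exists (p : com) (D : nat),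
  forall n (G : sgraph 'I_n) k (Q : Prop) Z0,
  (forall Z A, let c := F (Ctx n k (adjn G) Z A) in
     (cA c 0 0 0 != 0 -> cA c 0 0 1 = `[< Q >]) /\ (Z0 <= Z -> cA c 0 0 0 != 0)) ->
  exists t, decides_in p (input G k) Q t /\ t <= (2 * Z0 + n + 4) ^ D.
Proof.
move=> [shrun [D1 hrun]].
have [D2 hflag] : Ecomp (fun c _ => 1 - cA c 0 0 0) by ecomp.
have [D3 hans] : Ecomp (fun c _ => cA c 0 0 1) by ecomp.
have [prun hprun] := hrun [::] 5 isT isT.
have [pflag hpflag] := hflag [::] 5 isT isT.
have [pans hpans] := hans [::] 5 isT isT.
exists (Seq (forc 5 0 (Add 2 2 0)) (Seq (Const 3 1) (Seq (Const 4 1)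
  (Seq (main_loop prun pflag) (Seq pans (Seq (Const 0 0) (Add 0 0 5))))))).
exists ((D1 + D2 + 1) + D3 + 10) => n G k Q Z0 H.
set B := 2 * Z0 + n + 4.
have B1 : 1 < B by rewrite /B; lia.
pose T := B ^ D1 + B ^ D2 + 4.
have bndB c : cn c = n -> cZ c <= 2 * Z0 + 2 -> forall D, bnd c ^ D <= B ^ D.
  move=> cnn cz D; case: D => // D; rewrite leq_exp2r // /bnd /B; lia.
(* The last budget is the double of one that was below [Z0] or equal to the initial 1, hence the
   summand 2. *)
pose fin s := exists Z A, [/\ rep (F (Ctx n k (adjn G) Z A)) s, Z <= 2 * Z0 + 2 &
  cA (F (Ctx n k (adjn G) Z A)) 0 0 0 != 0].
have loop : forall m s, based k G s -> reg s 4 = 1 -> 0 < reg s 3 ->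
    (reg s 3 <= Z0) || (reg s 3 <= 1) -> Z0 - reg s 3 <= m ->
    exists s' t, [/\ exec (main_loop prun pflag) s t s', fin s' & t <= m.+1 * (T + 1) + 1].
  { elim=> [|m IH] s bs r4 r3 hz hm.
  all: pose s1 := set_reg s 3 (reg s 3 + reg s 3).
  all: have bs1 : based k G s1 by case: bs => *; split.
  all: have [A rc] := based_rep bs1.
  all: have hz1 : reg s1 3 = reg s 3 + reg s 3 by rewrite reg_set.
  all: set c := Ctx _ _ _ _ _ in rc.
  all: have hcz : cZ c <= 2 * Z0 + 2 by rewrite /c /= /upd /=; lia.
  all: have [s2 [t2 [e2 rc2 q2 le2]]] := hprun c s1 rc.
  all: have [s3 [t3 [e3 m3 q3 r3' le3]]] := hpflag _ s2 rc2.
  all: pose s4 := set_reg s3 4 0.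
  all: pose s5 := set_reg s4 4 (reg s4 4 + reg s4 5).
  all: have E5 : reg s5 4 = 1 - cA (F c) 0 0 0 by rewrite /s5 reg_set /= /upd /= r3'.
  all: have rc5 : rep (F c) s5
    by (apply: (@rep_eqr _ s2 s5 4 isT rc2) => [|r rlt]; [exact: m3 |
        rewrite /s5 /s4 !reg_setN ?q3 //; lia]).
  all: have ex5 : exec (Seq (Add 3 3 3) (Seq prun (Seq pflag (Seq (Const 4 0) (Add 4 4 5)))))
      s (1 + (t2 + (t3 + (1 + 1)))) s5
    by do !(apply: ExecSeq; [by eassumption || by constructor |]); constructor.
  all: have [shn _ _ shz] := shrun c [::].
  all: have leT : 1 + (t2 + (t3 + (1 + 1))) <= T
    by (have := bndB c erefl hcz D1; have := bndB (F c) shn _ D2; rewrite shz => /(_ hcz);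
        rewrite /T; lia).
  all: have [hdone hZ] := H (reg s1 3) A.
  all: case E : (cA (F c) 0 0 0 != 0).
  - exists s5, (1 + (t2 + (t3 + (1 + 1))) + 1).+1; split.
    + apply: ExecWhileTrue ex5 _; first by rewrite r4.
      by apply: ExecWhileFalse; rewrite E5; lia.
    + by exists (reg s1 3), A; split.
    + lia.
  - by have := hZ (_ : Z0 <= reg s1 3); rewrite -/c E => h; have : false by apply: h; rewrite hz1; lia.
  - exists s5, (1 + (t2 + (t3 + (1 + 1))) + 1).+1; split.
    + apply: ExecWhileTrue ex5 _; first by rewrite r4.
      by apply: ExecWhileFalse; rewrite E5; lia.
    + by exists (reg s1 3), A; split.
    + by move: leT; rewrite !mulSn; clear; lia.
  - have hlt : reg s1 3 < Z0.
      by rewrite ltnNge; apply/negP => /hZ; rewrite -/c E.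
    have E53 : reg s5 3 = reg s1 3 by case: rc5 => _ _ _ -> _ _ _ _; rewrite shz.
    have [|||||s6 [t6 [e6 f6 le6]]] := IH s5.
    + have [_ shk shG _] := shrun c [::].
      by case: rc5; rewrite shn shk shG => ? ? ? _ ? _ _ _; split.
    + by rewrite E5; lia.
    + by rewrite E53 hz1; lia.
    + by rewrite E53; lia.
    + by rewrite E53 hz1; lia.
    exists s6, (1 + (t2 + (t3 + (1 + 1))) + t6).+1; split=> //.
      by apply: ExecWhileTrue ex5 e6; rewrite r4.
    by move: leT le6; rewrite [m.+2 * _]mulSn; clear; lia. }
(* Register 2 receives [n * n] by repeated addition. *)
pose I i (s : state) := [/\ reg s 0 = n, reg s 1 = k, reg s 2 = i * n &
  dmem s = adj_matrix G].
have [|||||s1 [t1 [e1 [i0 i1 i2 i3] le1]]] :=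
    @exec_for I 5 0 (Add 2 2 0) n 1 (input G k).
- by [].
- by [].
- by move=> i sa sb [j0 j1 j2 j3] em er; split; rewrite ?em // er.
- by split=> //=; rewrite mul0n.
- move=> i s im [j0 j1 j2 j3] r5 r0.
  exists (set_reg s 2 (reg s 2 + reg s 0)), 1; split=> //; first by constructor.
  by split=> //; rewrite reg_set j2 j0 mulSn addnC.
pose s2 := set_reg s1 3 1.
pose s3 := set_reg s2 4 1.
have [|||||s4 [t4 [e4 [Z [A [rc hz hd]]] le4]]] := loop Z0 s3.
- by split=> // i j hi hj; rewrite /s3 /s2 /= i3 adj_matrixE.
- by rewrite reg_set.
- by [].
- by rewrite /s3 /s2 /= /upd /=; apply: orbT.
- by rewrite leq_subr.
have [s5 [t5 [e5 m5 q5 r5 le5]]] := hpans _ s4 rc.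
pose s6 := set_reg s5 0 0.
pose s7 := set_reg s6 0 (reg s6 0 + reg s6 5).
exists (t1 + (1 + (1 + (t4 + (t5 + (1 + 1)))))); split.
  exists s7; split.
    by do !(apply: ExecSeq; [by eassumption || by constructor |]); constructor.
  rewrite /s7 reg_set /= /upd /= r5.
  by have [hdone _] := H Z A; apply: hdone.
have [shn _ _ shz] := shrun (Ctx n k (adjn G) Z A) [::].
have h5 : t5 <= B ^ D3 by apply: leq_trans le5 _; apply: bndB; rewrite ?shn ?shz.
have hn : n * 5 + 3 <= B ^ 4.
  have : n + 4 <= B by rewrite /B; lia.
  have : B * 8 <= B ^ 4 by rewrite expnS leq_mul2l -[8]/(2 ^ 3) leq_exp2r ?B1 ?orbT.
  by move: (B ^ 4); lia.
have h4 : t4 <= B ^ (D1 + D2 + 1 + 5).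
  apply: leq_trans le4 _.
  have hT : T <= B ^ (D1 + D2 + 1) + 4 by have := expn_sum2 D1 D2 B1; rewrite /T; lia.
  have hB : Z0.+1 + 2 <= B by rewrite /B; lia.
  have hP : 0 < B ^ (D1 + D2 + 1) by rewrite expn_gt0; lia.
  have h32 : 16 <= B ^ 4 by rewrite -[16]/(2 ^ 4) leq_exp2r.
  rewrite expnD expnS; move: (B ^ (D1 + D2 + 1)) (B ^ 4) hT hP h32 => P R hT hP h32.
  apply: (@leq_trans (B * (P + 5) + 1)); first by rewrite leq_add2r leq_mul; lia.
  apply: (@leq_trans (P * (B * 16))); first by clear -hP B1; nia.
  by rewrite !leq_mul2l h32 !orbT.
have h10 : 9 <= B ^ 4.
  by apply: (@leq_trans (2 ^ 4)) => //; rewrite leq_exp2r.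
have hA := expn_sum2 (D1 + D2 + 1 + 5) D3 B1.
have hR : 1 < B ^ (D1 + D2 + 1 + 5 + D3 + 1).
  by apply: (@leq_trans (B ^ 1)); [rewrite expn1 | rewrite leq_pexp2l; lia].
have -> : D1 + D2 + 1 + D3 + 10 = (D1 + D2 + 1 + 5 + D3 + 1) + 4 by lia.
rewrite expnD.
have h16 : 16 <= B ^ 4 by rewrite -[16]/(2 ^ 4) leq_exp2r.
move: hA hR hn h5 h4 h16 le1.
move: (B ^ (D1 + D2 + 1 + 5 + D3 + 1)) (B ^ 4) (B ^ D3) (B ^ (D1 + D2 + 1 + 5)) => R P U V.
move=> hA hR hn h5 h4 h16 le1.
have hPR : P + R + 4 <= R * P by clear -hR h16; nia.
by apply: leq_trans hPR; lia.
Qed.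

(** * Distances *)

Lemma partition_card_le (T : finType) (P : {set {set T}}) (A : {set T}) :
  partition P A -> #|P| <= #|A|.
Proof.
move=> Pp; rewrite (card_partition Pp) -sum1_card; apply: leq_sum => B BP.
by rewrite card_gt0; apply: contraTneq BP => ->; have /and3P[] := Pp.
Qed.

(** For a property closed downwards the sum is the length of the initial segment where it holds. All
    maxima, quotients and searches of the program are read through this fact. *)
Lemma sum_threshold (n : nat) (Q : nat -> bool) i :
  (forall i j, i <= j -> Q j -> Q i) -> (i < \sum_(t < n) Q t) = (i < n) && Q i.
Proof.
move=> mono; elim: n => [|n IH]; first by rewrite big_ord0 !ltn0.
rewrite big_ord_recr /=.
case Qn : (Q n); last first.
  rewrite addn0 IH; case Qi : (Q i); rewrite ?andbF // !andbT.
  by case: (eqVneq i n) Qi => [->|ne _]; [rewrite Qn | rewrite ltnS ltn_neqAle ne].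
have -> : \sum_(t < n) Q t = n.
  rewrite (eq_bigr (fun _ => 1)) ?sum1_card ?card_ord // => t _.
  by rewrite (mono _ n) //; exact: ltnW.
rewrite addn1; case: (ltnP i n.+1) => //= h.
by rewrite (mono _ n).
Qed.

Lemma sum_find (n : nat) (P : nat -> bool) :
  \sum_(t < n) [forall j : 'I_n, (j <= t) ==> ~~ P j] = find P (iota 0 n).
Proof.
set Q := fun t : nat => [forall j : 'I_n, (j <= t) ==> ~~ P j].
have mono i j : i <= j -> Q j -> Q i.
  move=> ij /forallP h; apply/forallP => k; apply/implyP => ki.
  by have /implyP := h k; apply; apply: leq_trans ij.
have fle : find P (iota 0 n) <= n by rewrite -[leqRHS](size_iota 0 n) find_size.
apply/eqP; rewrite eqn_leq; apply/andP; split; rewrite leqNgt.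
  rewrite (@sum_threshold n Q) //; apply/negP => /andP[fn /forallP/(_ (Ordinal fn)) /=].
  rewrite leqnn /= => /negP; apply.
  have := nth_find 0 (s := iota 0 n) (a := P).
  by rewrite nth_iota // add0n; apply; rewrite has_find size_iota.
case E : (find P (iota 0 n)) => [|f]; first by rewrite ltn0.
rewrite ltnS -ltnNge (@sum_threshold n Q) // -ltnS -E; rewrite E in fle; rewrite E.
apply/andP; split; first lia.
apply/forallP => j; apply/implyP => jf; apply/negP => Pj.
have := @before_find _ 0 P (iota 0 n) j; rewrite E nth_iota // add0n Pj.
by move/(_ jf).
Qed.

Section Dist.
Variables (T : finType) (r : rel T).

Fixpoint ball (t : nat) (x y : T) : bool :=
  if t is t'.+1 then ball t' x y || [exists z, ball t' x z && r z y] else x == y.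

(** The number of radii whose ball misses [y]: the distance from [x] to [y], and [#|T|] when [y] is
    unreachable. The program computes it in this form. *)
Definition dd (x y : T) : nat := \sum_(t < #|T|) ~~ ball t x y.

Lemma ballP t x y :
  reflect (exists p, [/\ path r x p, last x p = y & size p <= t]) (ball t x y).
Proof.
apply: (iffP idP) => [|[p [pp <-]]].
  elim: t y => /= [|t IH] y; first by move/eqP->; exists [::].
  case/orP => [/IH[p [pp lp sp]]|/existsP[z /andP[/IH[p [pp lp sp]] rzy]]].
    by exists p; split=> //; apply: leqW.
  exists (rcons p y); rewrite rcons_path last_rcons size_rcons pp lp rzy; split=> //.
elim: t p pp => [|t IH] p; first by case: p => //= _ _; rewrite eqxx.
case/lastP: p => [_ _ /=|p z].
  by have := IH [::] isT isT => /= ->.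
rewrite rcons_path last_rcons size_rcons ltnS /= => /andP[pp rz] sp.
by apply/orP; right; apply/existsP; exists (last x p); rewrite rz andbT IH.
Qed.

Lemma ball_mono x y i j : i <= j -> ball i x y -> ball j x y.
Proof.
by move=> ij /ballP[p [pp lp sp]]; apply/ballP; exists p; split=> //; apply: leq_trans ij.
Qed.

Lemma dd_leT x y : dd x y <= #|T|.
Proof.
apply: (@leq_trans (\sum_(t < #|T|) 1)); last by rewrite sum1_card card_ord.
by apply: leq_sum => i _; exact: leq_b1.
Qed.

Lemma dd_le x y t : t < #|T| -> (dd x y <= t) = ball t x y.
Proof.
move=> tT; rewrite leqNgt /dd (@sum_threshold _ (fun t => ~~ ball t x y)) ?tT ?negbK //.
by move=> i j ij; apply: contra; apply: ball_mono.
Qed.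

Lemma dd_connect x y : (dd x y < #|T|) = connect r x y.
Proof.
have T0 : 0 < #|T| by apply/card_gt0P; exists x.
apply/idP/connectP => [|[p pp ->]].
  by rewrite -(ltn_predK T0) ltnS dd_le ?ltn_predL // => /ballP[p [pp <- _]]; exists p.
case: (shortenP pp) => p' pp' up' _.
rewrite -(ltn_predK T0) ltnS dd_le ?ltn_predL //; apply/ballP; exists p'; split=> //.
rewrite -ltnS (ltn_predK T0) -[(size p').+1]/(size (x :: p')).
by rewrite -(card_uniqP up') max_card.
Qed.

Lemma dd_path x p : path r x p -> dd x (last x p) <= size p.
Proof.
move=> pp; case: (ltnP (size p) #|T|) => [sp|]; last by apply: leq_trans (dd_leT _ _).
by rewrite dd_le //; apply/ballP; exists p.
Qed.

Lemma dd_ex x y : connect r x y -> exists p, [/\ path r x p, last x p = y & size p = dd x y].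
Proof.
rewrite -dd_connect => h; have := leqnn (dd x y); rewrite dd_le //.
move=> /ballP[p [pp lp sp]]; exists p; split=> //; apply/eqP; rewrite eqn_leq sp.
by rewrite -lp dd_path.
Qed.

Lemma dd_refl x : dd x x = 0.
Proof. by apply/eqP; rewrite -leqn0; apply: (@dd_path x [::]). Qed.

Lemma dd_triangle x y z : dd x z <= dd x y + dd y z.
Proof.
case cxy : (connect r x y); last first.
  by move: cxy; rewrite -dd_connect; have := dd_leT x z; lia.
case cyz : (connect r y z); last first.
  by move: cyz; rewrite -dd_connect; have := dd_leT x z; lia.
have [p [pp lp <-]] := dd_ex cxy; have [q [pq lq <-]] := dd_ex cyz.
by rewrite -size_cat -lq -lp -last_cat dd_path // cat_path pp lp.
Qed.

Lemma dd_edge x y : r x y -> dd x y <= 1.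
Proof. by move=> h; apply: (@dd_path x [:: y]); rewrite /= h. Qed.

Lemma dd_eq0 x y : dd x y = 0 -> x = y.
Proof.
have T0 : 0 < #|T| by apply/card_gt0P; exists x.
by move=> E; have := dd_le x y T0; rewrite E /= => /esym /eqP.
Qed.

Hypothesis rs : symmetric r.

Lemma ddC x y : dd x y = dd y x.
Proof.
wlog suff : x y / dd x y <= dd y x by move=> h; apply/eqP; rewrite eqn_leq !h.
case cyx : (connect r y x); last first.
  by move: cyx; rewrite -dd_connect; have := dd_leT x y; lia.
have [p [pp lp <-]] := dd_ex cyx.
have -> : size p = size (rev (belast y p)) by rewrite size_rev size_belast.
have E : y = last x (rev (belast y p)).
  by case: p lp {pp} => [//|a p] /= _; rewrite rev_cons last_rcons.
rewrite [in dd x _]E; apply: dd_path; rewrite -lp rev_path.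
by rewrite (eq_path (e' := r)) // => a b; rewrite rs.
Qed.

End Dist.

Section GraphDist.
Variables (T : finType) (G : sgraph T).
Local Notation d := (dd G).

(** A walk as short as the distance cannot repeat a vertex: shortening it to a simple path with the
    same ends would make it shorter. *)
Lemma isometricP (x : T) (s : seq T) :
  isometric G x s <-> path G x s /\ size s = d x (last x s).
Proof.
split=> [[/andP[pp us] min]|[pp sz]].
  split=> //; apply/eqP; rewrite eqn_leq dd_path // andbT.
  have [|p [pq lq <-]] := @dd_ex _ G x (last x s); first by apply/connectP; exists s.
  case: (shortenP pq) lq => p' pp' up' sub lq.
  apply: leq_trans (min p' _ lq) _; first by rewrite /gpath pp'.
  by apply: uniq_leq_size; [case/andP: up' | move=> z /sub].
have us : uniq (x :: s).
  case: (shortenP pp) sz (erefl (last x s)) => p' pp' up' sub sz _.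
  have les : size s <= size p' by rewrite sz dd_path.
  suff /perm_uniq-> : perm_eq (x :: s) (x :: p') by [].
  have /andP[_ up] := up'.
  rewrite perm_cons; rewrite perm_sym; apply: uniq_perm => //.
    by apply: (leq_size_uniq up) => // z /sub.
  by have [_] := uniq_min_size up (fun z => @sub z) les.
split; first by rewrite /gpath pp.
by move=> s' /andP[ps' _] ls; rewrite sz -ls dd_path.
Qed.

(** Needed in this direction: the running time, stated with [diam], must dominate the distances that
    the program computes. *)
Lemma dd_le_dist x y : connect G x y -> d x y <= dist G x y.
Proof.
move=> cxy; rewrite /dist; set P := fun d => _; set f := find P _.
case: (ltnP f #|T|) => [fT|]; last by apply: leq_trans (dd_leT _ _ _).
have : P (nth 0 (iota 0 #|T|) f) by apply: nth_find; rewrite has_find size_iota.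
rewrite nth_iota // add0n => /existsP[s /andP[/andP[ps _] /eqP <-]].
by have := dd_path ps; rewrite size_tuple.
Qed.

Lemma dd_le_diam x y : connect G x y -> d x y <= diam G.
Proof.
move=> cxy; apply: leq_trans (dd_le_dist cxy) _; rewrite /diam.
apply: leq_trans (leq_bigmax x).
by apply: (@leq_bigmax_cond _ _ (fun y => dist G x y)).
Qed.

End GraphDist.

(** * Balanced separators *)

(** Edges meeting X disappear but its vertices remain, so a vertex of X is connected to itself
    only. *)
Definition rdel (T : finType) (r : rel T) (X : {set T}) : rel T :=
  [rel a b | [&& r a b, a \notin X & b \notin X]].

Lemma rdelE (T : finType) (r : rel T) X a b :
  rdel r X a b = [&& r a b, a \notin X & b \notin X].
Proof. by []. Qed.

Lemma rdel_sym (T : finType) (r : rel T) X : symmetric r -> symmetric (rdel r X).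
Proof. by move=> rs a b; rewrite /rdel /= [r a b]rs [(a \notin X) && _]andbC. Qed.

Lemma connect_rdel_sub (T : finType) (r : rel T) X : subrel (connect (rdel r X)) (connect r).
Proof. by apply: connect_sub => a b /= /andP[rab _]; apply: connect1. Qed.

Lemma connect_rdel_notin (T : finType) (r : rel T) X a b :
  connect (rdel r X) a b -> a != b -> (a \notin X) && (b \notin X).
Proof.
case/connectP => p; case: p => [_ ->|c p]; first by rewrite eqxx.
move=> pp -> _; apply/andP; split; first by case/andP: pp => /and3P[].
by move: pp; rewrite lastI rcons_path last_rcons => /andP[_ /and3P[]].
Qed.

Section Tree.
Variables (U : finType) (F : sgraph U).
Hypothesis Ft : is_tree F.

Lemma tree_edge_cut u v : F u v ->
  ~~ connect [rel a b | [&& F a b, (a, b) != (u, v) & (a, b) != (v, u)]] u v.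
Proof.
case: Ft => _ _ noc Fuv; apply/negP => /connectP[p pp lp].
case: (shortenP pp) lp => q pq uq _ lq.
apply: (noc (u :: q)).
  case: q pq uq lq => [|a [|b q]] //=.
    by move=> _ _ E; move: Fuv; rewrite E adj_irr.
  by move=> /andP[/and3P[_ ne _] _] _ E; rewrite -E eqxx in ne.
rewrite /ucycle uq andbT /= rcons_path -lq adj_sym Fuv andbT.
by apply: sub_path pq => a b /and3P[].
Qed.

(** An orbit of [f] ends in a period. Length 1 is excluded by irreflexivity and length at least 3
    would be a cycle of the tree, so the period is 2. *)
Lemma tree_walk_turns (f : U -> U) : (forall u, F u (f u)) -> exists u, f (f u) = u.
Proof.
case: Ft => /card_gt0P[x0 _] _ noc hf.
set n := order f x0.
have /trajectP[i ni Ei] : looping f x0 n by apply: looping_order.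
pose y := iter i f x0; pose m := n - i.
have m0 : 0 < m by rewrite subn_gt0.
have Ey : iter m f y = y by rewrite /y -iterD subnK ?Ei // ltnW.
have ut : uniq (traject f y m).
  have := orbit_uniq f x0; rewrite /orbit -/n -(subnKC (ltnW ni)) -/m trajectD cat_uniq.
  by case/and3P.
have pt : path F y (traject f (f y) m).
  by have := fpath_traject f y m; apply: sub_path => a b /eqP <-.
case Em : m m0 => [//|[|[|k]]] _.
- by move: Ey (hf y); rewrite Em /= => ->; rewrite adj_irr.
- by exists y; move: Ey; rewrite Em.
case: (noc (traject f y m)); first by rewrite size_traject Em.
rewrite /ucycle ut andbT; move: pt; rewrite Em /= .
have -> : rcons (traject f (f (f (f y))) k) y = traject f (f (f (f y))) k.+1.
  by rewrite trajectSr -!iterSr -[in RHS]Em [in RHS]Em; move: Ey; rewrite Em => ->.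
by [].
Qed.

End Tree.

Section Separator.
Variables (T U : finType) (G : sgraph T) (F : sgraph U) (bag : U -> {set T}).
Hypothesis td : tree_decomposition G F bag.
Variable W : {set T}.

Local Notation cc X y := [set z in W | connect (rdel G X) y z].

(** The bags of a vertex outside [bag u] form a connected set avoiding [u], and adjacent vertices
    share a bag. A component of G minus the bag therefore lives in one branch at [u], and [v] is the
    first node of that branch. *)
Lemma toward (u : U) (y : T) : y \notin bag u -> exists v, F u v /\
  forall z t, connect (rdel G (bag u)) y z -> z \in bag t -> connect (rdel F [set u]) v t.
Proof.
move=> yu; have [[_ Fc _] tdv tde tdc] := td.
have [t0 yt0] := tdv y.
have /connectP[p pp lp] := Fc u t0.
case: (shortenP pp) lp => q pq uq _ lq.
case: q pq uq lq => [_ _ E|v q /=]; first by move: yt0; rewrite E (negbTE yu).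
case/andP => Fuv pq /andP[uq _] lq; exists v; split=> //.
have cv : connect (rdel F [set u]) v t0.
  apply/connectP; exists q => //.
  elim: q v {Fuv lq} pq uq => //= a q IH v /andP[Fva pq].
  rewrite !inE !negb_or => /and3P[uv ua uq]; rewrite rdelE Fva !inE (eq_sym v) uv (eq_sym a) ua /=.
  by apply: IH => //; rewrite inE negb_or ua.
have same z t t' : z \notin bag u -> z \in bag t -> z \in bag t' ->
    connect (rdel F [set u]) t t'.
  move=> zu zt zt'; have := tdc z t t' zt zt'.
  apply: connect_sub => a b /and3P[Fab za zb]; apply: connect1.
  by rewrite rdelE Fab !inE /=; apply/andP; split; apply: contraNneq zu => <-.
move=> z t /connectP[s ps ->] {z}.
have : exists2 t1, y \in bag t1 & connect (rdel F [set u]) v t1 by exists t0.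
elim: s y ps {yt0} yu => [|z s IH] y /=.
  by move=> _ yu [t1 yt1 c1] yt; apply: connect_trans c1 (same y _ _ _ _ _).
case/andP => /and3P[Gyz _ zu] ps yu [t1 yt1 c1].
apply: IH => //; have [t2 /andP[yt2 zt2]] := tde _ _ Gyz.
by exists t2 => //; apply: connect_trans c1 (same y _ _ _ _ _).
Qed.

(** Otherwise every node points to the branch of a component with more than half of W, and two
    adjacent nodes point at each other. Their heavy components meet, yet they lie on different sides
    of the edge between the nodes. *)
Lemma balanced_bag : exists u, forall y, y \notin bag u -> 2 * #|cc (bag u) y| <= #|W|.
Proof.
apply: contrapT => /forallNP no.
have {}no u : exists y, y \notin bag u /\ #|W| < 2 * #|cc (bag u) y|.
  have /existsNP[y /not_implyP[yu /negP]] := no u.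
  by rewrite -ltnNge => lt; exists y.
have [ys hys] := choice no.
have [f hf] := choice (fun u => toward (proj1 (hys u))).
have [u Eu] := tree_walk_turns (td_tree td) (fun u => proj1 (hf u)).
pose v := f u; have Fuv : F u v := proj1 (hf u).
have [z] : exists z, z \in cc (bag u) (ys u) :&: cc (bag v) (ys v).
  apply/set0Pn; rewrite -card_gt0.
  have := cardsUI (cc (bag u) (ys u)) (cc (bag v) (ys v)).
  have : #|cc (bag u) (ys u) :|: cc (bag v) (ys v)| <= #|W|.
    by apply: subset_leq_card; apply/subsetP => z; rewrite !inE => /orP[] /andP[].
  by have := proj2 (hys u); have := proj2 (hys v); lia.
rewrite !inE => /andP[/andP[_ zu] /andP[_ zv]].
have [t zt] := td_vertex td z.
have h1 := proj2 (hf u) z t zu zt.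
have := proj2 (hf v) z t zv zt; rewrite Eu => h2.
have := tree_edge_cut (td_tree td) Fuv; rewrite -/v; apply/negP; rewrite negbK.
set r := [rel a b | _].
have rs : connect_sym r.
  apply: sym_connect_sym => a b /=; rewrite adj_sym !xpair_eqE.
  by case: (F b a); case: (a == u); case: (b == v); case: (a == v); case: (b == u).
have sub1 : subrel (connect (rdel F [set v])) (connect r).
  apply: connect_sub => a b /= /and3P[Fab]; rewrite !inE => av bv.
  by apply: connect1; rewrite /= Fab !xpair_eqE (negbTE av) (negbTE bv) andbF.
have sub2 : subrel (connect (rdel F [set u])) (connect r).
  apply: connect_sub => a b /= /and3P[Fab]; rewrite !inE => av bv.
  by apply: connect1; rewrite /= Fab !xpair_eqE (negbTE av) (negbTE bv) andbF.
by apply: connect_trans (sub1 _ _ h2) _; rewrite rs; apply: sub2.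
Qed.

(** Take for A a maximal union of classes with at most 2w+2 vertices. If its complement is too
    large, then A has at most w+1 vertices, and the class K of any remaining vertex works alone: by
    maximality |K| is at least w+2, and by balance it is at most half of 3w+4. *)
Lemma balanced_split w : (forall u, #|bag u| <= w.+1) -> #|W| <= 3 * w + 4 ->
  exists X A : {set T}, [/\ #|X| <= w.+1, A \subset W, #|A| <= 2 * w + 2,
    #|W :\: A| <= 2 * w + 2 &
    forall a b, a \in A -> b \in W :\: A -> ~~ connect (rdel G X) a b].
Proof.
move=> hb hW; have [u hu] := balanced_bag.
set r := rdel G (bag u).
have rs : connect_sym r by apply: sym_connect_sym; apply: rdel_sym; apply: adj_sym.
pose closedA (A : {set T}) := (A \subset W) &&
  [forall a in A, forall b in W, connect r a b ==> (b \in A)].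
have sep A : closedA A -> forall a b, a \in A -> b \in W :\: A -> ~~ connect r a b.
  move=> /andP[_ /forall_inP h] a b aA /setDP[bW bA].
  by have /forall_inP/(_ b bW) := h a aA; rewrite implybE (negbTE bA) orbF.
pose P A := closedA A && (#|A| <= 2 * w + 2).
have P0 : P set0.
  rewrite /P cards0 /closedA sub0set; apply/andP; split=> //.
  by apply/forall_inP => a; rewrite inE.
have [A /maxsetP[/andP[cA sA] maxA] _] := maxset_exists P0.
have AW : A \subset W by case/andP: cA.
case: (leqP #|W :\: A| (2 * w + 2)) => hD.
  by exists (bag u), A; split=> //; apply: sep.
have [y] : exists y, y \in W :\: A by apply/card_gt0P; lia.
move=> /setDP[yW yA]; pose K := cc (bag u) y.
have yK : y \in K by rewrite inE yW connect0.
have cK : closedA K.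
  apply/andP; split; first by apply/subsetP => z; rewrite inE => /andP[].
  apply/forall_inP => a; rewrite inE => /andP[_ ca]; apply/forall_inP => b bW.
  by apply/implyP => ab; rewrite inE bW; apply: connect_trans ab.
have cAK : closedA (A :|: K).
  apply/andP; split; first by rewrite subUset AW; case/andP: cK.
  apply/forall_inP => a; rewrite inE => aAK; apply/forall_inP => b bW; apply/implyP => ab.
  rewrite inE; case/orP: aAK => aA; apply/orP; [left|right].
    by case/andP: cA => _ /forall_inP/(_ a aA)/forall_inP/(_ b bW)/implyP; apply.
  by case/andP: cK => _ /forall_inP/(_ a aA)/forall_inP/(_ b bW)/implyP; apply.
have big : 2 * w + 2 < #|A :|: K|.
  rewrite ltnNge; apply/negP => le; have := maxA (A :|: K).
  rewrite /P cAK le subsetUl => /(_ isT isT) E; move: yA.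
  by rewrite -E inE yK orbT.
(* A vertex of W inside the bag is a class by itself. *)
have Khalf : 2 * #|K| <= #|W| \/ #|K| <= 1.
  case yu : (y \in bag u); last by left; apply: hu; rewrite yu.
  right; rewrite -(cards1 y); apply: subset_leq_card; apply/subsetP => z.
  rewrite !inE => /andP[_ cyz]; apply/negPn/negP => zy; rewrite eq_sym in zy.
  by have := connect_rdel_notin cyz zy; rewrite yu.
have := cardsU A K; have := cardsD W A; have := cardsD W K.
rewrite (setIidPr AW) (setIidPr (_ : K \subset W)); last by case/andP: cK.
move=> e1 e2 e3.
exists (bag u), K; split=> //; [by case/andP: cK | lia | | exact: sep].
by have := subset_leq_card AW; lia.
Qed.

End Separator.

(** * Minimum vertex cuts *)

Section Flow.
Variables (N : finType) (c : rel N) (s t : N).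
Hypothesis st : s != t.

Record isflow (f : rel N) (k : nat) : Prop := IsFlow {
  flow_cap : forall x y, f x y -> c x y;
  flow_cons : forall x, x != s -> x != t -> \sum_y f x y = \sum_y f y x;
  flow_val : \sum_y f s y = \sum_y f y s + k }.

Definition residual (f : rel N) : rel N := [rel x y | (c x y && ~~ f x y) || f y x].

Lemma isflow0 : isflow (fun _ _ => false) 0.
Proof. by split=> // *; rewrite !big1. Qed.

Section Cut.
Variables (f : rel N) (k : nat) (R : {set N}).
Hypotheses (ff : isflow f k) (sR : s \in R) (tR : t \notin R).

Lemma flow_cut : \sum_(x in R) \sum_(y | y \notin R) f x y =
  \sum_(x in R) \sum_(y | y \notin R) f y x + k.
Proof.
case: ff => _ fc fv.
have E : \sum_(x in R) \sum_y f x y = \sum_(x in R) \sum_y f y x + k.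
  rewrite (bigD1 s) //= [in RHS](bigD1 s) //= fv -addnA [k + _]addnC addnA; congr (_ + _ + _).
  apply: eq_bigr => x /andP[xR xs]; apply: fc => //.
  by apply: contraNneq tR => <-.
have split2 g : \sum_(x in R) \sum_y (g x y : nat) =
    \sum_(x in R) \sum_(y in R) g x y + \sum_(x in R) \sum_(y | y \notin R) g x y.
  rewrite -big_split; apply: eq_bigr => x _ /=; rewrite (bigID (mem R)) //=.
move: E; rewrite (split2 (fun x y => f x y)) (split2 (fun x y => f y x)).
by rewrite [X in _ = X + _ + _ -> _]exchange_big /= -addnA => /addnI.
Qed.

Lemma cut_card (Q : rel N) :
  \sum_(x in R) \sum_(y | y \notin R) Q x y =
  #|[set a : N * N | [&& a.1 \in R, a.2 \notin R & Q a.1 a.2]]|.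
Proof.
rewrite pair_big_dep /= -sum1dep_card big_mkcond [RHS]big_mkcond /=.
apply: eq_bigr => -[x y] _ /=.
by case: (x \in R); case: (y \in R); case: (Q x y).
Qed.

Lemma flow_le_cut : k <= #|[set a : N * N | [&& a.1 \in R, a.2 \notin R & c a.1 a.2]]|.
Proof.
apply: (@leq_trans (\sum_(x in R) \sum_(y | y \notin R) f x y)).
  by rewrite flow_cut leq_addl.
rewrite cut_card; apply: subset_leq_card; apply/subsetP => -[x y]; rewrite !inE /=.
by case/and3P => -> -> /(flow_cap ff).
Qed.

(** Closure under residual arcs saturates the arcs leaving R and empties those entering it. *)
Lemma flow_eq_cut : (forall x y, x \in R -> residual f x y -> y \in R) ->
  #|[set a : N * N | [&& a.1 \in R, a.2 \notin R & c a.1 a.2]]| = k.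
Proof.
move=> closedR; have := flow_cut.
rewrite [X in _ = X + _]big1 ?add0n => [<-|x xR]; last first.
  rewrite big1 // => y yR; apply/eqP; rewrite eqb0; apply: contra yR => fyx.
  by apply: (closedR x) => //; rewrite /residual /= fyx orbT.
rewrite cut_card; apply: eq_card => -[x y]; rewrite !inE /=.
case xR : (x \in R) => //=; case yR : (y \in R) => //=.
apply/idP/idP => [cxy|/(flow_cap ff)//].
by apply/negPn/negP => nf; move: (closedR x y xR); rewrite /residual /= cxy nf yR => /(_ isT).
Qed.

End Cut.

Section Augment.
Variables (f : rel N) (k : nat) (q : nat -> N) (L : nat).
Hypotheses (ff : isflow f k) (q0 : q 0 = s) (qL : q L = t).
Hypothesis qinj : forall i j, i <= L -> j <= L -> q i = q j -> i = j.
Hypothesis qres : forall i, i < L -> residual f (q i) (q i.+1).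

Definition onpath (x y : N) : bool := [exists i : 'I_L, (q i == x) && (q i.+1 == y)].
Definition augmented (x y : N) : bool :=
  if onpath x y && ~~ f y x then true else if onpath y x && f x y then false else f x y.

Lemma onpathP x y : onpath x y -> exists i, [/\ i < L, q i = x & q i.+1 = y].
Proof. by case/existsP => i /andP[/eqP qi /eqP qi1]; exists i. Qed.

Lemma onpath_asym x y : onpath x y -> onpath y x = false.
Proof.
move/onpathP => [i [iL qi qi1]]; apply/negbTE/negP => hj; have [j [jL qj qj1]] := onpathP hj.
have E1 : i = j.+1 by apply: qinj; [exact: ltnW | | rewrite qi].
have E2 : i.+1 = j by apply: qinj; [ | exact: ltnW | rewrite qi1].
by lia.
Qed.

(** The net flow between two nodes changes by the net traversal of the path, whether an arc is
    filled or an opposite one is cancelled. Written without subtraction. *)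
Lemma augmented_diff x y :
  augmented x y + f y x + onpath y x = f x y + augmented y x + onpath x y.
Proof.
rewrite /augmented; case Pxy : (onpath x y).
  rewrite (onpath_asym Pxy) /=; case/onpathP: Pxy => i [/qres rq qi qi1].
  by move: rq; rewrite qi qi1 /residual /=; case: (f y x); case: (f x y); rewrite ?andbF.
case Pyx : (onpath y x) => //=.
case/onpathP: Pyx => i [/qres rq qi qi1].
by move: rq; rewrite qi qi1 /residual /=; case: (f y x); case: (f x y); rewrite ?andbF.
Qed.

Lemma onpath_out x : \sum_y onpath x y = \sum_(i < L) (q i == x).
Proof.
rewrite (eq_bigr (fun y => \sum_(i < L) ((q i == x) && (q i.+1 == y)))) => [|y _].
  rewrite exchange_big /=; apply: eq_bigr => i _; case: (q i == x); last by rewrite big1.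
  rewrite (bigD1 (q i.+1)) //= eqxx big1 ?addn0 // => y /negbTE.
  by rewrite eq_sym => ->.
rewrite /onpath; case: existsP => [[i0 Pi0]|no].
  rewrite (bigD1 i0) //= Pi0 big1 ?addn0 // => i ii0.
  apply/eqP; rewrite eqb0; apply: contra ii0 => /andP[/eqP qi _].
  case/andP: Pi0 => /eqP qi0 _; apply/eqP/val_inj; apply: qinj; [exact: (ltnW (ltn_ord _)) | exact: (ltnW (ltn_ord _)) | by rewrite qi].
by rewrite big1 // => i _; apply/eqP; rewrite eqb0; apply/negP => Pi; apply: no; exists i.
Qed.

Lemma onpath_in x : \sum_y onpath y x = \sum_(i < L) (q i.+1 == x).
Proof.
rewrite (eq_bigr (fun y => \sum_(i < L) ((q i == y) && (q i.+1 == x)))) => [|y _].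
  rewrite exchange_big /=; apply: eq_bigr => i _.
  case: (q i.+1 == x); last by rewrite big1 // => y _; rewrite andbF.
  rewrite (bigD1 (q i)) //= eqxx big1 ?addn0 // => y /negbTE.
  by rewrite eq_sym => ->.
rewrite /onpath; case: existsP => [[i0 Pi0]|no].
  rewrite (bigD1 i0) //= Pi0 big1 ?addn0 // => i ii0.
  apply/eqP; rewrite eqb0; apply: contra ii0 => /andP[_ /eqP qi].
  case/andP: Pi0 => _ /eqP qi0; apply/eqP/val_inj.
  have [] : i.+1 = i0.+1 by apply: qinj; [exact: ltn_ord | exact: ltn_ord | rewrite qi].
  by [].
by rewrite big1 // => i _; apply/eqP; rewrite eqb0; apply/negP => Pi; apply: no; exists i.
Qed.

Lemma isflow_augmented : isflow augmented k.+1.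
Proof.
case: ff => fcap fc fv.
have bal x : \sum_y augmented x y + \sum_y f y x + \sum_y onpath y x =
   \sum_y f x y + \sum_y augmented y x + \sum_y onpath x y.
  by rewrite -!big_split /=; apply: eq_bigr => y _; apply: augmented_diff.
(* Both sides count the visits of [q 0, ..., q L] to [x], with either the last or the first visit
   split off. *)
have pbal x : \sum_y onpath x y + (x == t) = \sum_y onpath y x + (x == s).
  rewrite onpath_out onpath_in -q0 -qL ![x == _]eq_sym addnC [RHS]addnC.
  rewrite -(big_ord_recl L (fun i => (q i == x) : nat)) addnC.
  by rewrite -(big_ord_recr L (fun i => (q i == x) : nat)).
split.
- move=> x y; rewrite /augmented; case: ifP => [/andP[/onpathP[i [/qres + qi qi1]] nf]|_].
    by rewrite qi qi1 /residual /= (negbTE nf) orbF => /andP[].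
  by case: ifP => // _ /fcap.
- move=> x xs xt; have := bal x; have := pbal x.
  by rewrite (negbTE xs) (negbTE xt) (fc x) //; lia.
- by have := bal s; have := pbal s; rewrite eqxx (negbTE st) fv; lia.
Qed.

End Augment.
End Flow.

Section VertexCut.
Variables (V N : finType) (G : sgraph V) (A B : {set V}).
Variables (inn outn : V -> N) (s t : N) (c : rel N).
Hypothesis dAB : [disjoint A & B].
Hypotheses (inn_inj : injective inn) (outn_inj : injective outn).
Hypothesis inn_out : forall u v, inn u != outn v.
Hypotheses (s_inn : forall u, s != inn u) (s_out : forall u, s != outn u).
Hypotheses (t_inn : forall u, t != inn u) (t_out : forall u, t != outn u) (st : s != t).
Hypothesis cP : forall x y, c x y <-> [\/ exists2 u, x = inn u & y = outn u,
  exists u v, [/\ x = outn u, y = inn v & G u v],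
  exists u, [/\ u \in A, x = s & y = inn u] |
  exists u, [/\ u \in B, x = outn u & y = t]].

(** The separator yields a cut R of the network in which every cut arc runs from [inn u] to [outn u]
    with [u] in X. *)
Lemma flow_le_sep (f : rel N) k (X : {set V}) : isflow c s t f k ->
  (forall a b, a \in A -> b \in B -> ~~ connect (rdel G X) a b) -> k <= #|X|.
Proof.
move=> ff sep.
pose Ra := [set u | [exists a in A, connect (rdel G X) a u]].
pose R := s |: (inn @: (Ra :|: X) :|: outn @: (Ra :\: X)).
have sR : s \in R by rewrite !inE eqxx.
have innR u : (inn u \in R) = (u \in Ra :|: X).
  rewrite !in_setU1 in_setU (mem_imset _ _ inn_inj) eq_sym (negbTE (s_inn u)) /=.
  case: imsetP => [[v _ E]|]; last by rewrite orbF.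
  by have := inn_out u v; rewrite E eqxx.
have outR u : (outn u \in R) = (u \in Ra :\: X).
  rewrite !in_setU1 in_setU (mem_imset _ _ outn_inj) eq_sym (negbTE (s_out u)) /=.
  case: imsetP => [[v _ E]|] //.
  by have := inn_out v u; rewrite E eqxx.
have tR : t \notin R.
  rewrite !in_setU1 in_setU eq_sym (negbTE st) /=; apply/norP.
  by split; apply/imsetP => -[u _ E]; [have := t_inn u | have := t_out u]; rewrite E eqxx.
apply: leq_trans (flow_le_cut ff sR tR) _.
apply: (@leq_trans #|(fun u => (inn u, outn u)) @: X|); last exact: leq_imset_card.
apply: subset_leq_card; apply/subsetP => -[x y]; rewrite inE /= => /and3P[xR yR /cP].
case=> [[u E1 E2]|[u [v [E1 E2 Guv]]]|[u [uA E1 E2]]|[u [uB E1 E2]]].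
- move: xR yR; rewrite E1 E2 innR outR in_setU in_setD => xR yR; apply/imsetP.
  by exists u => //; move: xR yR; case: (u \in Ra); case: (u \in X).
- move: xR yR; rewrite E1 E2 innR outR in_setU in_setD => /andP[uX uR].
  rewrite negb_or => /andP[vR vX]; move: uR vR; rewrite !inE => /exists_inP[a aA cau].
  move=> /exists_inPn/(_ a aA)/negP[]; apply: connect_trans cau (connect1 _).
  by rewrite rdelE Guv uX.
- move: yR; rewrite E2 innR in_setU negb_or inE => /andP[/exists_inPn/(_ u uA)].
  by rewrite connect0.
- move: xR; rewrite E1 outR !inE => /andP[_ /exists_inP[a aA cau]].
  by have := sep a u aA uB; rewrite cau.
Qed.

(** Each cut arc is charged to one vertex: to [u] if it leaves a copy of [u], and to its head if it
    leaves the source. *)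
Definition cutset (R : {set N}) : {set V} := [set u | [||
  (inn u \in R) && (outn u \notin R),
  (outn u \in R) && [exists v, G u v && (inn v \notin R)],
  [&& outn u \in R, u \in B & t \notin R] |
  (u \in A) && (inn u \notin R)]].

(** A cut arc charged to [u] determines [u], so there are no more vertices than cut arcs. Along a
    path that avoids these vertices the out-copies stay in R, and at its end in B the arc to the
    sink would leave R. *)
Lemma cutset_le (f : rel N) k (R : {set N}) : isflow c s t f k -> s \in R -> t \notin R ->
  (forall x y, x \in R -> residual c f x y -> y \in R) ->
  #|cutset R| <= k /\
  (forall a b, a \in A -> b \in B -> ~~ connect (rdel G (cutset R)) a b).
Proof.
move=> ff sR tR clR; split.
  rewrite -(flow_eq_cut ff sR tR clR); set C := [set a : N * N | _].
  pose g u := odflt (s, t) [pick a in C | [|| a.1 == inn u, a.1 == outn u |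
     (a.1 == s) && (a.2 == inn u)]].
  have gP u : u \in cutset R -> g u \in C /\ [|| (g u).1 == inn u, (g u).1 == outn u |
     ((g u).1 == s) && ((g u).2 == inn u)].
    rewrite inE => hu; rewrite /g; case: pickP => [a /andP[]//|no] /=; exfalso.
    case/or4P: hu => [/andP[h1 h2]|/andP[h1 /existsP[v /andP[Guv h2]]]|/and3P[h1 h2 h3]|/andP[h1 h2]].
    - have := no (inn u, outn u); rewrite inE /= h1 h2 eqxx andbT => /negP; apply.
      by apply/cP; constructor 1; exists u.
    - have := no (outn u, inn v); rewrite inE /= h1 h2 eqxx /= orbT andbT => /negP; apply.
      by apply/cP; constructor 2; exists u, v.
    - have := no (outn u, t); rewrite inE /= h1 h3 eqxx /= orbT andbT => /negP; apply.
      by apply/cP; constructor 4; exists u.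
    - have := no (s, inn u); rewrite inE /= sR h2 !eqxx /= !orbT andbT => /negP; apply.
      by apply/cP; constructor 3; exists u.
  rewrite -(@card_in_imset _ _ g).
    by apply: subset_leq_card; apply/subsetP => _ /imsetP[u /gP[]//+ _ ->].
  move=> u v /gP[_ hu] /gP[_ hv] E; move: hu; rewrite E.
  case/or3P: hv => [/eqP E1|/eqP E1|/andP[/eqP E1 /eqP E2]]; rewrite ?E1 ?E2.
  - rewrite (inj_eq inn_inj) (negbTE (inn_out _ _)) eq_sym [inn v == s]eq_sym (negbTE (s_inn _)).
    by rewrite !orbF => /eqP.
  - rewrite (inj_eq outn_inj) eq_sym (negbTE (inn_out _ _)) [outn v == s]eq_sym (negbTE (s_out _)).
    by rewrite orbF => /eqP.
  - rewrite (negbTE (s_inn _)) (negbTE (s_out _)) eqxx /= (inj_eq inn_inj).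
    by move/eqP.
move=> a b aA bB; apply/negP => cab.
have ab : a != b by apply: contraTneq bB => <-; rewrite (disjointFr dAB aA).
have /andP[aX _] := connect_rdel_notin cab ab.
have step u : u \notin cutset R -> inn u \in R -> outn u \in R.
  by rewrite inE => /norP[+ _] iu; rewrite iu /= negbK.
have outa : outn a \in R.
  apply: step => //; apply/negPn/negP => ia; move: aX; rewrite inE aA ia !orbT //.
have prop p x : path (rdel G (cutset R)) x p -> outn x \in R -> x \notin cutset R ->
    (outn (last x p) \in R) && (last x p \notin cutset R).
  elim: p x => [x _ /= -> -> //|y p IH x /= /andP[/and3P[Gxy xX yX] pp] ox _].
  apply: IH => //; apply: step => //.
  apply/negPn/negP => iy; move: xX; rewrite inE ox /= => /norP[_ /norP[/existsP[]]].
  by exists y; rewrite Gxy.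
case/connectP: cab => p pp E.
have := prop p a pp outa aX; rewrite -E => /andP[ob]; rewrite inE ob bB tR /=.
by rewrite !orbT.
Qed.

End VertexCut.

(** * Elimination orders *)

Section Neighbours.
Variables (T : finType) (G : sgraph T).
Implicit Types Q : {set T}.

Definition nbr Q (y : T) : {set T} :=
  [set u in Q | [exists z, connect (rdel G Q) y z && G z u]].

Lemma nbrP Q y u : reflect (u \in Q /\ exists2 z, connect (rdel G Q) y z & G z u) (u \in nbr Q y).
Proof.
rewrite inE; apply: (iffP andP) => -[uQ].
  by case/existsP => z /andP[h1 h2]; split=> //; exists z.
by case=> z h1 h2; split=> //; apply/existsP; exists z; rewrite h1.
Qed.

Lemma connect_rdel_mono Q Q' y z :
  Q \subset Q' -> connect (rdel G Q') y z -> connect (rdel G Q) y z.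
Proof.
move=> /subsetP sub; apply: connect_sub => a b; rewrite rdelE => /and3P[ab aQ bQ].
by apply: connect1; rewrite rdelE ab (contra (sub a)) // (contra (sub b)).
Qed.

End Neighbours.

Section Order.
Variables (n : nat) (G : sgraph 'I_n).
Local Notation T := 'I_n.
Local Notation nbr := (nbr G).
Implicit Types (K : T -> nat) (Q X A W : {set T}).

Definition placed K : {set T} := [set u | K u != 0].
Definition before K (v : T) : {set T} := [set u | (K u != 0) && (K u < K v)].

(** [ord_nbr] is what makes [balanced_split] applicable in the next round, [ord_bag] is the bound on
    the bags that is finally wanted, and [ord_card] records that each round places a vertex, so that
    n rounds suffice. *)
Record ordinv (w r : nat) K : Prop := OrdInv {
  ord_le : forall u, K u <= n * r;
  ord_inj : forall u v, K u != 0 -> K u = K v -> u = v;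
  ord_nbr : forall y, K y = 0 -> #|nbr (placed K) y| <= 3 * w + 3;
  ord_bag : forall v, K v != 0 -> #|nbr (before K v) v| <= 6 * w + 6;
  ord_card : (r <= #|placed K|) || (#|placed K| == n) }.

Lemma ordinv0 w : ordinv w 0 (fun _ => 0).
Proof.
split=> //= y _; apply: (@leq_trans 0) => //; rewrite leqn0 cards_eq0.
by apply/eqP/setP => u; rewrite !inE.
Qed.

Section Step.
Variables (w r : nat) (K : T -> nat) (v : T) (A X : {set T}).
Hypothesis inv : ordinv w r K.
Hypothesis v0 : K v = 0.
Local Notation Q := (placed K).
Definition ocomp : {set T} := [set u | (K u == 0) && connect (rdel G Q) v u].
Definition owall : {set T} := v |: nbr Q v.
Local Notation C := ocomp.
Local Notation W := owall.
Hypotheses (XA : #|X| + #|A| <= 3 * w + 3) (XB : #|X| + #|W :\: A| <= 3 * w + 3).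
Hypothesis sep : forall a b, a \in A -> b \in W :\: A -> ~~ connect (rdel G X) a b.

(** Round r gives keys from [n * r + 1] to [n * r + n]: later rounds get larger keys, the vertices
    of one round are ordered by their number, and 0 remains free for unplaced vertices. *)
Definition nextkey (u : T) : nat :=
  if K u != 0 then K u else if (u == v) || (u \in C) && (u \in X) then (n * r + u).+1 else 0.
Local Notation K' := nextkey.
Local Notation Q' := (placed K').

Let subQ : Q \subset Q'.
Proof. by apply/subsetP => u; rewrite !inE /nextkey => Ku; rewrite Ku. Qed.

Let vC : v \in C. Proof. by rewrite inE v0 connect0. Qed.

Let newC u : u \in Q' -> K u = 0 -> (u \in C) && (u \in W :|: X).
Proof.
rewrite inE /nextkey => + Ku; rewrite Ku eqxx /=.
case: (eqVneq u v) => [-> _|_ /=]; first by rewrite vC !inE eqxx.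
by case: ifP => // /andP[-> uX]; rewrite !in_setU uX orbT.
Qed.

Let inC Q0 y z : Q \subset Q0 -> y \in C -> connect (rdel G Q0) y z -> z \in C.
Proof.
move=> sub; rewrite !inE => /andP[Ky cvy] /(connect_rdel_mono sub) cyz.
rewrite (connect_trans cvy cyz) andbT.
case: (eqVneq y z) => [<- //|yz].
by have /andP[_] := connect_rdel_notin cyz yz; rewrite inE negbK.
Qed.

(** Intermediate sets [Q0] matter because the vertices placed in one round are also ordered among
    themselves. *)
Let nbr_sub Q0 y : Q \subset Q0 -> Q0 \subset Q' -> y \in C -> nbr Q0 y \subset W :|: X.
Proof.
move=> s1 s2 yC; apply/subsetP => u /nbrP[uQ0 [z cyz Gzu]].
have zC := inC s1 yC cyz.
case Ku : (K u == 0); last first.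
  rewrite !in_setU; apply/orP; left; apply/orP; right; apply/nbrP; split; first by rewrite inE Ku.
  by exists z => //; move: zC; rewrite inE => /andP[].
by have /andP[] := newC (subsetP s2 u uQ0) (eqP Ku).
Qed.

(** The part of X inside the component has just been placed, so what remains is connected in the
    graph without X. *)
Let avoidX y z : y \in C -> K' y = 0 -> connect (rdel G Q') y z ->
  z \notin X /\ connect (rdel G X) y z.
Proof.
have noX u : u \in C -> K' u = 0 -> u \notin X.
  move=> uC; have Ku : K u = 0 by move: uC; rewrite inE => /andP[/eqP].
  rewrite /nextkey Ku eqxx /= uC /=.
  by case: (u \in X); rewrite ?orbT.
move=> yC Ky /connectP[p pp ->] {z}.
elim: p y yC Ky pp => [|z p IH] y yC Ky /=; first by split; [exact: noX | exact: connect0].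
case/andP; rewrite rdelE => /and3P[Gyz yQ zQ] pp.
have zC : z \in C by apply: (inC subQ yC); apply: connect1; rewrite rdelE Gyz yQ.
have Kz : K' z = 0 by move: zQ; rewrite inE negbK => /eqP.
have [lX cl] := IH z zC Kz pp; split=> //.
by apply: connect_trans cl; apply: connect1; rewrite rdelE Gyz !noX.
Qed.

Lemma owall_card : #|W| <= 3 * w + 4.
Proof.
apply: leq_trans (leq_of_leqif (leq_card_setU _ _)) _.
by rewrite cards1 add1n; move: (ord_nbr inv v0); clear; lia.
Qed.

(** By [avoidX] and [sep], a remaining part of the component cannot see both A and W minus A outside
    X. Its neighbours lie in X with one side, which is at most 3w+3. A vertex placed now sees at
    most W and X, bounded by the sum of the two hypotheses. Other components keep their
    neighbours. *)
Lemma ordinv_step : ordinv w r.+1 K'.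
Proof.
have newbig u : K u = 0 -> K' u != 0 -> K' u = (n * r + u).+1.
  by rewrite /nextkey => ->; rewrite eqxx /=; case: ifP.
have old u : K u != 0 -> K' u = K u by rewrite /nextkey => ->.
have keyle u : K' u <= n * r.+1.
  case: (eqVneq (K u) 0) => [Ku|/old->]; last by have := ord_le inv u; rewrite mulnS; lia.
  case: (eqVneq (K' u) 0) => [->//|/(newbig _ Ku)->]; rewrite mulnS; have := ltn_ord u; lia.
split=> //.
- move=> a b a0 E; have b0 : K' b != 0 by rewrite -E.
  case: (eqVneq (K a) 0) => [Ka|Ka]; case: (eqVneq (K b) 0) => [Kb|Kb].
  + by apply: val_inj; move: E; rewrite (newbig a) // (newbig b) // => /eqP; rewrite eqSS eqn_add2l => /eqP.
  + by move: E; rewrite (newbig a) // (old b) // => E; have := ord_le inv b; lia.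
  + by move: E; rewrite (old a) // (newbig b) // => E; have := ord_le inv a; lia.
  + by move: E; rewrite (old a) // (old b) // => /(ord_inj inv Ka).
- move=> y Ky; have Ky0 : K y = 0.
    by case: (eqVneq (K y) 0) => // h; move: Ky; rewrite old.
  case yC : (y \in C); last first.
    apply: leq_trans (ord_nbr inv Ky0); apply: subset_leq_card; apply/subsetP => u.
    move=> /nbrP[uQ [z cyz Gzu]]; have cyz' := connect_rdel_mono subQ cyz.
    apply/nbrP; split; last by exists z.
    rewrite inE; apply/negP => /eqP Ku; have /andP[uC _] := newC uQ Ku.
    have zu : connect (rdel G Q) u z.
      apply: connect1; rewrite rdelE adj_sym Gzu !inE Ku eqxx /=.
      case: (eqVneq y z) => [<-|yz]; first by rewrite Ky0.
      by have /andP[_] := connect_rdel_notin cyz' yz; rewrite inE.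
    move: yC; rewrite (@inC Q u y) //; apply: connect_trans zu _.
    by rewrite sym_connect_sym //; apply: rdel_sym; apply: adj_sym.
  have sub := nbr_sub subQ (subxx _) yC.
  have [/subsetP sA|/subsetPn[a aN aA]] := boolP (nbr Q' y \subset X :|: A).
    by apply: leq_trans (subset_leq_card _) (leq_trans (leq_of_leqif (leq_card_setU _ _)) XA); apply/subsetP.
  apply: leq_trans (subset_leq_card _) (leq_trans (leq_of_leqif (leq_card_setU _ _)) XB).
  apply/subsetP => b bN; have /norP[aX {}aA] : ~~ ((a \in X) || (a \in A)) by rewrite -in_setU.
  have aW : a \in W :\: A.
    by rewrite inE aA /=; move: (subsetP sub a aN); rewrite in_setU (negbTE aX) orbF.
  have bWX : (b \in W) || (b \in X) by rewrite -in_setU; apply: (subsetP sub).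
  rewrite in_setU; case bX : (b \in X) => //=; rewrite inE; rewrite bX orbF in bWX.
  rewrite bWX andbT; apply/negP => bA; move/negP: (sep bA aW); apply.
  case/nbrP: aN => _ [za cza Gza]; case/nbrP: bN => _ [zb czb Gzb].
  have [zaX ca] := avoidX yC Ky cza; have [zbX cb] := avoidX yC Ky czb.
  apply: (@connect_trans _ _ zb); first by apply: connect1; rewrite rdelE adj_sym Gzb bX.
  apply: (@connect_trans _ _ y).
    by rewrite sym_connect_sym //; apply: rdel_sym; apply: adj_sym.
  by apply: connect_trans ca (connect1 _); rewrite rdelE Gza zaX aX.
- move=> u Ku; case: (eqVneq (K u) 0) => [Ku0|Ku0].
    have /andP[uC _] : (u \in C) && (u \in W :|: X) by apply: newC; rewrite ?inE.
    have s1 : Q \subset before K' u.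
      apply/subsetP => x; rewrite !inE => Kx; rewrite old // Kx newbig //=.
      by have := ord_le inv x; lia.
    have s2 : before K' u \subset Q' by apply/subsetP => x; rewrite !inE => /andP[].
    apply: leq_trans (subset_leq_card (nbr_sub s1 s2 uC)) _.
    apply: leq_trans (leq_of_leqif (leq_card_setU _ _)) _.
    have := cardsID A W; have := subset_leq_card (subsetIr W A); lia.
  have -> : before K' u = before K u.
    apply/setP => x; rewrite !inE (old u) //.
    case: (eqVneq (K x) 0) => [Kx|Kx]; last by rewrite old // Kx.
    apply/negbTE/negP => /andP[hx]; rewrite (newbig x Kx hx); have := ord_le inv u; lia.
  exact: ord_bag inv _ Ku0.
- have /orP[h|/eqP h] := ord_card inv.
    apply/orP; left; apply: leq_ltn_trans h _; apply: proper_card; apply/properP; split=> //.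
    by exists v; rewrite !inE /nextkey v0 ?eqxx.
  have : Q = [set: T] by apply/eqP; rewrite eqEcard subsetT cardsT card_ord h /=.
  by move/setP => /(_ v); rewrite !inE v0.
Qed.

End Step.

(** The number of rounds is fixed, so rounds after the last placement must be harmless. *)
Lemma ordinv_done w r K : ordinv w r K -> (forall u, K u != 0) -> ordinv w r.+1 K.
Proof.
case=> h1 h2 h3 h4 h5 al; split=> //; first by move=> u; rewrite mulnS; have := h1 u; lia.
have -> : placed K = [set: T] by apply/setP => u; rewrite !inE al.
by rewrite cardsT card_ord eqxx orbT.
Qed.

Lemma ordinv_final w K : ordinv w n K -> forall u, K u != 0.
Proof.
move=> inv u; have : placed K = [set: T].
  apply/eqP; rewrite eqEcard subsetT cardsT card_ord.
  case: inv => _ _ _ _ /orP[//|/eqP E]; by rewrite leq_eqVlt [X in _ == X]E eqxx.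
by move/setP => /(_ u); rewrite !inE.
Qed.

End Order.

(** * Local descriptions along the elimination tree *)

(* px u z: value at z of the potential of the path through u; pe u z: u and z
   lie on the same path; pP, pQ: predecessor and successor among the vertices
   that are higher in the elimination tree. *)
Record data (T : finType) := Data {
  px : T -> T -> nat; pe : T -> T -> bool; pP : option T; pQ : option T }.

(* Interface of a partial solution: potentials, path identities, realized
   in-degrees and out-degrees, number of completed paths. *)
Record astate (T : finType) := AState {
  sx : T -> T -> nat; se : T -> T -> bool; si : T -> nat; so : T -> nat; sk : nat }.

Section ElimTree.
Variables (T : finType) (G : sgraph T) (rk : T -> nat) (b : nat).
Hypothesis rk_inj : injective rk.
Local Notation d := (dd G).

Definition bef (v : T) : {set T} := [set u | rk u < rk v].
(** The neighbours of smaller rank in the chordal completion of the order: those reached through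
    vertices of rank at least [rk v]. The vertex of largest rank among them is the parent. *)
Definition Sv (v : T) : {set T} := nbr G (bef v) v.
Definition Bv (v : T) : {set T} := v |: Sv v.
Definition par (c p : T) : Prop := p \in Sv c /\ forall u, u \in Sv c -> rk u <= rk p.

Lemma Sv_rk v u : u \in Sv v -> rk u < rk v.
Proof. by case/nbrP; rewrite inE. Qed.

Lemma Sv_notin v : v \notin Sv v.
Proof. by apply/negP => /Sv_rk; rewrite ltnn. Qed.

Lemma Bv_rk v u : u \in Bv v -> rk u <= rk v.
Proof. by case/setU1P => [->//|/Sv_rk/ltnW]. Qed.

Lemma par_uniq c p p' : par c p -> par c p' -> p = p'.
Proof.
move=> [h1 h2] [h1' h2']; apply: rk_inj; apply/eqP; rewrite eqn_leq.
by rewrite h2' // h2.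
Qed.

Lemma par_ex c : (Sv c == set0) = false -> exists p, par c p.
Proof.
move/negbT/set0Pn => [u uS]; case: (arg_maxnP (P := fun u => u \in Sv c) rk uS) => p pS mx.
by exists p; split.
Qed.

Lemma Sv_edge u y : G u y -> rk u < rk y -> u \in Sv y.
Proof.
move=> Guy lt; apply/nbrP; split; first by rewrite inE.
by exists y; [exact: connect0 | rewrite adj_sym].
Qed.

(** Without [bef p], which is contained in [bef c], the vertices [c] and [p] lie in one component.
    What is seen from [c] and precedes [p] is then seen from [p]. *)
Lemma Sv_par c p : par c p -> Sv c \subset Bv p.
Proof.
case=> pS mx; apply/subsetP => u uS; rewrite in_setU1.
have [-> //|up] := eqVneq u p; apply/orP; right.
have lt : rk u < rk p.
  by rewrite ltn_neqAle mx // andbT; apply: contra_neq up; apply: rk_inj.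
case/nbrP: (pS) => _ [z1 c1 g1]; case/nbrP: (uS) => _ [z2 c2 g2].
have sub : bef p \subset bef c.
  by apply/subsetP => x; rewrite !inE => h; apply: ltn_trans h (Sv_rk pS).
apply/nbrP; split; first by rewrite inE.
exists z2 => //; have c1' := connect_rdel_mono sub c1; have c2' := connect_rdel_mono sub c2.
have rs : connect_sym (rdel G (bef p)) by apply: sym_connect_sym; apply: rdel_sym; apply: adj_sym.
have nb z : connect (rdel G (bef p)) c z -> z \notin bef p.
  case: (eqVneq c z) => [<- _|cz h]; last by case/andP: (connect_rdel_notin h cz).
  by rewrite inE -leqNgt; apply/ltnW/Sv_rk.
apply: (@connect_trans _ _ z1).
  by apply: connect1; rewrite rdelE adj_sym g1 (nb z1 c1') !inE ltnn.
by apply: connect_trans c2'; rewrite rs.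
Qed.

(* Every path from v to a higher vertex leaves the component of v through Sv v. *)
Lemma Sv_separates v z : rk z < rk v -> connect G v z ->
  exists2 u, u \in Sv v & d v z = d v u + d u z.
Proof.
move=> lt cvz; have [p [pp lp sp]] := dd_ex cvz.
have [i [u [us]]] : exists i u, [/\ u \in Sv v, i <= size p & u = last v (take i p)].
  have main : forall q x, path G x q -> connect (rdel G (bef v)) v x -> x \notin bef v ->
      last x q \in bef v -> exists i u, [/\ u \in Sv v, i <= size q & u = last x (take i q)].
    elim=> [x _ _ nx /=|y q IH x /= /andP[Gxy pq] cx nx lq]; first by rewrite (negbTE nx).
    case yb : (y \in bef v).
      by exists 1, y; split=> //; [apply/nbrP; split=> //; exists x | rewrite /= take0].
    have [||//|i [u [h1 h2 h3]]] := IH y pq.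
    - by apply: connect_trans cx (connect1 _); rewrite rdelE Gxy nx yb.
    - by rewrite yb.
    by exists i.+1, u.
  by apply: (main p v pp (connect0 _ _)); rewrite ?lp !inE ?ltnn.
move=> ile ue; exists u => //; apply/eqP; rewrite eqn_leq dd_triangle /=.
rewrite -sp -[in leqRHS](cat_take_drop i p) size_cat leq_add //.
  by rewrite ue dd_path // take_path.
have -> : z = last u (drop i p) by rewrite -lp -[in LHS](cat_take_drop i p) last_cat ue.
rewrite dd_path //.
by move: pp; rewrite -{1}(cat_take_drop i p) cat_path -ue => /andP[].
Qed.

Lemma Sv_connect v u : u \in Sv v -> connect G v u.
Proof.
case/nbrP => _ [z cz Gz]; apply: connect_trans (connect_rdel_sub cz) (connect1 Gz).
Qed.

Lemma Bv_connect v u z : u \in Bv v -> z \in Bv v -> connect G u z.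
Proof.
have h x : x \in Bv v -> connect G v x by case/setU1P => [->|/Sv_connect].
move=> /h cu /h; apply: connect_trans; rewrite sym_connect_sym //; exact: adj_sym.
Qed.

(** Distances in [loc_lip] are those of the whole graph, not of the bag; this is what makes isometry
    testable bag by bag. *)
Record loc (v : T) (x : T -> T -> nat) (e : T -> T -> bool) (P Q : option T) : Prop := Loc {
  loc_refl : forall u, u \in Bv v -> e u u;
  loc_sym : forall u z, u \in Bv v -> z \in Bv v -> e u z -> e z u;
  loc_trans : forall u z y, u \in Bv v -> z \in Bv v -> y \in Bv v -> e u z -> e z y -> e u y;
  loc_row : forall u z y, u \in Bv v -> z \in Bv v -> y \in Bv v -> e u z -> x u y = x z y;
  loc_lip : forall u z y, u \in Bv v -> z \in Bv v -> y \in Bv v -> x u y <= x u z + d z y;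
  loc_bnd : forall u z, u \in Bv v -> z \in Bv v -> x u z < b;
  loc_P : forall p, P = Some p -> [/\ p \in Sv v, G v p, e p v & x v v = (x p p).+1];
  loc_Q : forall q, Q = Some q -> [/\ q \in Sv v, G v q, e v q & x q q = (x v v).+1] }.

Implicit Types (D Ts : {set T}) (dt : T -> data T) (q : option T) (a : astate T).

(** An arc is stored once, at its end of larger rank: as [pP] when that end is the head, as [pQ]
    when it is the tail. *)
Definition cin dt D (u : T) : nat :=
  \sum_(y in D) ((pQ (dt y) == Some u) + ((y == u) && isSome (pP (dt y)))).
Definition cout dt D (u : T) : nat :=
  \sum_(y in D) ((pP (dt y) == Some u) + ((y == u) && isSome (pQ (dt y)))).

Definition dloc dt (y : T) := loc y (px (dt y)) (pe (dt y)) (pP (dt y)) (pQ (dt y)).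
Definition agree (v : T) x e x' e' := forall u z : T, u \in Sv v -> z \in Sv v ->
  x u z = x' u z :> nat /\ e u z = e' u z :> bool.
Definition dagree dt c p := agree c (px (dt c)) (pe (dt c)) (px (dt p)) (pe (dt p)).

Definition Bq q : {set T} := if q is Some v then Bv v else set0.
Definition Dq q Ts : {set T} := if q is Some v then v |: Ts else Ts.
Definition istop c := Sv c = set0.
Definition ispar c q := if q is Some p then par c p else istop c.

(** [Ts] are the vertices already forgotten. The degree conditions bind only these, since vertices
    in the bag of [q] may still receive arcs. The case [q = None] is the empty bag above all
    roots. *)
Record sol q Ts dt : Prop := Sol {
  sol_loc : forall y, y \in Dq q Ts -> dloc dt y;
  sol_agree : forall c p, c \in Ts -> p \in Dq q Ts -> par c p -> dagree dt c p;
  sol_in : forall c, c \in Ts -> cin dt (Dq q Ts) c <= 1;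
  sol_out : forall c, c \in Ts -> cout dt (Dq q Ts) c <= 1;
  sol_start : forall c, c \in Ts -> cin dt (Dq q Ts) c = 0 -> px (dt c) c c = 0 }.

Record interface q Ts dt a : Prop := Interface {
  if_x : forall v, q = Some v -> forall u z, u \in Bv v -> z \in Bv v ->
    sx a u z = px (dt v) u z /\ se a u z = pe (dt v) u z;
  if_in : forall u, u \in Bq q -> si a u = cin dt (Dq q Ts) u /\ si a u <= 1;
  if_out : forall u, u \in Bq q -> so a u = cout dt (Dq q Ts) u /\ so a u <= 1;
  if_k : sk a = #|[set c in Ts | cin dt (Dq q Ts) c == 0]| }.

Definition Sem q Ts a := exists dt, sol q Ts dt /\ interface q Ts dt a.

Lemma Sem_root_init a : Sem None set0 a <-> sk a = 0.
Proof.
split=> [[dt [_ [_ _ _ ->]]]|k0].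
  by apply/eqP; rewrite cards_eq0; apply/eqP/setP => c; rewrite !inE.
exists (fun _ => Data (fun _ _ => 0) (fun _ _ => true) None None); split.
  by split=> c; rewrite /= inE.
split=> //= [u|u|]; rewrite ?inE // k0; apply/esym/eqP; rewrite cards_eq0.
by apply/eqP/setP => c; rewrite !inE.
Qed.

Lemma Sem_init v a : Sem (Some v) set0 a <-> sk a = 0 /\ exists P Q,
  loc v (sx a) (se a) P Q /\ forall u, u \in Bv v ->
    si a u = (u == v) && isSome P + (Q == Some u) /\
    so a u = (u == v) && isSome Q + (P == Some u).
Proof.
have cin1 dt u : cin dt (Dq (Some v) set0) u = (u == v) && isSome (pP (dt v)) + (pQ (dt v) == Some u).
  by rewrite /cin /Dq setU0 big_set1 addnC eq_sym.
have cout1 dt u : cout dt (Dq (Some v) set0) u = (u == v) && isSome (pQ (dt v)) + (pP (dt v) == Some u).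
  by rewrite /cout /Dq setU0 big_set1 addnC eq_sym.
split=> [[dt [[hl _ _ _ _] [ix ii io ->]]]|[k0 [P [Q [hl hf]]]]].
  split; first by apply/eqP; rewrite cards_eq0; apply/eqP/setP => c; rewrite !inE.
  exists (pP (dt v)), (pQ (dt v)); split; last first.
    by move=> u uB; have [-> _] := ii u uB; have [-> _] := io u uB; rewrite cin1 cout1.
  have [] := hl v (setU11 _ _); have vB := setU11 v (Sv v).
  have E := ix v erefl => l1 l2 l3 l4 l5 l6 l7 l8; split.
  - by move=> u hu; rewrite (E u u hu hu).2 l1.
  - by move=> u z hu hz; rewrite !(E _ _ _ _).2 //; apply: l2.
  - by move=> u z y hu hz hy; rewrite !(E _ _ _ _).2 //; apply: l3.
  - by move=> u z y hu hz hy; rewrite (E _ _ _ _).2 // !(E _ _ _ _).1 //; apply: l4.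
  - by move=> u z y hu hz hy; rewrite !(E _ _ _ _).1 //; apply: l5.
  - by move=> u z hu hz; rewrite !(E _ _ _ _).1 //; apply: l6.
  - move=> p /l7[h1 h2 h3 h4]; have pB := setU1r v h1.
    by rewrite (E _ _ _ _).2 // !(E _ _ _ _).1.
  - move=> p /l8[h1 h2 h3 h4]; have pB := setU1r v h1.
    by rewrite (E _ _ _ _).2 // !(E _ _ _ _).1.
pose dt (_ : T) := Data (sx a) (se a) P Q; exists dt; split.
  by split=> [y|c|c|c|c]; rewrite ?inE // orbF => /eqP->.
split=> //.
- move=> u uB; rewrite cin1; have [-> _] := hf u uB; split=> //=.
  case: eqP => [-> |_] /=; last by case: eqP.
  case: eqP => [/(loc_Q hl)[]|_]; last by rewrite addn0 leq_b1.
  by rewrite (negbTE (Sv_notin v)).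
- move=> u uB; rewrite cout1; have [_ ->] := hf u uB; split=> //=.
  case: eqP => [-> |_] /=; last by case: eqP.
  case: eqP => [/(loc_P hl)[]|_]; last by rewrite addn0 leq_b1.
  by rewrite (negbTE (Sv_notin v)).
- by rewrite k0; apply/esym/eqP; rewrite cards_eq0; apply/eqP/setP => c; rewrite !inE.
Qed.

(* q gets the subtree of its child c. *)
Record attach (q : option T) Tq (c : T) Tc : Prop := Attach {
  at_par : ispar c q;
  at_disj : [disjoint (c |: Tc) & Dq q Tq];
  at_Bq : [disjoint (c |: Tc) & Bq q];
  at_TB : [disjoint Tq & Bq q];
  at_cT : c \notin Tc;
  at_cB : [disjoint Tc & Bv c];
  at_Sq : forall y u, y \in Dq q Tq -> u \in Sv y -> u \in Dq q Tq :|: Bq q;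
  at_Sc : forall y u, y \in c |: Tc -> u \in Sv y -> u \in (c |: Tc) :|: Sv c;
  at_Pq : forall y p, y \in Tq -> par y p -> p \in Dq q Tq;
  at_Pc : forall y p, y \in Tc -> par y p -> p \in c |: Tc }.

Definition mergeable q c a a1 a2 : Prop :=
  [/\ forall v, q = Some v -> forall u z, u \in Bv v -> z \in Bv v ->
        sx a u z = sx a1 u z /\ se a u z = se a1 u z,
      agree c (sx a2) (se a2) (sx a1) (se a1),
      [/\ si a2 c <= 1, so a2 c <= 1 & si a2 c = 0 -> sx a2 c c = 0],
      forall u, u \in Bq q ->
        [/\ si a u = si a1 u + (if u \in Sv c then si a2 u else 0), si a u <= 1,
            so a u = so a1 u + (if u \in Sv c then so a2 u else 0) & so a u <= 1] &
      sk a = sk a1 + sk a2 + (si a2 c == 0)].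

Lemma cin_ext dt dt' D u : {in D, dt =1 dt'} -> cin dt D u = cin dt' D u.
Proof. by move=> h; apply: eq_bigr => y yD; rewrite h. Qed.

Lemma cout_ext dt dt' D u : {in D, dt =1 dt'} -> cout dt D u = cout dt' D u.
Proof. by move=> h; apply: eq_bigr => y yD; rewrite h. Qed.

Lemma cin0 dt D u : (forall y, y \in D -> dloc dt y) -> (forall y, y \in D -> u \notin Sv y) ->
  u \notin D -> cin dt D u = 0.
Proof.
move=> hl hS uD; apply: big1 => y yD; case: eqP => [/(loc_Q (hl y yD))[uS]|_].
  by have := hS y yD; rewrite uS.
by case: eqP => // E; rewrite -E yD in uD.
Qed.

Lemma cout0 dt D u : (forall y, y \in D -> dloc dt y) -> (forall y, y \in D -> u \notin Sv y) ->
  u \notin D -> cout dt D u = 0.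
Proof.
move=> hl hS uD; apply: big1 => y yD; case: eqP => [/(loc_P (hl y yD))[uS]|_].
  by have := hS y yD; rewrite uS.
by case: eqP => // E; rewrite -E yD in uD.
Qed.

Lemma Sem_ext q Ts a a' : (forall u z, u \in Bq q -> z \in Bq q ->
    sx a u z = sx a' u z /\ se a u z = se a' u z) ->
  (forall u, u \in Bq q -> si a u = si a' u /\ so a u = so a' u) -> sk a = sk a' ->
  Sem q Ts a -> Sem q Ts a'.
Proof.
move=> hx hi hk [dt [sl [ix ii io ik]]]; exists dt; split=> //; split; rewrite -?hk //.
- move=> v qv u z hu hz; have [<- <-] : sx a u z = sx a' u z /\ se a u z = se a' u z.
    by apply: hx; rewrite qv.
  exact: ix.
- by move=> u hu; have [<- _] := hi u hu; apply: ii.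
- by move=> u hu; have [_ <-] := hi u hu; apply: io.
Qed.

Lemma Sem_bnd v Ts a u z : Sem (Some v) Ts a -> u \in Bv v -> z \in Bv v -> sx a u z < b.
Proof.
case=> dt [[hl _ _ _ _] [ix _ _ _]] hu hz; have [-> _] := ix v erefl u z hu hz.
by apply: (loc_bnd (hl v (setU11 _ _))).
Qed.

Section Merge.
Variables (q : option T) (Tq : {set T}) (c : T) (Tc : {set T}).
Hypothesis at_ : attach q Tq c Tc.
Local Notation D1 := (Dq q Tq).
Local Notation D2 := (c |: Tc).
Local Notation D3 := (Dq q (Tq :|: (c |: Tc))).

Let Sc_Bq : Sv c \subset Bq q.
Proof. by case: q (at_par at_) => [p|]; [exact: Sv_par | move=> /= ->; exact: sub0set]. Qed.

Let D3E : D3 = D1 :|: D2.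
Proof. by rewrite /Dq; case: q => // v; rewrite setUA. Qed.

Let d12 u : u \in D1 -> u \in D2 -> False.
Proof. by move=> h1 h2; rewrite (disjointFr (at_disj at_) h2) in h1. Qed.

Let dB u : u \in D2 -> u \in Bq q -> False.
Proof. by move=> h1 h2; rewrite (disjointFr (at_Bq at_) h1) in h2. Qed.

Let dT u : u \in Tq -> u \in Bq q -> False.
Proof. by move=> h1 h2; rewrite (disjointFr (at_TB at_) h1) in h2. Qed.

Let T1 u : u \in Tq -> u \in D1.
Proof. by rewrite /Dq; case: q => // v; exact: setU1r. Qed.

Let dis12 : [disjoint D1 & D2]. Proof. by rewrite disjoint_sym; exact: (at_disj at_). Qed.

Let cinU dt u : cin dt D3 u = cin dt D1 u + cin dt D2 u.
Proof. by rewrite D3E /cin (eq_bigl [predU D1 & D2]) ?bigU // => y; rewrite !inE. Qed.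

Let coutU dt u : cout dt D3 u = cout dt D1 u + cout dt D2 u.
Proof. by rewrite D3E /cout (eq_bigl [predU D1 & D2]) ?bigU // => y; rewrite !inE. Qed.

Let z1 u y : u \in D2 -> y \in D1 -> u \notin Sv y.
Proof.
by move=> u2 y1; apply/negP => /(at_Sq at_ y1) /setUP[/d12|]; [apply | exact: (dB u2)].
Qed.

Let z2 u y : u \notin D2 -> u \notin Sv c -> y \in D2 -> u \notin Sv y.
Proof.
move=> u2 uc y2; apply/negP => /(at_Sc at_ y2); rewrite inE (negbTE u2) /=.
by rewrite (negbTE uc).
Qed.

Let T2 u : u \in Tq -> (u \notin D2) && (u \notin Sv c).
Proof.
move=> uT; apply/andP; split; apply/negP; first exact: (d12 (T1 uT)).
by move/(subsetP Sc_Bq); apply: dT.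
Qed.

Let D2c : Dq (Some c) Tc = D2. Proof. by []. Qed.

Let card_split dt :
  #|[set y in Tq :|: D2 | cin dt D3 y == 0]| =
  #|[set y in Tq | cin dt D3 y == 0]| + #|[set y in Tc | cin dt D3 y == 0]| + (cin dt D3 c == 0).
Proof.
have -> : [set y in Tq :|: D2 | cin dt D3 y == 0] =
   [set y in Tq | cin dt D3 y == 0] :|: ([set y in Tc | cin dt D3 y == 0] :|:
     [set y in [set c] | cin dt D3 y == 0]).
  apply/setP => y; rewrite !inE.
  by case: (y \in Tq); case: (y \in Tc); case: (y == c); case: (_ == 0).
rewrite !cardsU !(disjoint_setI0 _) ?cards0 ?subn0; first last.
- rewrite -setI_eq0; apply/eqP/setP => y; rewrite !inE.
  case: (y =P c) => [->|_]; last by rewrite !andbF.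
  by rewrite (negbTE (at_cT at_)).
- rewrite -setI_eq0; apply/eqP/setP => y; rewrite !inE.
  case yT : (y \in Tq) => //=; have /andP[+ _] := T2 yT; rewrite !inE negb_or => /andP[h1 h2].
  by rewrite (negbTE h1) (negbTE h2) /= andbF.
rewrite addnA; congr (_ + _); case E : (cin dt D3 c == 0).
  transitivity #|[set c]|; last by rewrite cards1.
  apply: eq_card => y; rewrite !inE.
  by case: (y =P c) => [->|//]; rewrite E.
apply/eqP; rewrite cards_eq0; apply/eqP/setP => y; rewrite !inE.
by case: (y =P c) => [->|//]; rewrite E.
Qed.

(** The two solutions are stored on disjoint vertex sets, so they combine piecewise. Arcs stored in
    the subtree of [c] end in that subtree or in [Sv c]; degrees therefore add up on [Sv c] and are
    unaffected at all other outside vertices. *)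
Lemma Sem_glue a a1 a2 : Sem q Tq a1 -> Sem (Some c) Tc a2 -> mergeable q c a a1 a2 ->
  Sem q (Tq :|: D2) a.
Proof.
move=> [dt1 [s1 f1]] [dt2 [s2 f2]] [mx mc [mi mo ms] mf mk].
pose dt y := if y \in D2 then dt2 y else dt1 y.
have e1 : {in D1, dt =1 dt1} by move=> y y1; rewrite /dt; case: ifP => // /(d12 y1).
have e2 : {in D2, dt =1 dt2} by move=> y y2; rewrite /dt y2.
have l1 y : y \in D1 -> dloc dt y by move=> y1; rewrite /dloc e1 //; exact: (sol_loc s1 y1).
have l2 y : y \in D2 -> dloc dt y by move=> y2; rewrite /dloc e2 //; exact: (sol_loc s2 y2).
have i1 u : cin dt D1 u = cin dt1 D1 u by apply: cin_ext.
have i2 u : cin dt D2 u = cin dt2 D2 u by apply: cin_ext.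
have o1 u : cout dt D1 u = cout dt1 D1 u by apply: cout_ext.
have o2 u : cout dt D2 u = cout dt2 D2 u by apply: cout_ext.
have i0 u : u \in D2 -> cin dt D1 u = 0.
  move=> u2; apply: cin0 => // [y|]; first exact: z1.
  by apply/negP => /d12; apply.
have o0 u : u \in D2 -> cout dt D1 u = 0.
  move=> u2; apply: cout0 => // [y|]; first exact: z1.
  by apply/negP => /d12; apply.
have i0' u : u \notin D2 -> u \notin Sv c -> cin dt D2 u = 0.
  by move=> u2 uc; apply: cin0 => // y; exact: z2.
have o0' u : u \notin D2 -> u \notin Sv c -> cout dt D2 u = 0.
  by move=> u2 uc; apply: cout0 => // y; exact: z2.
have iT u : u \in Tq -> cin dt D3 u = cin dt1 D1 u.
  by move=> /T2/andP[h1 h2]; rewrite cinU i0' // addn0 i1.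
have oT u : u \in Tq -> cout dt D3 u = cout dt1 D1 u.
  by move=> /T2/andP[h1 h2]; rewrite coutU o0' // addn0 o1.
have iD u : u \in D2 -> cin dt D3 u = cin dt2 D2 u by move=> h; rewrite cinU i0 // i2.
have oD u : u \in D2 -> cout dt D3 u = cout dt2 D2 u by move=> h; rewrite coutU o0 // o2.
have cD2 : c \in D2 by apply: setU11.
have cB : c \in Bq (Some c) by apply: setU11.
have [sic _] := if_in f2 cB; have [soc _] := if_out f2 cB.
exists dt; split; split.
- by move=> y; rewrite D3E => /setUP[/l1|/l2].
- move=> y p /setUP[yT|y2] + yp.
    have p1 := at_Pq at_ yT yp; move=> _; rewrite /dagree !e1 //; last exact: T1.
    exact: (sol_agree s1).
  case/setU1P: (y2) => [yc|yT] p3.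
    have {p3} p1 : p \in D1.
      move: p3; rewrite D3E => /setUP[//|p2]; case: (dB p2); apply: (subsetP Sc_Bq).
      by case: yp; rewrite yc.
    rewrite /dagree e2 // e1 // yc => u z hu hz.
    have uB := setU1r c hu; have zB := setU1r c hz.
    have [E1 E2] := mc u z hu hz; have [F1 F2] := if_x f2 erefl uB zB.
    case Eq : q (at_par at_) => [v|] /=; last first.
      by move=> hr; move: hu; rewrite hr inE.
    rewrite yc in yp; move=> cv; have vp := par_uniq cv yp; rewrite vp in Eq.
    have [||G1 G2] := if_x f1 Eq (u := u) (z := z); try by apply: (subsetP (Sv_par yp)).
    by rewrite -F1 -F2 -G1 -G2.
  have p2 := at_Pc at_ yT yp; rewrite /dagree !e2 //.
  exact: (sol_agree s2).
- move=> y /setUP[yT|y2]; first by rewrite iT //; exact: (sol_in s1).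
  rewrite iD //; case/setU1P: y2 => [->|]; last exact: (sol_in s2).
  by rewrite -D2c -sic.
- move=> y /setUP[yT|y2]; first by rewrite oT //; exact: (sol_out s1).
  rewrite oD //; case/setU1P: y2 => [->|]; last exact: (sol_out s2).
  by rewrite -D2c -soc.
- move=> y /setUP[yT|y2]; first by rewrite iT // e1 ?T1 //; exact: (sol_start s1).
  rewrite iD // e2 //; case/setU1P: y2 => [->|]; last exact: (sol_start s2).
  rewrite -D2c -sic => /ms; by have [<- _] := if_x f2 erefl cB cB.
- move=> v qv u z hu hz; have [-> ->] := mx v qv u z hu hz.
  by rewrite e1; [exact: (if_x f1) | rewrite /Dq qv setU11].
- move=> u uB; have [-> m1 _ _] := mf u uB; split=> //.
  have [-> _] := if_in f1 uB; rewrite cinU i1; congr (_ + _).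
  have u2 : u \notin D2 by apply/negP => /dB; apply.
  case: ifP => [uc|/negbT uc]; last by rewrite i0'.
  by rewrite i2; have [->] := if_in f2 (setU1r c uc).
- move=> u uB; have [_ _ -> m1] := mf u uB; split=> //.
  have [-> _] := if_out f1 uB; rewrite coutU o1; congr (_ + _).
  have u2 : u \notin D2 by apply/negP => /dB; apply.
  case: ifP => [uc|/negbT uc]; last by rewrite o0'.
  by rewrite o2; have [->] := if_out f2 (setU1r c uc).
- rewrite mk card_split (if_k f1) (if_k f2) sic -iD // -D2c; congr (_ + _ + _).
    by apply: eq_card => y; rewrite !inE; case yT : (y \in Tq) => //=; rewrite iT.
  apply: eq_card => y; rewrite !inE; case yT : (y \in Tc) => //=.
  by rewrite iD // setU1r.
Qed.

(** The same [dt] serves both parts; the two interfaces are read off by restricting the degree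
    counts to the two vertex sets. *)
Lemma Sem_split a : Sem q (Tq :|: D2) a ->
  exists a1 a2, [/\ Sem q Tq a1, Sem (Some c) Tc a2 & mergeable q c a a1 a2].
Proof.
move=> [dt [s f]].
have l1 y : y \in D1 -> dloc dt y.
  by move=> y1; apply: (sol_loc s); rewrite D3E inE y1.
have l2 y : y \in D2 -> dloc dt y.
  by move=> y2; apply: (sol_loc s); rewrite D3E inE y2 orbT.
have i0 u : u \in D2 -> cin dt D1 u = 0.
  move=> u2; apply: cin0 => // [y|]; first exact: z1.
  by apply/negP => /d12; apply.
have o0 u : u \in D2 -> cout dt D1 u = 0.
  move=> u2; apply: cout0 => // [y|]; first exact: z1.
  by apply/negP => /d12; apply.
have i0' u : u \notin D2 -> u \notin Sv c -> cin dt D2 u = 0.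
  by move=> u2 uc; apply: cin0 => // y; exact: z2.
have o0' u : u \notin D2 -> u \notin Sv c -> cout dt D2 u = 0.
  by move=> u2 uc; apply: cout0 => // y; exact: z2.
have iT u : u \in Tq -> cin dt D3 u = cin dt D1 u.
  by move=> /T2/andP[h1 h2]; rewrite cinU i0' // addn0.
have oT u : u \in Tq -> cout dt D3 u = cout dt D1 u.
  by move=> /T2/andP[h1 h2]; rewrite coutU o0' // addn0.
have iD u : u \in D2 -> cin dt D3 u = cin dt D2 u by move=> h; rewrite cinU i0.
have oD u : u \in D2 -> cout dt D3 u = cout dt D2 u by move=> h; rewrite coutU o0.
have cD2 : c \in D2 by apply: setU11.
have c3 : c \in Tq :|: D2 by rewrite inE cD2 orbT.
have T23 u : u \in Tc -> u \in Tq :|: D2 by move=> h; rewrite inE setU1r ?orbT.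
have T13 u : u \in Tq -> u \in Tq :|: D2 by move=> h; rewrite inE h.
have D13 u : u \in D1 -> u \in D3 by move=> h; rewrite D3E inE h.
have D23 u : u \in D2 -> u \in D3 by move=> h; rewrite D3E inE h orbT.
pose a1 := AState (sx a) (se a) (cin dt D1) (cout dt D1) #|[set y in Tq | cin dt D1 y == 0]|.
pose a2 := AState (px (dt c)) (pe (dt c)) (cin dt D2) (cout dt D2) #|[set y in Tc | cin dt D2 y == 0]|.
have leB u : u \in Bq q -> [/\ cin dt D1 u + cin dt D2 u = si a u, si a u <= 1,
    cout dt D1 u + cout dt D2 u = so a u & so a u <= 1].
  move=> uB; have [E1 h1] := if_in f uB; have [E2 h2] := if_out f uB.
  by split=> //; rewrite ?E1 ?E2 ?cinU ?coutU.
exists a1, a2; split.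
- exists dt; split; split=> //.
  + move=> y p yT p1; apply: (sol_agree s); [exact: T13 | exact: D13].
  + by move=> y yT; rewrite -iT //; apply: (sol_in s); exact: T13.
  + by move=> y yT; rewrite -oT //; apply: (sol_out s); exact: T13.
  + by move=> y yT; rewrite -iT //; apply: (sol_start s); exact: T13.
  + exact: (if_x f).
  + by move=> u /leB[h1 h2 _ _]; split=> //=; lia.
  + by move=> u /leB[_ _ h1 h2]; split=> //=; lia.
- exists dt; split; split=> //.
  + move=> y p yT p1; apply: (sol_agree s); [exact: T23 | exact: D23].
  + by move=> y yT; rewrite D2c -iD ?setU1r //; apply: (sol_in s); exact: T23.
  + by move=> y yT; rewrite D2c -oD ?setU1r //; apply: (sol_out s); exact: T23.
  + by move=> y yT; rewrite D2c -iD ?setU1r //; apply: (sol_start s); exact: T23.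
  + by move=> v [<-].
  + move=> u /setU1P[->|/(subsetP Sc_Bq)/leB[h1 h2 _ _]]; split=> //=; last lia.
    by rewrite -iD //; exact: (sol_in s).
  + move=> u /setU1P[->|/(subsetP Sc_Bq)/leB[_ _ h1 h2]]; split=> //=; last lia.
    by rewrite -oD //; exact: (sol_out s).
split=> //=.
- move=> u z hu hz; case Eq : q (at_par at_) => [v|] /=; last first.
    by move=> hr; move: hu; rewrite hr inE.
  move=> cv; have uB := subsetP (Sv_par cv) u hu; have zB := subsetP (Sv_par cv) z hz.
  have [-> ->] := if_x f Eq uB zB.
  apply: (sol_agree s) => //; first by rewrite /Dq Eq setU11.
- by rewrite -iD // -oD //; split; [exact: (sol_in s) | exact: (sol_out s) | exact: (sol_start s)].
- move=> u uB; have [<- h1 <- h2] := leB u uB; split=> //; try lia.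
    case: ifP => // /negbT uc; rewrite i0' //; by apply/negP => /dB; apply.
  case: ifP => // /negbT uc; rewrite o0' //; by apply/negP => /dB; apply.
- rewrite (if_k f) card_split -iD //; congr (_ + _ + _).
    by apply: eq_card => y; rewrite !inE; case yT : (y \in Tq) => //=; rewrite iT.
  by apply: eq_card => y; rewrite !inE; case yT : (y \in Tc) => //=; rewrite iD // setU1r.
Qed.

End Merge.
End ElimTree.

(** * Attaching subtrees in order of decreasing rank *)

Section Subtrees.
Variables (T : finType) (G : sgraph T) (rk : T -> nat) (b n : nat).
Hypothesis rk_inj : injective rk.
Hypothesis rk_lt : forall u, rk u < n.
Variable cs : nat -> T.
Hypothesis csP : forall t, t < n -> rk (cs t) = n - t.+1.
Local Notation Sv := (Sv G rk).
Local Notation Bv := (Bv G rk).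
Local Notation Sem := (Sem G rk b).

Definition isparb (c : T) (q : option T) : bool :=
  if q is Some p then (p \in Sv c) && [forall u in Sv c, rk u <= rk p] else Sv c == set0.

Lemma isparP c q : reflect (ispar G rk c q) (isparb c q).
Proof.
case: q => [p|]; last exact: eqP.
apply: (iffP andP) => -[h1 h2]; split=> //.
  by move=> u uS; move/forall_inP: h2; apply.
by apply/forall_inP.
Qed.

(* The vertices below q after the t vertices of largest rank have been attached
   to their parents. *)
Fixpoint subtree (t : nat) (q : option T) : {set T} :=
  if t is t'.+1 then
    if isparb (cs t') q then subtree t' q :|: (cs t' |: subtree t' (Some (cs t')))
    else subtree t' q
  else set0.

(** The vertices not yet attached to their parents, and the virtual root. *)
Definition active (t : nat) (q : option T) := if q is Some v then rk v < n - t else true.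

Record subinv t : Prop := SubInv {
  su_rk : forall q u, active t q -> u \in subtree t q -> n - t <= rk u;
  su_dis : forall q q', active t q -> active t q' -> q != q' ->
    [disjoint subtree t q & subtree t q'];
  su_S : forall q y u, active t q -> y \in subtree t q -> u \in Sv y ->
    u \in Dq q (subtree t q) :|: Bq G rk q;
  su_P : forall q y p, active t q -> y \in subtree t q -> par G rk y p ->
    p \in Dq q (subtree t q);
  su_all : forall u, n - t <= rk u -> exists2 q, active t q & u \in subtree t q }.

Lemma subinv0 : subinv 0.
Proof.
split=> [q u|q q' _ _ _|q y u|q y p|u]; rewrite ?inE //.
  by rewrite -setI_eq0 set0I.
by rewrite subn0 leqNgt rk_lt.
Qed.

Lemma active_step t q : t < n -> active t.+1 q -> active t q /\ q != Some (cs t).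
Proof.
case: q => //= v tn h; split; first lia.
by apply: contraTneq h => -[->]; rewrite csP // ltnn.
Qed.

Lemma attach_step t q : t < n -> subinv t -> active t.+1 q -> isparb (cs t) q ->
  attach G rk q (subtree t q) (cs t) (subtree t (Some (cs t))).
Proof.
move=> tn inv aq1 pq; have [aq qc] := active_step tn aq1.
have ac : active t (Some (cs t)) by rewrite /= csP //; lia.
have rc := csP tn.
have hT u : u \in subtree t q -> n - t <= rk u by apply: (su_rk inv).
have hC u : u \in subtree t (Some (cs t)) -> n - t <= rk u by apply: (su_rk inv).
have hC' u : u \in cs t |: subtree t (Some (cs t)) -> n - t.+1 <= rk u.
  by case/setU1P => [->|/hC]; lia.
have hB u : u \in Bq G rk q -> rk u < n - t.+1.
  case: q aq1 {aq qc pq hT} => [v|] /=; last by rewrite inE.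
  by move=> av /Bv_rk h; apply: leq_ltn_trans av.
split.
- exact/isparP.
- rewrite -setI_eq0; apply/eqP/setP => u; rewrite [RHS]inE; apply/negbTE/negP.
  case/setIP => u1 u2.
  have uT : u \in subtree t q -> False.
    move=> uT; case/setU1P: u1 => [E|uC]; first by have := hT u uT; rewrite E rc; lia.
    by have /disjointFr/(_ uT) := su_dis inv aq ac qc; rewrite uC.
  case: q aq1 u2 uT {aq qc pq hT hB} => [v|] /=; last by move=> _ u2; apply.
  move=> av /setU1P[E|u2]; last by apply.
  by have := hC' u u1; rewrite E; lia.
- rewrite -setI_eq0; apply/eqP/setP => u; rewrite [RHS]inE; apply/negbTE/negP.
  by case/setIP => /hC' h1 /hB; lia.
- rewrite -setI_eq0; apply/eqP/setP => u; rewrite [RHS]inE; apply/negbTE/negP.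
  by case/setIP => /hT h1 /hB; lia.
- by apply/negP => /hC; lia.
- rewrite -setI_eq0; apply/eqP/setP => u; rewrite [RHS]inE; apply/negbTE/negP.
  by case/setIP => /hC h1 /Bv_rk; lia.
- move=> y u yD uS; case: (boolP (y \in subtree t q)) => [yT|yT]; first exact: (su_S inv aq yT).
  case: q yD yT {aq1 aq qc pq hT hB} => [v|] /=; last by move=> ->.
  by case/setU1P => [E|->//] _; apply/setUP; right; apply: setU1r; rewrite -E.
- move=> y u /setU1P[->|yT] uS; first by rewrite inE uS orbT.
  have := su_S inv ac yT uS; rewrite /= => /setUP[h|/setU1P[->|h]]; apply/setUP; [by left| |by right].
  by left; exact: setU11.
- by move=> y p; apply: (su_P inv).
- by move=> y p; apply: (su_P inv ac).
Qed.

Lemma subinv_step t : t < n -> subinv t -> subinv t.+1.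
Proof.
move=> tn inv; have rc := csP tn.
have ac : active t (Some (cs t)) by rewrite /= rc; lia.
set c := cs t in rc ac.
have hC u : u \in subtree t (Some c) -> n - t <= rk u by apply: (su_rk inv).
have Dsub q : {subset Dq q (subtree t q) <= Dq q (subtree t.+1 q)}.
  move=> u; rewrite /=; case: ifP => // _; case: q => [v|] /=; rewrite !inE; last by move=> ->.
  by case/orP => [->|->] //; rewrite ?orbT.
have Csub q : isparb c q -> {subset c |: subtree t (Some c) <= subtree t.+1 q}.
  by move=> pq u uC; rewrite /= pq inE uC orbT.
have one q q' : isparb c q -> isparb c q' -> q = q'.
  move=> /isparP + /isparP; case: q => [p|]; case: q' => [p'|] //=.
  - by move=> h h'; rewrite (par_uniq rk_inj h h').
  - by move=> [h _] E; move: h; rewrite (E : Sv c = set0) inE.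
  - by move=> E [h _]; move: h; rewrite (E : Sv c = set0) inE.
split.
- move=> q u aq1; have [aq _] := active_step tn aq1; rewrite /=; case: ifP => _.
    case/setUP => [/(su_rk inv aq) h|/setU1P[->|/hC h]]; [|rewrite rc|]; lia.
  by move/(su_rk inv aq) => h; lia.
- move=> q q' aq1 aq1' ne; have [aq qc] := active_step tn aq1; have [aq' qc'] := active_step tn aq1'.
  have aux q1 q2 : active t.+1 q1 -> active t.+1 q2 -> q1 != q2 -> isparb c q1 ->
      [disjoint subtree t q1 :|: (c |: subtree t (Some c)) & subtree t q2].
    move=> a1 a2 n12 p1; have [a1' q1c] := active_step tn a1; have [a2' q2c] := active_step tn a2.
    rewrite -setI_eq0; apply/eqP/setP => u; rewrite [RHS]inE; apply/negbTE/negP => /setIP[u1 u2].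
    case/setUP: u1 => [u1|/setU1P[E|uC]].
    + by have /disjointFr/(_ u1) := su_dis inv a1' a2' n12; rewrite u2.
    + by have := su_rk inv a2' u2; rewrite E rc; clear -tn; lia.
    + by have /disjointFr/(_ u2) := su_dis inv a2' ac q2c; rewrite uC.
  rewrite /=; case: ifP => p1; case: ifP => p2.
  + by rewrite (one _ _ p1 p2) eqxx in ne.
  + exact: aux.
  + by rewrite disjoint_sym; apply: aux => //; rewrite eq_sym.
  + exact: (su_dis inv).
- move=> q y u aq1 yT uS; have [aq _] := active_step tn aq1.
  have old : y \in subtree t q -> u \in Dq q (subtree t.+1 q) :|: Bq G rk q.
    by move=> /(su_S inv aq)/(_ uS)/setUP[/Dsub|] h; rewrite inE h ?orbT.
  rewrite /= -/c in yT; move: yT; case: ifP => // pq /setUP[//|yC].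
  have at_ := attach_step tn inv aq1 pq.
  have /setUP[uC|uC] := at_Sc at_ yC uS.
    rewrite inE; apply/orP; left; have := Csub q pq u uC.
    by case: q {aq1 aq old pq at_} => //= v h; rewrite inE h orbT.
  rewrite inE; apply/orP; right; move: uC (at_par at_).
  case: q {aq1 aq old pq at_} => [p|] /= uC; last by move=> E; move: uC; rewrite (E : Sv c = set0) inE.
  by move=> h; apply: (subsetP (Sv_par rk_inj h)).
- move=> q y p aq1 yT yp; have [aq _] := active_step tn aq1.
  rewrite /= -/c in yT; move: yT; case: ifP => pq; last by move=> yT; apply: Dsub; apply: (su_P inv aq yT).
  case/setUP => [yT|]; first by apply: Dsub; apply: (su_P inv aq yT).
  case/setU1P => [E|yC].
    move/isparP: pq; case: q {aq1 aq} => [v|] /= pq.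
      by rewrite E in yp; rewrite (par_uniq rk_inj yp pq) setU11.
    by case: yp => h _; move: h; rewrite E (pq : Sv c = set0) inE.
  have := Csub q pq p (su_P inv ac yC yp).
  by case: q {aq1 aq pq} => //= v h; rewrite inE h orbT.
move=> u hu; case: (leqP (n - t) (rk u)) => hu'.
  have [q aq uq] := su_all inv hu'.
  have [q1|nq1] := boolP (active t.+1 q).
    by exists q => //=; case: ifP => // _; rewrite inE uq.
  have qc : q = Some c.
    case: q aq nq1 {uq} => //= v h1 h2; congr Some; apply: rk_inj; rewrite rc; lia.
  have [q' pq'] : exists q', isparb c q'.
    case E : (Sv c == set0); first by exists None; rewrite /= E.
    by have [p hp] := par_ex E; exists (Some p); apply/isparP.
  exists q'; last by apply: (Csub _ pq'); rewrite qc in uq; rewrite inE uq orbT.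
  by case: q' pq' => //= p /andP[/Sv_rk]; rewrite rc.
have uc : u = c by apply: rk_inj; rewrite rc; lia.
have [q' pq'] : exists q', isparb c q'.
  case E : (Sv c == set0); first by exists None; rewrite /= E.
  by have [p hp] := par_ex E; exists (Some p); apply/isparP.
exists q'; last by apply: (Csub _ pq'); rewrite uc setU11.
by case: q' pq' => //= p /andP[/Sv_rk]; rewrite rc.
Qed.

Lemma subinvP t : t <= n -> subinv t.
Proof.
by elim: t => [_|t IH tn]; [exact: subinv0 | apply: subinv_step => //; apply: IH; exact: ltnW].
Qed.

Lemma subtree_full : subtree n None = [set: T].
Proof.
apply/setP => u; rewrite inE.
have [|[v|] // av uT] := su_all (subinvP (leqnn n)) (u := u); first by rewrite subnn.
by move: av; rewrite /= subnn.
Qed.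

(** One step of the dynamic programming at the level of meanings. All descendants of [cs t] have
    larger rank, so its own subtree is complete when it is attached. *)
Lemma Sem_step t q a : t < n -> active t.+1 q ->
  Sem q (subtree t.+1 q) a <->
  if isparb (cs t) q then exists a1 a2, [/\ Sem q (subtree t q) a1,
    Sem (Some (cs t)) (subtree t (Some (cs t))) a2 & mergeable G rk q (cs t) a a1 a2]
  else Sem q (subtree t q) a.
Proof.
move=> tn aq /=; case: ifP => // pq.
have at_ := attach_step tn (subinvP (ltnW tn)) aq pq.
split; first exact: (Sem_split rk_inj at_).
by case=> a1 [a2 [h1 h2 h3]]; apply: (Sem_glue rk_inj at_ h1 h2 h3).
Qed.

End Subtrees.

(** * From local descriptions to isometric path partitions *)

Section PathsFromArcs.
Variables (T : finType) (G : sgraph T) (A : rel T) (l : T -> nat) (rep : T -> T) (H : T -> T -> nat).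
Hypothesis A_adj : forall p u, A p u -> G p u.
Hypothesis A_out : forall p u u', A p u -> A p u' -> u = u'.
Hypothesis A_lvl : forall p u, A p u -> l u = (l p).+1.
Hypothesis A_start : forall u, (forall p, ~~ A p u) -> l u = 0.
Hypothesis A_rep : forall p u, A p u -> rep p = rep u.
Hypothesis HE : forall u, H (rep u) u = l u.
Hypothesis H_lip : forall u z z', connect G z z' -> H (rep u) z <= H (rep u) z' + dd G z z'.

Definition prd u := if [pick p | A p u] is Some p then p else u.
Definition nx u := if [pick w | A u w] is Some w then w else u.
Definition st u := iter (l u) prd u.

Lemma prdP u : l u != 0 -> A (prd u) u.
Proof.
rewrite /prd; case: pickP => [p //|no]; rewrite A_start ?eqxx // => p.
by rewrite no.
Qed.

Lemma nxP u w : A u w -> nx u = w.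
Proof.
by rewrite /nx => Auw; case: pickP => [w' /A_out/(_ Auw)//|/(_ w)]; rewrite Auw.
Qed.

Lemma st_prd u : l u != 0 -> st (prd u) = st u.
Proof.
move=> lu; have := A_lvl (prdP lu); rewrite /st => E.
by rewrite E iterSr.
Qed.

(* The vertices of the block of s are s, nx s, nx (nx s), ... *)
Lemma chain u s : st u = s ->
  [/\ iter (l u) nx s = u, st s = s, l s = 0, rep s = rep u &
      forall i, i <= l u -> [/\ l (iter i nx s) = i, st (iter i nx s) = s &
        i < l u -> A (iter i nx s) (iter i.+1 nx s)]].
Proof.
move E : (l u) => m; elim: m u E => [|m IH] u E su.
  have us : u = s by move: su; rewrite /st E.
  rewrite -us /st E; split=> //.
  by move=> i; rewrite leqn0 => /eqP-> /=; rewrite E.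
have lu : l u != 0 by rewrite E.
have Ap := prdP lu; have lp : l (prd u) = m by have := A_lvl Ap; rewrite E => -[].
have [|h1 h2 h3 h4 h5] := IH (prd u) lp; first by rewrite st_prd.
have Eu : iter m.+1 nx s = u by rewrite iterS h1; apply: nxP.
split=> //; first by rewrite h4; apply: A_rep.
move=> i; rewrite leq_eqVlt => /orP[/eqP->|im].
  by rewrite Eu E; split=> //; rewrite ltnn.
have [k1 k2 k3] := h5 i im; split=> // _.
move: im; rewrite ltnS leq_eqVlt => /orP[/eqP->|/k3//].
by rewrite Eu h1.
Qed.

Definition starts : {set T} := [set u | l u == 0].
Definition block s : {set T} := [set u | st u == s].

Lemma st_start u : st u \in starts.
Proof. by rewrite inE; have [_ _ -> _ _] := chain (erefl (st u)). Qed.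

Lemma st_id s : s \in starts -> st s = s.
Proof. by rewrite inE /st => /eqP->. Qed.

(** The potential of the block is 1-Lipschitz and rises by one along each arc. Its values at both
    ends bound their distance from below by the number of arcs. *)
Lemma block_isometric s : s \in starts -> exists (x : T) (p : seq T),
  isometric G x p /\ block s = [set y | y \in x :: p].
Proof.
move=> sS; have sB : s \in block s by rewrite inE st_id.
case: (arg_maxnP (P := fun u => u \in block s) l sB) => u uB mx.
have su : st u = s by apply/eqP; move: uB; rewrite inE.
have [h1 h2 h3 h4 h5] := chain su.
set L := l u in h1 h5 *.
have sz : size (traject nx (nx s) L) = L by rewrite size_traject.
have pth m i : i + m <= L -> path G (iter i nx s) (traject nx (iter i.+1 nx s) m).
  elim: m i => //= m IH i im; apply/andP; split; last by have := IH i.+1; rewrite /=; apply; lia.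
  by have [_ _ h] := h5 i (leq_trans (leq_addr _ _) im); apply: A_adj; apply: h; lia.
have lst : last s (traject nx (nx s) L) = u by rewrite last_traject.
exists s, (traject nx (nx s) L); split.
  apply/isometricP; have ps : path G s (traject nx (nx s) L) by apply: (pth L 0).
  split=> //; apply/eqP; rewrite eqn_leq dd_path // andbT sz lst.
  have csu : connect G u s.
    rewrite sym_connect_sym; last exact: adj_sym.
    by apply/connectP; exists (traject nx (nx s) L).
  have := H_lip s csu; rewrite {1}h4 !HE -/L h3 add0n ddC //; exact: adj_sym.
apply/setP => y; rewrite [LHS]in_set [RHS]in_set -[s :: _]/(traject nx s L.+1).
apply/eqP/trajectP.
  move=> sy; have [<- _ _ _ _] := chain sy; exists (l y) => //.
  by rewrite ltnS; apply: mx; rewrite inE sy.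
by case=> i; rewrite ltnS => iL ->; have [] := h5 i iL.
Qed.

Lemma partition_of_arcs : isometric_path_partition G #|starts|.
Proof.
have bs u : u \in block (st u) by rewrite inE.
have binj : {in starts &, injective block}.
  move=> s s' sS sS' E; have : s \in block s' by rewrite -E inE st_id.
  by rewrite inE st_id // => /eqP.
exists [set block s | s in starts]; split.
- apply/and3P; split.
  + apply/eqP/setP => u; rewrite inE; apply/bigcupP; exists (block (st u)) => //.
    exact/imset_f/st_start.
  + apply/trivIsetP => _ _ /imsetP[s sS ->] /imsetP[s' sS' ->] ne.
    rewrite -setI_eq0; apply/eqP/setP => u; rewrite !inE; apply/negbTE/negP.
    by move=> /andP[/eqP us /eqP us']; rewrite -us us' eqxx in ne.
  + apply/imsetP => -[s sS E]; have : s \in block s by rewrite inE st_id.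
    by rewrite -E inE.
- exact: card_in_imset.
- by move=> _ /imsetP[s sS ->]; apply: block_isometric.
Qed.

End PathsFromArcs.

Lemma set_min (T : finType) (S : {set T}) (g : T -> nat) : exists m,
  [/\ forall w, w \in S -> m <= g w, S != set0 -> exists2 w, w \in S & m = g w &
      S = set0 -> m = 0].
Proof.
case: (set_0Vmem S) => [->|[w0 wS]].
  by exists 0; split=> [w||]; rewrite ?inE // eqxx.
case: (arg_minnP (P := fun w => w \in S) g wS) => w hw mn.
by exists (g w); split=> // [_|E]; [exists w | move: wS; rewrite E inE].
Qed.

Section Solutions.
Variables (T : finType) (G : sgraph T) (rk : T -> nat) (b : nat).
Hypothesis rk_inj : injective rk.
Local Notation d := (dd G).
Local Notation Sv := (Sv G rk).
Local Notation Bv := (Bv G rk).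

Definition arc (dt : T -> data T) (p u : T) : bool :=
  (pP (dt u) == Some p) || (pQ (dt p) == Some u).

(** Stored at both ends, an arc would give each end a smaller rank than the other; so the sum counts
    every arc once. *)
Lemma cin_card dt c : (forall y, dloc G rk b dt y) -> cin dt [set: T] c = #|[set p | arc dt p c]|.
Proof.
move=> hl; rewrite /cin big_split /= -sum1dep_card [RHS]big_mkcond /=.
have -> : \sum_(y in [set: T]) (y == c) && isSome (pP (dt y)) = \sum_p (pP (dt c) == Some p).
  rewrite (bigD1 c) ?inE //= eqxx big1 ?addn0 => [|y /andP[_ /negbTE->]//].
  case: (pP (dt c)) => [p|] /=; last by rewrite big1.
  rewrite (bigD1 p) //= eqxx big1 // => p' /negbTE ne; apply/eqP; rewrite eqb0.
  by apply/eqP => -[E]; rewrite E eqxx in ne.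
rewrite (eq_bigl xpredT); last by move=> y; rewrite inE.
rewrite -big_split; apply: eq_bigr => y _ /=; rewrite /arc.
case: eqP => [E1|_]; case: eqP => [E2|_] //=.
have [/Sv_rk h1 _ _ _] := loc_Q (hl y) E1; have [/Sv_rk h2 _ _ _] := loc_P (hl c) E2.
by lia.
Qed.

Lemma cout_card dt c : (forall y, dloc G rk b dt y) -> cout dt [set: T] c = #|[set u | arc dt c u]|.
Proof.
move=> hl; rewrite /cout big_split /= -sum1dep_card [RHS]big_mkcond /=.
have -> : \sum_(y in [set: T]) (y == c) && isSome (pQ (dt y)) = \sum_p (pQ (dt c) == Some p).
  rewrite (bigD1 c) ?inE //= eqxx big1 ?addn0 => [|y /andP[_ /negbTE->]//].
  case: (pQ (dt c)) => [p|] /=; last by rewrite big1.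
  rewrite (bigD1 p) //= eqxx big1 // => p' /negbTE ne; apply/eqP; rewrite eqb0.
  by apply/eqP => -[E]; rewrite E eqxx in ne.
rewrite (eq_bigl xpredT); last by move=> y; rewrite inE.
rewrite -big_split; apply: eq_bigr => y _ /=; rewrite /arc.
case: eqP => [E1|_]; case: eqP => [E2|_] //=.
have [/Sv_rk h1 _ _ _] := loc_P (hl y) E1; have [/Sv_rk h2 _ _ _] := loc_Q (hl c) E2.
by lia.
Qed.

Section Extension.
Variable dt : T -> data T.
Hypothesis hl : forall y, dloc G rk b dt y.
Hypothesis hagree : forall c p, par G rk c p -> dagree G rk dt c p.
Hypothesis rs : symmetric G.

(** Global data on the vertices of rank below [t]: [rep u] represents the path of [u] and
    [H (rep u)] is its potential. The relations [pe] of all bags become equality of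
    representatives. *)
Definition extends t (rep : T -> T) (H : T -> T -> nat) :=
  [/\ forall u, rk u < t -> rk (rep u) < t,
      forall v u z, rk v < t -> u \in Bv v -> z \in Bv v ->
        pe (dt v) u z = (rep u == rep z) /\ px (dt v) u z = H (rep u) z &
      forall u z z', rk u < t -> rk z < t -> rk z' < t -> connect G z z' ->
        H (rep u) z <= H (rep u) z' + d z z'].

(* McShane extension: the potential of a class is extended to a new vertex v by
   its local value when v shares a bag with the class, and by the largest
   1-Lipschitz value otherwise. *)
Lemma extension_step t rep H v : rk v = t -> extends t rep H ->
  exists rep' H', extends t.+1 rep' H'.
Proof.
move=> rv [h1 h2 h3].
pose S := Sv v; have Srk u : u \in S -> rk u < t by rewrite -rv; apply: Sv_rk.
pose x := px (dt v); pose e := pe (dt v).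
have vB : v \in Bv v := setU11 _ _.
have SB u : u \in S -> u \in Bv v by apply: setU1r.
have locS u z : u \in S -> z \in S -> e u z = (rep u == rep z) /\ x u z = H (rep u) z.
  case E : (Sv v == set0); first by rewrite /S (eqP E) inE.
  have [p vp] := par_ex E; have sub := subsetP (Sv_par rk_inj vp) => hu hz.
  have [Ex Ee] := hagree vp hu hz; rewrite /e /x Ex Ee; apply: h2; rewrite ?sub //.
  by apply: Srk; case: vp.
(* All Lipschitz inequalities between [v] and an earlier vertex reduce to inequalities at [S]. *)
have sepv z : rk z < t -> connect G v z -> exists2 w, w \in S & d v z = d v w + d w z.
  by rewrite -rv => lt; apply: Sv_separates.
have [mn hmn] := choice (fun g : T -> nat => set_min S g).
(* The vertex [v] joins the class of a bag vertex on its path if there is one, and otherwise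
   represents a class of its own. *)
pose r0 := if [pick u0 in S | e v u0] is Some u0 then rep u0 else v.
pose rep' u := if u == v then r0 else rep u.
(* Dually, a class opened by [v] is extended from its values on [S] to all earlier vertices; the
   empty minimum is 0. *)
pose newrow z := mn (fun w => x v w + d w z).
pose newcol r := if [pick u1 in S | rep u1 == r] is Some u1 then x u1 v
                 else mn (fun w => H r w + d w v).
pose H' r z := if r == v then (if z == v then x v v else newrow z)
               else (if z == v then newcol r else H r z).
have repv u : rk u < t -> (rep u == v) = false.
  by move=> /h1 lt; apply/eqP => E; rewrite E rv ltnn in lt.
have uv u : rk u < t -> (u == v) = false.
  by move=> lt; apply/eqP => E; rewrite E rv ltnn in lt.
have rep'E u : rk u < t -> rep' u = rep u by move=> /uv; rewrite /rep' => ->.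
have HE r z : (r == v) = false -> (z == v) = false -> H' r z = H r z.
  by rewrite /H' => -> ->.
have lto u : rk u < t.+1 -> u = v \/ rk u < t.
  rewrite ltnS leq_eqVlt => /orP[/eqP E|]; [left | by right].
  by apply: rk_inj; rewrite E.
have dC := ddC rs.
have cC : connect_sym G by apply: sym_connect_sym.
have lip u z y : u \in Bv v -> z \in Bv v -> y \in Bv v -> x u y <= x u z + d z y.
  exact: (loc_lip (hl v)).
have rowS u z y : u \in Bv v -> z \in Bv v -> y \in Bv v -> e u z -> x u y = x z y.
  exact: (loc_row (hl v)).
have newrow_le z w : w \in S -> newrow z <= x v w + d w z by case: (hmn (fun w => x v w + d w z)) => + _ _; apply.
have newrow_ex z : S != set0 -> exists2 w, w \in S & newrow z = x v w + d w z.
  by case: (hmn (fun w => x v w + d w z)) => _ + _; apply.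
have newrowS z : z \in S -> newrow z = x v z.
  move=> zS; apply/eqP; rewrite eqn_leq; apply/andP; split.
    by have := newrow_le z z zS; rewrite dd_refl addn0.
  have [|w wS ->] := newrow_ex z; first by apply/set0Pn; exists z.
  by apply: lip => //; apply: SB.
have newcolS u : u \in S -> newcol (rep u) = x u v.
  move=> uS; rewrite /newcol; case: pickP => [u1 /andP[u1S /eqP E]|/(_ u)]; last by rewrite uS eqxx.
  by apply: rowS; rewrite ?vB ?SB //; have [-> _] := locS u1 u u1S uS; rewrite E.
have newcol_le r w : w \in S -> newcol r <= H r w + d w v.
  move=> wS; rewrite /newcol; case: pickP => [u1 /andP[u1S /eqP <-]|_].
    by have [_ <-] := locS u1 w u1S wS; apply: lip; rewrite ?vB ?SB.
  by case: (hmn (fun w => H r w + d w v)) => + _ _; apply.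
have newcol_ge u z : rk u < t -> rk z < t -> connect G v z -> H (rep u) z <= newcol (rep u) + d v z.
  move=> ut zt cvz; have [w wS Ew] := sepv z zt cvz; rewrite /newcol.
  have czS w' : w' \in S -> connect G z w'.
    by move=> w'S; apply: (@connect_trans _ _ v); [rewrite cC | apply: Sv_connect w'S].
  case: pickP => [u1 /andP[u1S /eqP E]|_].
    have := h3 u z w ut zt (Srk w wS) (czS w wS); rewrite -E.
    have [_ <-] := locS u1 w u1S wS.
    have := lip u1 v w (SB _ u1S) vB (SB _ wS); rewrite Ew (dC z w); lia.
  have [_ ex _] := hmn (fun w => H (rep u) w + d w v).
  have [|w0 w0S ->] := ex; first by apply/set0Pn; exists w.
  have := h3 u z w0 ut zt (Srk w0 w0S) (czS w0 w0S).
  by have := dd_triangle G z v w0; rewrite (dC z v) (dC v w0); lia.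
exists rep', H'; split.
- move=> u /lto[->|ut]; last by rewrite rep'E // ltnW // ltnS h1.
  rewrite /rep' eqxx /r0; case: pickP => [u0 /andP[u0S _]|_]; last by rewrite rv.
  by rewrite ltnW // ltnS h1 // Srk.
- move=> v' u z hv' hu hz; case: (lto _ hv') => [E|v't]; last first.
    have ut : rk u < t by apply: leq_ltn_trans (Bv_rk hu) v't.
    have zt : rk z < t by apply: leq_ltn_trans (Bv_rk hz) v't.
    by rewrite !rep'E // HE ?repv ?uv //; apply: h2.
  subst v'; rewrite -/x -/e.
  have caseS u0 : u0 \in S -> rep' u0 = rep u0 by move=> /Srk; apply: rep'E.
  have HvS u0 : u0 \in S -> H' (rep u0) v = x u0 v.
    by move=> u0S; rewrite /H' repv ?Srk // eqxx newcolS.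
  have HSS u0 z0 : u0 \in S -> z0 \in S -> H' (rep u0) z0 = x u0 z0.
    by move=> u0S z0S; rewrite HE ?repv ?uv ?Srk //; have [_ ->] := locS u0 z0 u0S z0S.
  have rv' : rep' v = r0 by rewrite /rep' eqxx.
  have evS z0 : z0 \in S -> e v z0 = (r0 == rep z0) /\ x v z0 = H' r0 z0.
    move=> z0S; rewrite /r0; case: pickP => [u0 /andP[u0S evu]|no].
      have [<- _] := locS u0 z0 u0S z0S; rewrite HSS //; split; last by apply: rowS; rewrite ?vB ?SB.
      apply/idP/idP => h.
        by apply: (loc_trans (hl v) _ vB _ _ h); rewrite ?vB ?SB //; apply: (loc_sym (hl v)); rewrite ?vB ?SB.
      by apply: (loc_trans (hl v) vB _ _ evu h); rewrite ?vB ?SB.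
    rewrite eq_sym repv ?Srk //; split; first by have := no z0; rewrite /= z0S.
    by rewrite /H' eqxx uv ?Srk // newrowS.
  case/setU1P: hu => [->|uS]; case/setU1P: hz => [->|zS].
  + have evv : e v v by exact: (loc_refl (hl v) vB).
    rewrite eqxx rv' evv; split=> //.
    rewrite /r0; case: pickP => [u0 /andP[u0S evu]|no]; last by rewrite /H' !eqxx.
    by rewrite HvS //; apply: rowS; rewrite ?vB ?SB.
  + by rewrite rv' caseS //; apply: evS.
  + rewrite rv' caseS // HvS //; split=> //; rewrite [_ == r0]eq_sym; have [<- _] := evS u uS.
    by apply/idP/idP => h; apply: (loc_sym (hl v)) => //; apply: SB.
  + by rewrite !caseS // HSS //; have [] := locS u z uS zS.
move=> u z z' hu hz hz' czz.
have old r (u0 : T) : rk u0 < t -> rep u0 = r -> H' r z <= H' r z' + d z z'.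
  move=> u0t Er; have rnv : (r == v) = false by rewrite -Er repv.
  case: (lto z hz) => [Ez|zt]; case: (lto z' hz') => [Ez'|z't].
  + by rewrite Ez Ez' leq_addr.
  + rewrite Ez in czz *; rewrite (HE r z' rnv (uv _ z't)) /H' rnv eqxx -Er.
    have [w wS Ew] := sepv z' z't czz.
    have cw : connect G w z'.
      by apply: (@connect_trans _ _ v) => //; rewrite cC; apply: Sv_connect wS.
    have := newcol_le (rep u0) w wS; have := h3 u0 w z' u0t (Srk w wS) z't cw.
    by rewrite Ew (dC w v); lia.
  + rewrite Ez' in czz *; rewrite (HE r z rnv (uv _ zt)) /H' rnv eqxx -Er (dC z).
    by apply: newcol_ge => //; rewrite cC.
  + by rewrite (HE r z rnv (uv _ zt)) (HE r z' rnv (uv _ z't)) -Er; apply: h3.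
case: (lto u hu) => [Eu|ut]; last by rewrite rep'E //; apply: (old _ u).
rewrite Eu /rep' eqxx /r0; case: pickP => [u0 /andP[u0S _]|_]; first by apply: (old _ u0); rewrite ?Srk.
rewrite /H' eqxx; case: (lto z hz) => [Ez|zt]; case: (lto z' hz') => [Ez'|z't].
- by rewrite Ez Ez' eqxx leq_addr.
- rewrite Ez eqxx uv //; rewrite Ez in czz; have [w wS _] := sepv z' z't czz.
  have [|w0 w0S ->] := newrow_ex z'; first by apply/set0Pn; exists w.
  have := lip v w0 v vB (SB _ w0S) vB; have := dd_triangle G w0 z' v.
  by rewrite (dC z' v); lia.
- rewrite Ez' eqxx uv //; rewrite Ez' cC in czz; have [w wS Ew] := sepv z zt czz.
  by have := newrow_le z w wS; have := lip v v w vB vB (SB _ wS); rewrite (dC z v) Ew; lia.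
- rewrite !uv //; case: (set_0Vmem S) => [S0|[w wS]].
    by have [_ _ E0] := hmn (fun w => x v w + d w z); rewrite /newrow (E0 S0).
  have [|w0 w0S ->] := newrow_ex z'; first by apply/set0Pn; exists w.
  by have := newrow_le z w0 w0S; have := dd_triangle G w0 z' z; rewrite (dC z' z); lia.
Qed.

Lemma extension_ex t : exists rep H, extends t rep H.
Proof.
elim: t => [|t [rep [H ext]]]; first by exists id, (fun _ _ => 0); split.
have [[v rv]|no] := pselect (exists v, rk v = t); first exact: extension_step rv ext.
have lt u : rk u < t.+1 -> rk u < t.
  rewrite ltnS leq_eqVlt => /orP[/eqP E|//].
  by case: no; exists u.
case: ext => h1 h2 h3; exists rep, H; split.
- by move=> u /lt/h1/ltnW.
- by move=> v u z /lt; apply: h2.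
- by move=> u z z' /lt hu /lt hz /lt hz'; apply: h3.
Qed.

(** The potential of a vertex at itself has the same value in every bag containing it, because all
    bags show values of one global potential. So levels rise by one along an arc wherever it is
    stored. *)
Lemma arcP p u : arc dt p u -> [/\ G p u, px (dt u) u u = (px (dt p) p p).+1 &
  exists2 v, (p \in Bv v) && (u \in Bv v) & pe (dt v) p u].
Proof.
have diag v z : z \in Sv v -> px (dt v) z z = px (dt z) z z.
  move=> zS.
  have [rep [H [_ h2 _]]] := extension_ex (\max_v rk v).+1.
  have lt w : rk w < (\max_v rk v).+1 by rewrite ltnS; apply: leq_bigmax.
  have [_ ->] := h2 v z z (lt v) (setU1r _ zS) (setU1r _ zS).
  by have [_ ->] := h2 z z z (lt z) (setU11 _ _) (setU11 _ _).
case/orP => /eqP E.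
  have [pS Gup epu xu] := loc_P (hl u) E; split; first by rewrite rs.
    by rewrite xu diag.
  by exists u => //; rewrite setU11 setU1r.
have [uS Gpu epu xu] := loc_Q (hl p) E; split=> //; first by rewrite -(diag p u uS).
by exists p => //; rewrite setU11 setU1r.
Qed.

Lemma solution_partition :
  (forall c, cin dt [set: T] c <= 1) -> (forall c, cout dt [set: T] c <= 1) ->
  (forall c, cin dt [set: T] c = 0 -> px (dt c) c c = 0) ->
  isometric_path_partition G #|[set c | cin dt [set: T] c == 0]|.
Proof.
move=> hi ho hs.
have [rep [H [_ h2 h3]]] := extension_ex (\max_v rk v).+1.
have lt w : rk w < (\max_v rk v).+1 by rewrite ltnS; apply: leq_bigmax.
pose l u := px (dt u) u u.
have noarc u : (forall p, ~~ arc dt p u) -> cin dt [set: T] u = 0.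
  move=> no; rewrite cin_card //; apply/eqP; rewrite cards_eq0; apply/eqP/setP => p.
  by rewrite !inE; apply/negbTE/no.
have -> : [set c | cin dt [set: T] c == 0] = starts l.
  apply/setP => u; rewrite !inE; apply/eqP/eqP => [/hs//|lu].
  by apply: noarc => p; apply/negP => /arcP[_ E _]; rewrite /l E in lu.
apply: (@partition_of_arcs _ G (arc dt) l rep H).
- by move=> p u /arcP[].
- move=> p u u' pu pu'; have := ho p; rewrite cout_card // => /card_le1_eqP; apply.
  + by rewrite inE.
  + by rewrite inE.
- by move=> p u /arcP[].
- by move=> u /noarc/hs.
- move=> p u /arcP[_ _ [v /andP[pv uv] e]]; apply/eqP.
  by have [<- _] := h2 v p u (lt v) pv uv.
- by move=> u; have [_ <-] := h2 u u u (lt u) (setU11 _ _) (setU11 _ _).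
- by move=> u z z' czz; apply: h3.
Qed.

End Extension.

End Solutions.

Lemma isometric_prefix (T : finType) (G : sgraph T) (x : T) (s : seq T) i :
  isometric G x s -> i <= size s -> dd G x (nth x (x :: s) i) = i.
Proof.
move=> /isometricP[ps sz] si.
have E : nth x (x :: s) i = last x (take i s).
  case: i si => [|i] si; first by rewrite take0.
  rewrite (last_nth x) size_take; case: ltnP => h; last first.
    have -> : i.+1 = size s by apply/eqP; rewrite eqn_leq si h.
    by rewrite take_size.
  by rewrite /= nth_take.
apply/eqP; rewrite eqn_leq; apply/andP; split.
  rewrite E; have pt : path G x (take i s) by apply: take_path.
  by apply: leq_trans (dd_path pt) _; rewrite size_takel.
have := dd_triangle G x (nth x (x :: s) i) (last x s); rewrite -sz E.
have : path G (last x (take i s)) (drop i s) by move: ps; rewrite -{1}(cat_take_drop i s) cat_path => /andP[].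
move/dd_path; rewrite size_drop -last_cat cat_take_drop; lia.
Qed.

(** The potential of a path is the distance from its first vertex, which equals the position along
    the path; each arc is stored at its end of larger rank. *)
Lemma partition_solution (T : finType) (G : sgraph T) (rk : T -> nat) (b k : nat) :
  injective rk -> isometric_path_partition G k ->
  (forall u z, connect G u z -> dd G u z < b) ->
  exists dt, [/\ forall y, dloc G rk b dt y, forall c p, dagree G rk dt c p,
    (forall c, cin dt [set: T] c <= 1) /\ (forall c, cout dt [set: T] c <= 1),
    forall c, cin dt [set: T] c = 0 -> px (dt c) c c = 0 &
    k = #|[set c | cin dt [set: T] c == 0]|].
Proof.
move=> rk_inj [P [/and3P[/eqP covP trP nP] cP isoP]] hb.
pose bl u := pblock P u.
have blP u : bl u \in P by apply: pblock_mem; rewrite covP.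
have ubl u : u \in bl u by rewrite mem_pblock covP.
have blE u z : (z \in bl u) = (bl u == bl z) by rewrite /bl eq_pblock ?covP.
have hq (u : T) : exists q : T * seq T, isometric G q.1 q.2 /\ bl u = [set y | y \in q.1 :: q.2].
  by have [x [s h]] := isoP _ (blP u); exists (x, s).
have [g hg] := choice hq.
(* A canonical vertex of each block, so that the chosen path depends on the block only. *)
pose cn u := if [pick z in bl u] is Some z then z else u.
have cn_bl u : bl (cn u) = bl u.
  by rewrite /cn; case: pickP => [z|//]; rewrite blE => /eqP.
have cn_eq u z : bl u = bl z -> cn u = cn z.
  by move=> E; rewrite /cn E; case: pickP => // /(_ z); rewrite ubl.
pose so u := (g (cn u)).1; pose sq u := so u :: (g (cn u)).2.
have sqE u z : bl u = bl z -> sq u = sq z by move=> /cn_eq E; rewrite /sq /so E.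
have iso u : isometric G (so u) (g (cn u)).2 by have [] := hg (cn u).
have inseq u z : (z \in sq u) = (bl u == bl z).
  by have [_] := hg (cn u); rewrite cn_bl -blE => ->; rewrite inE.
have usq u : uniq (sq u) by have [/andP[]] := iso u.
pose pos u := index u (sq u).
have posP u : nth (so u) (sq u) (pos u) = u by rewrite nth_index // inseq.
have pos_lt u : pos u < size (sq u) by rewrite index_mem inseq.
have pos_inj u z : bl u = bl z -> pos u = pos z -> u = z.
  move=> E Ep; rewrite -(posP u) -(posP z) Ep (sqE _ _ E); apply: set_nth_default.
  by rewrite pos_lt.
have dpos u : dd G (so u) u = pos u.
  by rewrite -{2}(posP u); apply: isometric_prefix => //; have := pos_lt u.
pose A p u := (bl p == bl u) && (pos u == (pos p).+1).
have A_adj p u : A p u -> G p u.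
  case/andP => /eqP E /eqP Ep; have := iso p => -[/andP[/(pathP (so p)) pp _] _].
  have lt : pos p < size (g (cn p)).2.
    by have := pos_lt u; rewrite -(sqE _ _ E) Ep /= ltnS.
  have := pp _ lt; rewrite -[so p :: _]/(sq p) posP.
  have -> // : nth (so p) (g (cn p)).2 (pos p) = u.
  rewrite -[LHS]/(nth (so p) (sq p) (pos p).+1) -Ep -[RHS]posP (sqE _ _ E).
  by apply: set_nth_default; rewrite pos_lt.
have A_in p p' u : A p u -> A p' u -> p = p'.
  case/andP => /eqP E1 /eqP P1 /andP[/eqP E2 /eqP P2]; apply: pos_inj; first by rewrite E1.
  by move: P2; rewrite P1 => -[].
have A_out p u u' : A p u -> A p u' -> u = u'.
  case/andP => /eqP E1 /eqP P1 /andP[/eqP E2 /eqP P2]; apply: pos_inj; first by rewrite -E1.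
  by rewrite P1 P2.
pose dt u := Data (fun u z => dd G (so u) z) (fun u z => bl u == bl z)
   [pick p | A p u && (p \in Sv G rk u)] [pick w | A u w && (w \in Sv G rk u)].
have arcE p u : arc dt p u = A p u.
  apply/idP/idP.
    rewrite /arc /=; case: pickP => [p' /andP[h _]|_] /=.
      case: eqP => [[<-]//|_] /=; case: pickP => [w /andP[h' _]|//] /eqP[<-] //.
    by case: pickP => [w /andP[h' _]|//] /eqP[<-].
  move=> Apu; have Gpu := A_adj _ _ Apu.
  have := ltngtP (rk p) (rk u); case=> [lt|lt|/rk_inj E]; last by rewrite E adj_irr in Gpu.
    rewrite /arc /=; case: pickP => [p' /andP[/A_in/(_ Apu)-> _]|/(_ p)]; first by rewrite eqxx.
    by rewrite Apu (Sv_edge Gpu lt).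
  rewrite /arc /=; apply/orP; right.
  case: pickP => [w /andP[/A_out/(_ Apu)-> _]|/(_ u)]; first by rewrite eqxx.
  by rewrite Apu (@Sv_edge _ G rk u p) // adj_sym.
have conn u : connect G (so u) u.
  have -> : u = nth (so u) (sq u) (pos u) by rewrite posP.
  rewrite -dd_connect; have := dpos u; rewrite posP => ->.
  apply: leq_trans (pos_lt u) _; rewrite -(card_uniqP (usq u)); exact: max_card.
have hl y : dloc G rk b dt y.
  split=> //=.
  - by move=> u z _ _; rewrite eq_sym.
  - by move=> u z w _ _ _ /eqP-> /eqP->.
  - by move=> u z w _ _ _ /eqP E; rewrite /so (cn_eq _ _ E).
  - by move=> u z w _ _ _; apply: dd_triangle.
  - move=> u z hu hz; apply: hb; apply: connect_trans (conn u) _.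
    exact: (Bv_connect hu hz).
  - move=> p; case: pickP => [p' /andP[h hS]|//] [<-]; split=> //.
    + by rewrite adj_sym A_adj.
    + by case/andP: h.
    + by rewrite !dpos; case/andP: h => _ /eqP.
  - move=> p; case: pickP => [p' /andP[h hS]|//] [<-]; split=> //.
    + by rewrite A_adj.
    + by case/andP: h.
    + by rewrite !dpos; case/andP: h => _ /eqP.
have cin0P c : (cin dt [set: T] c == 0) = (pos c == 0).
  rewrite (cin_card c hl) cards_eq0; apply/eqP/eqP => [E|E].
    case Ep : (pos c) => [//|m]; exfalso.
    pose p := nth (so c) (sq c) m.
    have lt : m < size (sq c) by rewrite ltnW // -Ep pos_lt.
    have ps : p \in sq c by apply: mem_nth.
    have pb : bl p = bl c by move: ps; rewrite inseq => /eqP.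
    have pp : pos p = m by rewrite /pos (sqE _ _ pb) index_uniq.
    have : p \in [set p | arc dt p c] by rewrite inE arcE /A pb eqxx pp Ep /=.
    by rewrite E inE.
  by apply/setP => p; rewrite !inE arcE /A E andbF.
exists dt; split=> //.
- split=> c; [rewrite (cin_card c hl) | rewrite (cout_card c hl)].
    by apply/card_le1_eqP => p p'; rewrite !inE !arcE => h /(A_in _ _ _ h).
  by apply/card_le1_eqP => p p'; rewrite !inE !arcE => h /(A_out _ _ _ h).
- by move=> c /eqP; rewrite cin0P /= dpos => /eqP.
rewrite -cP; have -> : [set c | cin dt [set: T] c == 0] = [set c | pos c == 0].
  by apply/setP => c; rewrite !inE cin0P.
rewrite -(@card_in_imset _ _ bl [set c | pos c == 0]); last first.
  by move=> u z; rewrite !inE => /eqP h1 /eqP h2 E; apply: pos_inj; rewrite ?h1.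
congr #|pred_of_set _|; apply/setP => B; apply/idP/imsetP => [BP|[c _ ->]]; last exact: blP.
have [z zB] : exists z, z \in B by apply/set0Pn; apply: contraNneq nP => <-.
have Bz : B = bl z by apply/esym/def_pblock.
have sb : bl z = bl (so z) by apply/eqP; rewrite -inseq mem_head.
by exists (so z); rewrite -?sb // inE /pos -(sqE _ _ sb) /sq /= eqxx.
Qed.

Theorem Sem_root (T : finType) (G : sgraph T) (rk : T -> nat) (b : nat) (a : astate T) :
  injective rk -> (forall u z, connect G u z -> dd G u z < b) ->
  Sem G rk b None [set: T] a <-> isometric_path_partition G (sk a).
Proof.
move=> rk_inj hb; split.
  move=> [dt [[hl ha hi ho hs] [_ _ _ ->]]].
  have -> : [set c in [set: T] | cin dt (Dq None [set: T]) c == 0] =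
    [set c | cin dt [set: T] c == 0] by apply/setP => c; rewrite !inE.
  apply: (solution_partition rk_inj (b := b)) => //.
  - by move=> y; apply: hl; rewrite inE.
  - by move=> c p cp; apply: ha; rewrite ?inE.
  - exact: adj_sym.
  - by move=> c; apply: hi; rewrite inE.
  - by move=> c; apply: ho; rewrite inE.
  - by move=> c; apply: hs; rewrite inE.
move=> /(partition_solution rk_inj)/(_ hb)[dt [hl ha [hi ho] hs hk]].
exists dt; split; first by split=> *; rewrite ?hi ?ho ?hs //; auto.
split=> //= [u|u|]; rewrite ?inE //.
by rewrite hk; apply: eq_card => c; rewrite !inE.
Qed.

(** * Graphs whose components are cliques *)

Section Cliques.
Variables (T : finType) (G : sgraph T) (Ld : {set T}).
Hypothesis diam1 : forall x y, connect G x y -> dd G x y <= 1.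
Hypothesis Ld_ex : forall u, exists2 v, v \in Ld & connect G v u.
Hypothesis Ld_uniq : forall v v', v \in Ld -> v' \in Ld -> connect G v v' -> v = v'.

Definition cls (v : T) : {set T} := [set u | connect G v u].

Let cC : connect_sym G. Proof. exact/sym_connect_sym/adj_sym. Qed.

Lemma clique_adj a b : connect G a b -> a != b -> G a b.
Proof.
move=> cab ab; have [p [pp lp sp]] := dd_ex cab; have := diam1 cab; rewrite -sp.
case: p pp lp {sp} => [|x [|y p]] //=; first by move=> _ E; rewrite E eqxx in ab.
by rewrite andbT => Gax <-.
Qed.

Lemma Ld_cls v v' u : v \in Ld -> v' \in Ld -> u \in cls v -> u \in cls v' -> v = v'.
Proof.
by rewrite !inE => hv hv' h h'; apply: Ld_uniq => //; apply: connect_trans h _; rewrite cC.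
Qed.

Lemma sum_cls : \sum_(v in Ld) #|cls v| = #|T|.
Proof.
have hex u : exists v, v \in Ld /\ connect G v u by have [v h1 h2] := Ld_ex u; exists v.
have [f hf] := choice hex.
rewrite -cardsT -[RHS]sum1_card [RHS](partition_big f (mem Ld)) /=; last by move=> u _; have [] := hf u.
apply: eq_bigr => v vL; rewrite -sum1_card; apply: eq_bigl => u.
rewrite !inE; apply/idP/eqP => [cvu|<-]; last by have [] := hf u.
by have [h1 h2] := hf u; apply: Ld_uniq => //; rewrite (connect_trans h2) // cC.
Qed.

(** With distances at most 1, a part has at most two vertices and stays inside one component. *)
Lemma clique_lower k : isometric_path_partition G k ->
  \sum_(v in Ld) uphalf #|cls v| <= k /\ k <= #|T|.
Proof.
move=> [P [partP <- isoP]]; have /and3P[/eqP covP trP nP] := partP.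
have A2 A : A \in P -> #|A| <= 2 /\ forall x y, x \in A -> y \in A -> connect G x y.
  move=> /isoP[x [s [/isometricP[ps sz] ->]]]; split.
    apply: leq_trans (_ : size (x :: s) <= _).
      by rewrite cardsE; exact: card_size.
    by rewrite /= sz ltnS diam1 //; apply/connectP; exists s.
  have cx y : y \in [set y | y \in x :: s] -> connect G x y.
    by rewrite inE => ys; apply: (path_connect ps).
  by move=> y z /cx h /cx; apply: connect_trans; rewrite cC.
split; last first.
  by rewrite -cardsT partition_card_le.
have hv v : v \in Ld -> uphalf #|cls v| <= #|[set A in P | A \subset cls v]|.
  move=> vL; rewrite leq_uphalf_double -muln2 -sum_nat_const.
  apply: (@leq_trans (\sum_(A in [set A in P | A \subset cls v]) #|A|)); last first.
    by apply: leq_sum => A; rewrite inE => /andP[/A2[]].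
  apply: leq_trans (leq_card_cover _).1; apply: subset_leq_card; apply/subsetP => u uv.
  have uc : u \in cover P by rewrite covP.
  apply/bigcupP; exists (pblock P u); last by rewrite mem_pblock.
  rewrite inE pblock_mem //=; apply/subsetP => y yB.
  have [_ h] := A2 _ (pblock_mem uc); rewrite inE in uv; rewrite inE.
  by apply: connect_trans uv (h _ _ _ yB); rewrite mem_pblock.
apply: (@leq_trans (\sum_(v in Ld) #|[set A in P | A \subset cls v]|)); first exact: leq_sum.
rewrite (eq_bigr (fun v => \sum_(A in P) (A \subset cls v))) => [|v _]; last first.
  rewrite -sum1_card big_mkcond [RHS]big_mkcond; apply: eq_bigr => A _ /=.
  by rewrite inE; case: (A \in P); case: (A \subset _).
rewrite exchange_big -sum1_card; apply: leq_sum => A AP.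
have [x xA] : exists x, x \in A by apply/set0Pn; apply: contraNneq nP => <-.
have [v vL cvx] := Ld_ex x.
rewrite (bigD1 v) //= big1 ?addn0 ?leq_b1 // => v' /andP[v'L nv].
apply/eqP; rewrite eqb0; apply: contra nv => /subsetP/(_ x xA) xv'.
by apply/eqP; apply: (Ld_cls v'L vL xv'); rewrite inE.
Qed.

(** Each pair taken inside a component saves one part, and a component offers half its size in
    disjoint pairs, rounded down. *)
Lemma clique_pairs j (U : {set T}) : j <= \sum_(v in Ld) (#|cls v :&: U|)./2 ->
  exists P : {set {set T}}, [/\ partition P U, #|P| + j = #|U| &
    forall A, A \in P -> (exists a, A = [set a]) \/ exists a b, G a b /\ A = [set a; b]].
Proof.
elim: j U => [|j IH] U hj.
  exists [set [set u] | u in U]; split.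
  - apply/and3P; split.
    + apply/eqP/setP => u; apply/bigcupP/idP => [[_ /imsetP[w wU ->] /set1P->//]|uU].
      by exists [set u]; [exact: imset_f | rewrite inE].
    + apply/trivIsetP => _ _ /imsetP[u _ ->] /imsetP[w _ ->] ne.
      rewrite -setI_eq0; apply/eqP/setP => z; rewrite !inE; apply/negbTE/negP.
      by move=> /andP[/eqP-> /eqP E]; rewrite E eqxx in ne.
    + by apply/imsetP => -[u _ /setP/(_ u)]; rewrite !inE eqxx.
  - by rewrite addn0; apply: card_imset; exact: set1_inj.
  - by move=> _ /imsetP[u _ ->]; left; exists u.
have [v vL v2] : exists2 v, v \in Ld & 1 < #|cls v :&: U|.
  case: (pselect (exists2 v, v \in Ld & 1 < #|cls v :&: U|)) => // no.
  move: hj; rewrite big1 // => v vL; have : #|cls v :&: U| <= 1.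
    by rewrite leqNgt; apply/negP => h; apply: no; exists v.
  by case: (#|_|) => [|[]].
have [a [b [aK bK ab]]] := card_gt1P v2.
pose U' := U :\: [set a; b].
have abU : [set a; b] \subset U.
  by apply/subsetP => x; rewrite !inE => /orP[]/eqP->; [case/setIP: aK | case/setIP: bK].
have cU : #|U| = #|U'| + 2.
  by rewrite -(cardsID [set a; b] U) (setIidPr abU) cards2 ab addnC.
have [|P [partP cP hP]] := IH U'.
  move: hj; rewrite (bigD1 v) //= [X in _ -> _ <= X](bigD1 v) //=.
  rewrite [X in _ < _ + X -> _](eq_bigr (fun v' => #|cls v' :&: U'|./2)) => [|v' /andP[v'L ne]].
    have -> : #|cls v :&: U| = #|cls v :&: U'| + 2; last by rewrite addn2 /= addSn ltnS.
    rewrite -(cardsID [set a; b] (cls v :&: U)) addnC -setIDA; congr (_ + _).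
    rewrite (setIidPr _) ?cards2 ?ab //.
    by apply/subsetP => x; rewrite in_set2 => /orP[]/eqP->.
  congr (_./2); apply: eq_card => x; rewrite !inE.
  case xv : (connect G v' x) => //=.
  have nx y : y \in cls v :&: U -> x != y.
    move=> /setIP[yv _]; apply: contra_neqN ne => /eqP E.
    by apply: (@Ld_cls _ _ y) => //; rewrite -E inE.
  by rewrite (negbTE (nx a aK)) (negbTE (nx b bK)).
have /and3P[/eqP cov tr n0] := partP.
have disj (B : {set T}) : B \in P -> [disjoint [set a; b] & B].
  move=> BP; rewrite -setI_eq0; apply/eqP/setP => x; rewrite [RHS]inE; apply/negbTE/negP.
  case/setIP => xab xB; have : x \in cover P by apply/bigcupP; exists B.
  by rewrite cov inE xab.
have [tr' nP] := trivIsetU1 disj tr n0.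
exists ([set a; b] |: P); split.
- apply/and3P; split=> //.
    rewrite /cover bigcup_setU big_set1 -/(cover P) cov.
    apply/eqP/setP => x; rewrite in_setU in_setD.
    by case: (boolP (x \in [set a; b])) => [/(subsetP abU)->|].
  rewrite in_setU1 negb_or n0 andbT; apply/eqP => /setP/(_ a).
  by rewrite !inE eqxx.
- by rewrite cardsU1 nP cU -cP; lia.
- move=> A /setU1P[->|/hP//]; right; exists a, b; split=> //.
  apply: clique_adj => //; move: aK bK; rewrite !inE => /andP[h _] /andP[h' _].
  by apply: connect_trans h'; rewrite cC.
Qed.

(** Choosing exactly [#|T| - k] pairs realises every [k] between the two bounds. *)
Lemma clique_partition k : isometric_path_partition G k <->
  \sum_(v in Ld) uphalf #|cls v| <= k <= #|T|.
Proof.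
split=> [/clique_lower[-> ->]//|/andP[h1 h2]].
have hsum : \sum_(v in Ld) uphalf #|cls v| + \sum_(v in Ld) (#|cls v :&: [set: T]|)./2 = #|T|.
  rewrite -sum_cls -big_split; apply: eq_bigr => v _ /=; rewrite setIT.
  by rewrite uphalf_half -addnA addnn odd_double_half.
have [|P [partP cP hP]] := @clique_pairs (#|T| - k) [set: T]; first lia.
exists P; split=> //; first by rewrite cardsT in cP; lia.
move=> A /hP[[a ->]|[a [b [Gab ->]]]].
  exists a, [::]; split; last by apply/setP => y; rewrite !inE.
  by apply/isometricP; split=> //=; rewrite dd_refl.
exists a, [:: b]; split; last by apply/setP => y; rewrite !inE.
apply/isometricP; rewrite /= Gab; split=> //; apply/eqP; rewrite eqn_leq dd_edge // andbT.
rewrite lt0n; apply: contraTneq Gab => /dd_eq0->; by rewrite adj_irr.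
Qed.

End Cliques.

(** * Treewidth *)

Section Treewidth.
Variables (T : finType) (G : sgraph T).

Lemma treewidth_td : exists (U : finType) (F : sgraph U) (bag : U -> {set T}),
  tree_decomposition G F bag /\ forall u, #|bag u| <= (treewidth G).+1.
Proof.
rewrite /treewidth; case: ex_minnP => w /asboolP[U [F [bag [td <-]]]] _.
exists U, F, bag; split=> // u; apply: leq_trans (leqSpred _).
exact: (leq_bigmax (F := fun u => #|bag u|)).
Qed.

Lemma treewidth_edge x y : G x y -> 0 < treewidth G.
Proof.
move=> Gxy; have [U [F [bag [td hb]]]] := treewidth_td.
have [u /andP[xu yu]] := td_edge td Gxy.
rewrite -ltnS; apply: leq_trans (hb u).
have <- : #|[set x; y]| = 2.
  by rewrite cards2; case: eqP => // E; move: Gxy; rewrite E adj_irr.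
by apply: subset_leq_card; apply/subsetP => z; rewrite !inE => /orP[]/eqP->.
Qed.

(** A star: the centre [None] has an empty bag and every vertex has a leaf of its own. *)
Lemma treewidth_edgeless : (forall x y, ~~ G x y) -> treewidth G = 0.
Proof.
move=> no; rewrite /treewidth; case: ex_minnP => w _ /(_ 0) h.
apply/eqP; rewrite -leqn0; apply: h; apply/asboolP.
pose F (a b : option T) := isSome a (+) isSome b.
have Fs : symmetric F by move=> a b; rewrite /F addbC.
have Fi : irreflexive F by move=> a; rewrite /F addbb.
exists (option T), (SGraph Fs Fi), (fun a => if a is Some v then [set v] else set0); split.
- split=> /=.
  + split; first by apply/card_gt0P; exists None.
      have toN (a : option T) : connect F a None.
        by case: a => [v|]; [apply: connect1 | exact: connect0].
      move=> a b; apply: connect_trans (toN a) _.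
      by rewrite sym_connect_sym.
    move=> [|x [|y [|z c]]] //= _; rewrite /ucycle /= rcons_path /F.
    case: c => [|t c] /=.
      by case: x => [x|]; case: y => [y|]; case: z => [z|].
    rewrite !inE !negb_or.
    case: x => [x|]; case: y => [y|]; case: z => [z|]; case: t => [t|] //=;
      by rewrite ?eqxx ?andbF.
  + by move=> v; exists (Some v); rewrite inE.
  + by move=> v w' /= vw; have := no v w'; rewrite /= vw.
  + move=> v [a|] [a'|]; rewrite ?inE // => /eqP-> /eqP->; exact: connect0.
- rewrite /width; set m := \max_u _; suff : m <= 1 by case: m => [|[]].
  by apply/bigmax_leqP => -[v|] _; rewrite ?cards1 ?cards0.
Qed.

End Treewidth.

(** * Correctness of the program *)

(** The list [m] contains the arrays that [F] may change. *)
Definition frame (m : seq nat) (F : ctx -> ctx) := forall c,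
  [/\ cn (F c) = cn c, ck (F c) = ck c, cG (F c) = cG c, cZ (F c) = cZ c &
      forall b, b \notin m -> cA (F c) b = cA c b].

Lemma frame_fill a f : frame [:: a] (fillc a f).
Proof. by move=> c; split=> // b; rewrite inE /= => /negbTE->. Qed.

Lemma frame_seq m1 m2 F1 F2 : frame m1 F1 -> frame m2 F2 -> frame (m1 ++ m2) (F1 ;; F2).
Proof.
move=> h1 h2 c; have [a1 a2 a3 a4 a5] := h1 c; have [b1 b2 b3 b4 b5] := h2 (F1 c).
rewrite /seqc b1 b2 b3 b4; split=> // b; rewrite mem_cat negb_or => /andP[n1 n2].
by rewrite b5 ?a5.
Qed.

Lemma frame_loop m mm F : (forall i, frame m (F i)) -> frame m (loopc mm F).
Proof.
move=> h c; rewrite /loopc; elim: (mm c) => [|k [<- <- <- <- IH]] //=.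
have [b1 b2 b3 b4 b5] := h k (iteri k F c); split=> // b hb; by rewrite b5 // IH.
Qed.

Lemma frame_sub m m' F : {subset m <= m'} -> frame m F -> frame m' F.
Proof.
move=> s h c; have [b1 b2 b3 b4 b5] := h c; split=> // b hb; apply: b5.
by apply: contra hb; apply: s.
Qed.

Lemma loop_ind (P : nat -> ctx -> Prop) (mm : ctx -> nat) (F : nat -> ctx -> ctx) c :
  P 0 c -> (forall i c', i < mm c -> P i c' -> P i.+1 (F i c')) -> P (mm c) (loopc mm F c).
Proof.
move=> P0 PS; rewrite /loopc; have : mm c <= mm c by [].
by elim: {1 3 4}(mm c) => //= k IH kn; apply: PS => //; apply: IH; apply: ltnW.
Qed.

Lemma fillE a f c i j : i < cZ c -> j < cZ c -> cA (fillc a f c) a i j = f c i j.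
Proof. by move=> hi hj; rewrite /= eqxx hi hj. Qed.

Lemma SmE m f : Sm m f = \sum_(i < m) f i. Proof. by []. Qed.
Lemma ExP m (P : nat -> bool) : reflect (exists i : 'I_m, P i) (Ex m P). Proof. exact: existsP. Qed.
Lemma AlP m (P : nat -> bool) : reflect (forall i : 'I_m, P i) (Al m P). Proof. exact: forallP. Qed.

Lemma mulzE c x y : x <= cZ c -> mulz c x y = x * y.
Proof.
move=> h; rewrite /mulz SmE (eq_bigr (fun i : 'I__ => if i < x then y else 0)) //.
by rewrite -big_mkcond -(big_ord_widen _ (fun _ => y) h) sum_nat_const card_ord.
Qed.

Lemma firstE m (P : nat -> bool) : first m P = find P (iota 0 m).
Proof. exact: sum_find. Qed.

Lemma first_ord m (P : nat -> bool) (i : 'I_m) : P i ->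
  exists j : 'I_m, first m P = j /\ P j.
Proof.
move=> Pi; rewrite firstE.
have hf : has P (iota 0 m) by apply/hasP; exists (val i); rewrite // mem_iota /= add0n.
have lt : find P (iota 0 m) < m by rewrite -[X in _ < X](size_iota 0 m) -has_find.
exists (Ordinal lt); split=> //=.
by have := nth_find 0 hf; rewrite nth_iota // -[X in _ < X](size_iota 0 m) -has_find.
Qed.

(** * Distances and digits *)

Section Apsp.
Variables (m : ctx -> nat).
Hypothesis m_cn : forall c c', cn c' = cn c -> m c' = m c.

Lemma frame_apsp : frame [:: 2; 3] (apsp m).
Proof.
apply: (@frame_sub ([:: 2] ++ [:: 3] ++ [:: 3; 2])).
  by move=> x; rewrite !inE; case: (x == 2); case: (x == 3).
apply: frame_seq; first exact: frame_fill.
apply: frame_seq; first exact: frame_fill.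
by apply: frame_loop => i; apply: (@frame_seq [:: 3] [:: 2]); exact: frame_fill.
Qed.

(** After t rounds array 2 holds the balls of radius t, and array 3 the number of smaller radii that
    fail, which is [dd] truncated at t. *)
Lemma apsp_ok c M (r : rel 'I_M) : m c = M -> M <= cZ c ->
  (forall x y : 'I_M, (cA c 1 x y != 0) = r x y) ->
  forall x y : 'I_M, cA (apsp m c) 3 x y = dd r x y.
Proof.
move=> mc MZ hr.
pose P t c' := [/\ cn c' = cn c, cZ c' = cZ c, cA c' 1 = cA c 1 &
  forall x y : 'I_M, (cA c' 2 x y != 0) = ball r t x y /\
    cA c' 3 x y = \sum_(s < t) ~~ ball r s x y].
set c0 := fillc 3 (fun c i j => 0) (fillc 2 (fun c i j => i == j) c).
have lt (x : 'I_M) : x < cZ c by apply: leq_trans MZ.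
have : P M (apsp m c).
  have E : m c0 = M by rewrite -mc; apply: m_cn.
  rewrite /apsp /seqc -/c0 -{1}E; apply: (@loop_ind P).
    split=> // x y; rewrite big_ord0 /c0 /= !lt /=; split=> //.
    by rewrite eqb0 negbK.
  move=> t c' _ [h1 h2 h3 h4].
  set c1 := fillc 3 _ c'.
  split=> // x y; have [e1 e2] := h4 x y.
  have mc1 : m c1 = M by rewrite -mc; apply: m_cn.
  rewrite /seqc; split.
    rewrite fillE ?[cZ _]h2 ?lt // eqb0 negbK -[cA c1 2 _ _]/(cA c' 2 x y) e1 mc1; congr (_ || _).
    apply/existsP/existsP => -[z hz]; exists z; move: hz; have [e3 _] := h4 x z;
      by rewrite -[cA c1 2 _ _]/(cA c' 2 x z) -[cA c1 1]/(cA c' 1) e3 h3 hr.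
  rewrite -[cA _ 3 _ _]/(cA c1 3 x y) /c1 fillE ?h2 ?lt // e2 big_ord_recr /=.
  by congr (_ + _); rewrite -e1; case: (cA c' 2 x y == 0).
move=> [_ _ _ h] x y; have [_ ->] := h x y.
by rewrite /dd card_ord.
Qed.

End Apsp.

Lemma frame_apsp_graph : frame [:: 1; 2; 3; 4] apsp_graph.
Proof.
apply: (@frame_sub ([:: 1] ++ [:: 2; 3] ++ [:: 4])); first by [].
by apply: frame_seq; [exact: frame_fill | apply: frame_seq; [exact: frame_apsp | exact: frame_fill]].
Qed.

Section Graph.
Variables (n : nat) (G : sgraph 'I_n).

Lemma apsp_graph_ok c : cn c = n -> cG c = adjn G -> n <= cZ c ->
  forall x y : 'I_n, cA (apsp_graph c) 4 x y = dd G x y.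
Proof.
move=> cnn cGG nZ x y; rewrite /apsp_graph /seqc.
set c1 := fillc 1 _ c; have [f1 _ _ f4 _] := frame_apsp cn c1.
have lt (z : 'I_n) : z < cZ c by apply: leq_trans nZ.
rewrite fillE ?f4 ?lt //; apply: apsp_ok => //.
by move=> x' y'; rewrite /c1 fillE ?lt // eqb0 negbK cGG adjnE.
Qed.

Definition distok c := forall x y : 'I_n, cA c 4 x y = dd G x y.

Lemma dm_spec c i : cn c = n -> distok c -> (i < dm c) =
  (i < n) && [exists x : 'I_n, exists y : 'I_n, connect G x y && (i < dd G x y)].
Proof.
move=> cnn hd; rewrite /dm SmE cnn.
rewrite (eq_bigr (fun t : 'I_n => ([exists x : 'I_n, exists y : 'I_n, connect G x y && (t < dd G x y)] : nat))).
  apply: (sum_threshold _ (Q := fun t => [exists x : 'I_n, exists y : 'I_n, connect G x y && (t < dd G x y)])).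
  move=> t t' tt /existsP[x /existsP[y /andP[h1 h2]]]; apply/existsP; exists x; apply/existsP.
  by exists y; rewrite h1 (leq_ltn_trans tt).
move=> t _; congr nat_of_bool; apply: eq_existsb => x; apply: eq_existsb => y.
by rewrite hd -dd_connect card_ord.
Qed.

Lemma dm_max c : cn c = n -> distok c -> forall x y, connect G x y -> dd G x y <= dm c.
Proof.
move=> cnn hd x y cxy; rewrite leqNgt; apply/negP => lt.
have := dm_spec (dm c) cnn hd; rewrite ltnn => /esym/negP; apply; apply/andP; split.
  by apply: leq_trans lt _; rewrite -[X in _ <= X]card_ord dd_leT.
by apply/existsP; exists x; apply/existsP; exists y; rewrite cxy.
Qed.

Lemma dm_diam c : cn c = n -> distok c -> dm c <= diam G.
Proof.
move=> cnn hd; case E : (dm c) => [//|i].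
have := dm_spec i cnn hd; rewrite E ltnSn => /esym/andP[_ /existsP[x /existsP[y /andP[cxy lt]]]].
exact: leq_trans lt (dd_le_diam cxy).
Qed.

End Graph.

Lemma bb_gt1 c : 1 < bb c. Proof. by rewrite /bb addn2. Qed.

Lemma divbE c x : x <= cZ c -> divb c x = x %/ bb c.
Proof.
move=> h; rewrite /divb; apply/eqP; rewrite eqn_leq.
have b0 : 0 < bb c by have := bb_gt1 c; lia.
have T i : (i < Sm (cZ c) (fun i => bb c * i.+1 <= x)) = (i < cZ c) && (i < x %/ bb c).
  rewrite SmE (@sum_threshold (cZ c) (fun i => bb c * i.+1 <= x) i); last first.
    by move=> i1 i2 h12; apply: leq_trans; rewrite leq_mul2l ltnS h12 orbT.
  by congr (_ && _); rewrite [in RHS]leq_divRL // mulnC.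
apply/andP; split; rewrite leqNgt.
  by rewrite T ltnn andbF.
apply/negP => lt; have := T (Sm (cZ c) (fun i => bb c * i.+1 <= x)); rewrite ltnn lt andbT.
by rewrite (leq_trans lt) // (leq_trans (leq_div _ _)).
Qed.

Lemma frame_digits : frame [:: 5] digits.
Proof.
apply: (@frame_sub ([:: 5] ++ [:: 5])); first by move=> x; rewrite !inE orbb.
by apply: frame_seq; [exact: frame_fill | apply: frame_loop => i; exact: frame_fill].
Qed.

Lemma dm_ext c c' : cn c' = cn c -> cA c' 4 = cA c 4 -> dm c' = dm c.
Proof. by rewrite /dm => -> ->. Qed.

Definition digitsok c := forall j x, j < cZ c -> x < cZ c -> cA c 5 j x = x %/ bb c ^ j.

(** Row j is one division away from row j-1, so each round makes one more row correct. *)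
Lemma digits_ok c : digitsok (digits c).
Proof.
move=> j x; have [f1 _ _ f4 f5] := frame_digits c; rewrite f4 => hj hx.
have -> : bb (digits c) = bb c by rewrite /bb (dm_ext f1) // f5.
rewrite /digits /seqc; set c0 := fillc 5 _ c.
pose P t c' := [/\ cn c' = cn c, cZ c' = cZ c, cA c' 4 = cA c 4 &
  forall j x, j < t -> j < cZ c -> x < cZ c -> cA c' 5 j x = x %/ bb c ^ j].
have : P (cZ c0) (loopc cZ (fun _ => fillc 5 (fun c j x => ite (j == 0) x (divb c (cA c 5 (j - 1) x)))) c0).
  apply: (@loop_ind P) => // t c' _ [h1 h2 h3 h4]; split=> // i y it iZ yZ.
  rewrite fillE ?h2 // /ite; case: i it iZ => [|i] it iZ /=; first by rewrite expn0 divn1.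
  rewrite subn1 /= h4 //; last exact: ltnW.
  have E : bb c' = bb c by rewrite /bb (dm_ext h1).
  by rewrite divbE ?E ?h2 ?(leq_trans (leq_div _ _)) ?(ltnW yZ) // -divnMA expnSr.
by case=> _ _ _; apply.
Qed.

Lemma dgE c x j : digitsok c -> j.+1 < cZ c -> x < cZ c -> dg c x j = (x %/ bb c ^ j) %% bb c.
Proof.
move=> hd hj hx; rewrite /dg !hd ?(ltnW hj) // expnSr divnMA.
by rewrite {1}(divn_eq (x %/ bb c ^ j) (bb c)) [_ * bb c]mulnC addKn.
Qed.

(** The leading part [k] is not limited by the base; in the codes it carries the number of paths. *)
Lemma digit_code b m (f : nat -> nat) k : 0 < b -> (forall j, j < m -> f j < b) ->
  exists x, [/\ x < k.+1 * b ^ m, x %/ b ^ m = k & forall j, j < m -> (x %/ b ^ j) %% b = f j].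
Proof.
move=> b0; elim: m f => [|m IH] f hf.
  by exists k; rewrite expn0 muln1 divn1; split.
have [|x [h1 h2 h3]] := IH (fun j => f j.+1); first by move=> j hj; apply: hf.
have f0 := hf 0 isT.
exists (x * b + f 0); split.
- by rewrite expnSr mulnA; nia.
- by rewrite expnS divnMA divnMDl // (divn_small f0) addn0.
- case=> [_|j hj]; first by rewrite expn0 divn1 modnMDl modn_small.
  by rewrite expnS divnMA divnMDl // (divn_small f0) addn0 h3.
Qed.

(** * Flows and minimum cuts *)

Lemma nnode_cn c c' : cn c' = cn c -> nnode c' = nnode c.
Proof. by rewrite /nnode => ->. Qed.

Lemma frame_apspnode : frame [:: 2; 3] (apsp nnode).
Proof. by apply: frame_apsp. Qed.

Lemma frame_augment : frame [:: 1; 2; 3; 10; 11] augment.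
Proof.
apply: (@frame_sub ([:: 1] ++ [:: 2; 3] ++ [:: 11] ++ [:: 11] ++ [:: 10])).
  by apply/allP.
do 2 (apply: frame_seq; [by [exact: frame_fill | exact: frame_apspnode] |]).
apply: frame_seq; first exact: frame_fill.
by apply: frame_seq; [apply: frame_loop => i; exact: frame_fill | exact: frame_fill].
Qed.

Lemma frame_mincut : frame [:: 1; 2; 3; 10; 11; 12] mincut.
Proof.
apply: (@frame_sub ([:: 10] ++ [:: 1; 2; 3; 10; 11] ++ [:: 1] ++ [:: 2; 3] ++ [:: 12])).
  by apply/allP.
apply: frame_seq; first exact: frame_fill.
apply: frame_seq; first by apply: frame_loop => i; exact: frame_augment.
apply: frame_seq; first exact: frame_fill.
by apply: frame_seq; [exact: frame_apspnode | exact: frame_fill].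
Qed.

Section MinCut.
Variables (n : nat) (G : sgraph 'I_n).
Local Notation M := (n + n + 2).
Local Notation N := 'I_M.

Lemma inn_proof (u : 'I_n) : u < M. Proof. by have := ltn_ord u; lia. Qed.
Lemma outn_proof (u : 'I_n) : n + u < M. Proof. by have := ltn_ord u; lia. Qed.
Lemma src_proof : n + n < M. Proof. by lia. Qed.
Lemma snk_proof : (n + n).+1 < M. Proof. by lia. Qed.
Definition inn u : N := Ordinal (inn_proof u).
Definition outn u : N := Ordinal (outn_proof u).
Definition sN : N := Ordinal src_proof.
Definition tN : N := Ordinal snk_proof.

Record cutctx (c : ctx) : Prop := CutCtx {
  cc_n : cn c = n; cc_G : cG c = adjn G; cc_Z : M < cZ c }.

Definition setA c : {set 'I_n} := [set u : 'I_n | inA c u].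
Definition setB c : {set 'I_n} := [set u : 'I_n | inB c u].
Definition capr c : rel N := fun x y => cap c x y.
Definition flw c : rel N := fun x y => cA c 10 x y != 0.

Lemma disAB c : [disjoint setA c & setB c].
Proof.
rewrite -setI_eq0; apply/eqP/setP => u; rewrite !inE /inA /inB.
by case: (cA c 9 u 0 == 0); rewrite ?andbF.
Qed.

Lemma capP c : cutctx c -> forall x y : N, capr c x y <-> [\/ exists2 u, x = inn u & y = outn u,
  exists u v, [/\ x = outn u, y = inn v & G u v],
  exists u, [/\ u \in setA c, x = sN & y = inn u] |
  exists u, [/\ u \in setB c, x = outn u & y = tN]].
Proof.
case=> hn hG _ x y; rewrite /capr /= /cap hn hG; split.
  case/or4P.
  - case/andP => xn /eqP E; constructor 1; exists (Ordinal xn); apply: val_inj => //=.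
  - case/and4P => nx xn yn gxy; constructor 2.
    have h : x - n < n by lia.
    exists (Ordinal h), (Ordinal yn); split; [apply: val_inj => /=; lia | exact: val_inj |].
    by rewrite -adjnE.
  - case/and3P => /eqP E yn ya; constructor 3; exists (Ordinal yn).
    by split; [rewrite inE | exact: val_inj | exact: val_inj].
  - case/and4P => nx xn /eqP E yb; constructor 4.
    have h : x - n < n by lia.
    by exists (Ordinal h); split; [rewrite inE | apply: val_inj => /=; lia | exact: val_inj].
case=> [[u -> ->]|[u [v [-> -> guv]]]|[u [ua -> ->]]|[u [ub -> ->]]] /=; apply/or4P.
- by constructor 1; rewrite ltn_ord eqxx.
- constructor 2; have := ltn_ord u; have := ltn_ord v.
  by rewrite addKn adjnE guv leq_addr ltn_add2l => -> ->.
- by constructor 3; rewrite eqxx ltn_ord; move: ua; rewrite inE.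
- constructor 4; rewrite addKn leq_addr ltn_add2l ltn_ord eqxx.
  by move: ub; rewrite inE.
Qed.

Lemma capr_ext c c' : cn c' = cn c -> cG c' = cG c -> cA c' 8 = cA c 8 -> cA c' 9 = cA c 9 ->
  capr c' = capr c /\ setA c' = setA c /\ setB c' = setB c.
Proof. by rewrite /capr /setA /setB /cap /inA /inB => -> -> -> ->. Qed.

Lemma resid_ok c : cutctx c -> forall x y : N,
  cA (apsp nnode (fillc 1 (fun c x y => resid c x y) c)) 3 x y = dd (residual (capr c) (flw c)) x y.
Proof.
move=> cc x y; have nZ (z : N) : z < cZ c by apply: ltn_trans (cc_Z cc).
apply: (apsp_ok nnode_cn); first by rewrite /nnode [cn _](cc_n cc).
  by apply: ltnW; exact: (cc_Z cc).
by move=> x' y'; rewrite fillE ?nZ // eqb0 negbK /resid /residual /= negbK.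
Qed.

Section Augment.
Variables (c : ctx) (k : nat).
Hypothesis cc : cutctx c.
Hypothesis fl : isflow (capr c) sN tN (flw c) k.
Local Notation rd := (residual (capr c) (flw c)).

Let c1 := fillc 1 (fun c x y => resid c x y) c.
Let c2 := apsp nnode c1.
Let c3 := fillc 11 (fun c i j => src c) c2.
Let stp i := fillc 11 (fun c k j => ite (k == i.+1) (nxt c (cA c 11 i 0)) (cA c 11 k j)).
Let c4 := loopc nnode stp c3.

Let nZ (x : N) : x < cZ c. Proof. by apply: ltn_trans (cc_Z cc). Qed.
Let Z0 : 0 < cZ c. Proof. by have := cc_Z cc; lia. Qed.

Let rel1 (x y : N) : (cA c1 1 x y != 0) = rd x y.
Proof.
rewrite /c1 fillE ?nZ // eqb0 negbK /resid /residual /=.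
by rewrite negbK.
Qed.

Let dst2 (x y : N) : cA c2 3 x y = dd rd x y.
Proof. exact: resid_ok. Qed.

Let f2 := frame_apspnode c1.

Let nxt_ok c' (x : N) m : cn c' = n -> cA c' 1 = cA c1 1 -> cA c' 3 = cA c2 3 ->
  m.+1 < M -> dd rd x tN = m.+1 -> exists y : N, [/\ nxt c' x = y, rd x y & dd rd y tN = m].
Proof.
move=> hn h1 h3 mM dx.
have cx : connect rd x tN.
  by rewrite -dd_connect card_ord dx.
have [p [pp lp sp]] := dd_ex cx; rewrite dx in sp.
case: p pp lp sp => [//|z p] /= /andP[rxz pz] lp [sp].
pose Q := fun y : nat => (cA c' 1 x y != 0) && (cA c' 3 y (snk c') < cA c' 3 x (snk c')).
have sE : snk c' = tN by rewrite /snk hn.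
have QE (y : N) : Q y = rd x y && (dd rd y tN < m.+1) by rewrite /Q h1 h3 rel1 sE !dst2 dx.
have Qz : Q z by rewrite QE rxz ltnS -sp -lp dd_path.
have [y [Ey Qy]] := first_ord Qz; exists y; rewrite QE in Qy; have /andP[rxy dy] := Qy.
split=> //; first by rewrite /nxt /nnode hn -Ey.
apply/eqP; rewrite eqn_leq -ltnS dy /= -ltnS -dx.
by apply: leq_trans (dd_triangle rd x y tN) _; have := dd_edge rxy; lia.
Qed.

Let n1 : nnode c3 = M. Proof. by case: f2 => h *; rewrite /nnode [cn _]h [cn _](cc_n cc). Qed.

Let f4 : frame [:: 11] (loopc nnode stp).
Proof. by apply: frame_loop => i; exact: frame_fill. Qed.

Let keep4 : [/\ cn c4 = n, cZ c4 = cZ c & forall b, b \notin [:: 1; 2; 3; 11] -> cA c4 b = cA c b].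
Proof.
have [g1 _ _ g4 g5] := f4 c3; have [h1 _ _ h4 h5] := f2; split.
- by rewrite /c4 g1 [cn _]h1 [cn _](cc_n cc).
- by rewrite /c4 g4 [cZ _]h4.
- move=> b; rewrite !inE !negb_or => /and4P[b1 b2 b3 b11].
  have e3 : cA c3 b = cA c2 b by rewrite /c3 /= (negbTE b11).
  have e2 : cA c2 b = cA c1 b by apply: h5; rewrite !inE negb_or b2.
  have e1 : cA c1 b = cA c b by rewrite /c1 /= (negbTE b1).
  by rewrite /c4 g5 ?inE // e3 e2 e1.
Qed.

Let keep41 : cA c4 1 = cA c1 1 /\ cA c4 3 = cA c2 3.
Proof.
have [g1 _ _ g4 g5] := f4 c3; have [h1 _ _ h4 h5] := f2.
have e2 : cA c2 1 = cA c1 1 by apply: h5.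
by rewrite /c4 !g5.
Qed.

Let augE (x y : N) : cA (augment c) 10 x y = ite (cA c2 3 sN tN < M)
    (ite (onp c4 x y && (cA c 10 y x == 0)) 1
      (ite (onp c4 y x && (cA c 10 x y != 0)) 0 (cA c 10 x y)))
    (cA c 10 x y).
Proof.
have [h1 h2 h3] := keep4; have [k1 k3] := keep41.
rewrite /augment /seqc -/c1 -/c2 -/c3 -/stp -/c4 fillE ?h2 ?nZ //.
by rewrite /nnode /src /snk h1 k3 !h3.
Qed.

Lemma augment_noaug : ~~ connect rd sN tN -> flw (augment c) = flw c.
Proof.
rewrite -dd_connect card_ord -leqNgt => no.
apply/funext => x; apply/funext => y; rewrite /flw augE dst2.
by rewrite ltnNge no.
Qed.

Lemma augment_aug : connect rd sN tN -> isflow (capr c) sN tN (flw (augment c)) k.+1.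
Proof.
rewrite -dd_connect card_ord => yes; set L := dd rd sN tN in yes.
have [h1 h2 h3] := keep4; have [k1 k3] := keep41.
have [q [q0 qd qr qPQ]] : exists q : nat -> N, [/\ q 0 = sN,
   forall i, i <= L -> dd rd (q i) tN = L - i, forall i, i < L -> rd (q i) (q i.+1) &
   forall i, i <= L -> cA c4 11 i 0 = q i].
  (* The default [sN] only makes the sequence total: up to the sink the next node is in range by
     [nx]. *)
  pose q' := fix q i := if i is j.+1 then odflt sN (insub (nxt c2 (q j))) else sN.
  have nx i : i < L -> dd rd (q' i) tN = L - i -> [/\ nxt c2 (q' i) = q' i.+1,
      rd (q' i) (q' i.+1) & dd rd (q' i.+1) tN = L - i.+1].
    move=> iL di; have [|||||y [E1 E2 E3]] := @nxt_ok c2 (q' i) (L - i.+1) => //.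
    - by case: f2 => h *; rewrite [cn _]h [cn _](cc_n cc).
    - by case: f2 => _ _ _ _ h; apply: h.
    - by move: yes iL; clear; lia.
    - by rewrite di; move: iL; clear; lia.
    have -> : q' i.+1 = y by rewrite /= E1 valK.
    by [].
  have qd i : i <= L -> dd rd (q' i) tN = L - i.
    elim: i => [_|i IH iL]; first by rewrite subn0.
    by have [] := nx i iL (IH (ltnW iL)).
  have qs i : i < L -> nxt c2 (q' i) = q' i.+1 /\ rd (q' i) (q' i.+1).
    by move=> iL; have [] := nx i iL (qd i (ltnW iL)).
  exists q'; split=> //.
  - by move=> i /qs[].
  pose P t c' := [/\ cn c' = n, cZ c' = cZ c, cA c' 1 = cA c1 1 /\ cA c' 3 = cA c2 3 &
     forall i, i <= t -> i <= L -> cA c' 11 i 0 = q' i].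
  have LM : L < M by [].
  have : P M c4.
    rewrite /c4 -{1}n1; apply: (@loop_ind P).
      split.
      - by case: f2 => h *; rewrite /c3 [cn _]h [cn _](cc_n cc).
      - by case: f2 => _ _ _ h _; rewrite /c3 [cZ _]h.
      - by split=> //; case: f2 => _ _ _ _ h; rewrite -[LHS]/(cA c2 1) h.
      - move=> i; rewrite leqn0 => /eqP-> _; case: f2 => g1 _ _ g4 _.
        by rewrite /c3 fillE ?[cZ _]g4 // /src [cn _]g1 [cn _](cc_n cc).
    move=> t c' tn [g1 g2 [g3 g4] g5]; rewrite n1 in tn; split=> // i it iL.
    have iZ : i < cZ c' by rewrite g2; apply: leq_ltn_trans iL (ltn_trans LM (cc_Z cc)).
    rewrite /stp fillE ?g2 // -?g2 // /ite; case: eqP => [E|ne]; last by apply: g5 => //; lia.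
    subst i; have tL : t < L by [].
    rewrite g5 //; last exact: ltnW.
    have [<- _] := qs t tL.
    by rewrite /nxt /nnode g1 g3 g4 /snk g1; case: f2 => u1 _ _ _ u5; rewrite [cA c2 1]u5 // [cn c2]u1 [cn c1](cc_n cc).
  by case=> _ _ _ h i iL; apply: h => //; apply: leq_trans iL (ltnW LM).
have qL : q L = tN by apply: (@dd_eq0 _ rd); rewrite qd // subnn.
have qinj i j : i <= L -> j <= L -> q i = q j -> i = j.
  by move=> iL jL E; have := qd i iL; rewrite E qd //; lia.
have -> : flw (augment c) = augmented (flw c) q L; last first.
  have stN : sN != tN by apply/eqP => /(congr1 val) /=; lia.
  exact: (isflow_augmented (s := sN) (t := tN) stN fl q0 qL qinj qr).
apply/funext => x; apply/funext => y; rewrite {1}/flw augE dst2 -/L yes /=.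
have onE (x' y' : N) : onp c4 x' y' = onpath q L x' y'.
  rewrite /onp /nnode /src /snk h1 k3 -[cA c2 3 _ _]/(cA c2 3 sN tN) dst2 -/L.
  apply/existsP/existsP => [[i /and3P[iL /eqP e1 /eqP e2]]|[i /andP[/eqP e1 /eqP e2]]].
    exists (Ordinal iL) => /=; apply/andP; split; apply/eqP/val_inj.
      by apply: etrans e1; rewrite qPQ // ltnW.
    by apply: etrans e2; rewrite qPQ.
  exists (widen_ord (ltnW yes) i) => /=; rewrite ltn_ord /= !qPQ //; last exact: ltnW.
  by rewrite e1 e2 !eqxx.
rewrite !onE /ite /augmented /flw /=.
by case: ifP => [/andP[-> ->]|] //; case: (onpath q L x y) => //=; case: (cA c 10 y x == 0) => //=;
  case: (onpath q L y x) => //=; case: (cA c 10 x y =P 0) => //= ->.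
Qed.

End Augment.

(** After t rounds the flow has value at least t or admits no augmenting path. The set of all
    vertices is a separator, so the value is at most n, and n+1 rounds reach a maximum flow. *)
Lemma mincut_ok c : cutctx c -> let X := [set u : 'I_n | cA (mincut c) 12 u 0 != 0] in
  [/\ forall u : 'I_n, cA (mincut c) 12 u 0 = (u \in X),
      forall a b, a \in setA c -> b \in setB c -> ~~ connect (rdel G X) a b &
      forall X0 : {set 'I_n},
        (forall a b, a \in setA c -> b \in setB c -> ~~ connect (rdel G X0) a b) -> #|X| <= #|X0|].
Proof.
move=> cc X.
pose c0 := fillc 10 (fun c x y => 0) c.
pose c1 := loopc (fun c => (cn c).+1) (fun _ => augment) c0.
pose P t c' := [/\ cutctx c', capr c' = capr c /\ setA c' = setA c /\ setB c' = setB c &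
  exists2 k, isflow (capr c) sN tN (flw c') k &
    t <= k \/ ~~ connect (residual (capr c) (flw c')) sN tN].
have stN : sN != tN by apply/eqP => /(congr1 val) /=; lia.
have [cc1 [eC [eA eB]] [k fl hk]] : P n.+1 c1.
  have E : (cn c0).+1 = n.+1 by rewrite [cn _](cc_n cc).
  rewrite /c1 -{1}E; apply: (@loop_ind P).
    split; [by case: cc => *; split | exact: capr_ext |].
    exists 0; last by left.
    have -> : flw c0 = (fun _ _ => false).
      apply/funext => x; apply/funext => y; rewrite /flw /c0 /=.
      by case: ifP.
    exact: isflow0.
  move=> t c' _ [cc' [eC [eA eB]] [k fl hk]].
  have [f1 f2 f3 f4 f5] := frame_augment c'.
  have ex : capr (augment c') = capr c /\ setA (augment c') = setA c /\ setB (augment c') = setB c.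
    by rewrite -eC -eA -eB; apply: capr_ext; rewrite ?f5.
  split=> //; first by case: cc' => *; split; rewrite ?f1 ?f3 ?f4.
  rewrite -eC in fl hk *.
  case cn_ : (connect (residual (capr c') (flw c')) sN tN).
    exists k.+1; first exact: augment_aug.
    by case: hk => [h|]; [left | rewrite cn_].
  exists k; first by rewrite augment_noaug ?cn_.
  by right; rewrite augment_noaug ?cn_.
have inn_inj : injective inn by move=> u v /(congr1 val) /= E; apply: val_inj.
have outn_inj : injective outn by move=> u v /(congr1 val) /= /addnI E; apply: val_inj.
have i_o u v : inn u != outn v by apply/eqP => /(congr1 val) /=; have := ltn_ord u; lia.
have s_i u : sN != inn u by apply/eqP => /(congr1 val) /=; have := ltn_ord u; lia.
have s_o u : sN != outn u by apply/eqP => /(congr1 val) /=; have := ltn_ord u; lia.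
have t_i u : tN != inn u by apply/eqP => /(congr1 val) /=; have := ltn_ord u; lia.
have t_o u : tN != outn u by apply/eqP => /(congr1 val) /=; have := ltn_ord u; lia.
have kle (X0 : {set 'I_n}) : (forall a b, a \in setA c -> b \in setB c ->
    ~~ connect (rdel G X0) a b) -> k <= #|X0|.
  exact: (flow_le_sep inn_inj outn_inj i_o s_i s_o t_i t_o stN (capP cc) fl).
have no : ~~ connect (residual (capr c) (flw c1)) sN tN.
  case: hk => // nk; have := kle [set: 'I_n]; rewrite cardsT card_ord => h.
  have : k <= n; last by move=> h'; rewrite ltnNge h' in nk.
  apply: h => a b aA bB; apply/negP => cab.
  have ab : a != b by apply: contraTneq bB => <-; rewrite (disjointFr (disAB c) aA).
  by have := connect_rdel_notin cab ab; rewrite !inE.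
have mcE : mincut c = fillc 12 (fun c u j => incut c u)
  (apsp nnode (fillc 1 (fun c x y => resid c x y) c1)) by [].
clearbody c1; move: mcE.
pose c2 := fillc 1 (fun c x y => resid c x y) c1.
rewrite -/c2; pose c3 := apsp nnode c2; rewrite -/c3 => mcE.
have nZ (x : N) : x < cZ c1 by apply: ltn_trans (cc_Z cc1).
have d3 (x y : N) : cA c3 3 x y = dd (residual (capr c) (flw c1)) x y.
  by rewrite -eC; exact: resid_ok.
have [f1 f2 f3 f4 f5] := frame_apspnode c2.
have [g1 g3 g4] : [/\ cn c3 = n, cG c3 = adjn G & cZ c3 = cZ c1].
  by rewrite [cn c3]f1 [cG c3]f3 [cZ c3]f4; case: cc1.
have [A3 B3] : setA c3 = setA c /\ setB c3 = setB c.
  have [_ [-> ->]] : capr c3 = capr c1 /\ setA c3 = setA c1 /\ setB c3 = setB c1; last by [].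
  by apply: capr_ext => //; [exact: (f5 8) | exact: (f5 9)].
pose R := [set x : N | connect (residual (capr c) (flw c1)) sN x].
have rR (x : N) : rch c3 x = (x \in R).
  by rewrite inE -dd_connect card_ord -d3 /rch /nnode /src g1.
have cutE (u : 'I_n) : incut c3 u = (u \in cutset G (setA c) (setB c) inn outn tN R).
  rewrite [RHS]in_set /incut g1 g3 ltn_ord /= -!rR -A3 -B3 !in_set /= /snk g1.
  congr [|| _, _ && _, _ | _]; apply: eq_existsb => v.
  by rewrite adjnE -rR.
have Z0 : 0 < cZ c1 by have := cc_Z cc1; lia.
have XE (u : 'I_n) : cA (mincut c) 12 u 0 = incut c3 u.
  have uZ : u < cZ c3 by rewrite g4; have := cc_Z cc1; have := ltn_ord u; lia.
  by rewrite mcE fillE // g4.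
have -> : X = cutset G (setA c) (setB c) inn outn tN R.
  by apply/setP => u; rewrite /X inE XE eqb0 negbK cutE.
have sR : sN \in R by rewrite inE connect0.
have tR : tN \notin R by rewrite inE.
have clR x y : x \in R -> residual (capr c) (flw c1) x y -> y \in R.
  by rewrite !inE => h1 h2; apply: connect_trans h1 (connect1 h2).
have [le sep] := cutset_le (disAB c) inn_inj outn_inj i_o s_i s_o (capP cc) fl sR tR clR.
split=> //; first by move=> u; rewrite XE cutE.
by move=> X0 /kle h; apply: leq_trans le h.
Qed.

End MinCut.

(** * The budget and the width it admits *)

Definition same c c' := [/\ cn c' = cn c, cG c' = cG c, cZ c' = cZ c,
  cA c' 4 = cA c 4 & cA c' 5 = cA c 5].

Lemma same_trans c1 c2 c3 : same c1 c2 -> same c2 c3 -> same c1 c3.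
Proof. by case=> e1 e2 e3 e4 e5 [f1 f2 f3 f4 f5]; split; rewrite (f1, f2, f3, f4, f5). Qed.

Lemma frame_same m F c : frame m F -> 4 \notin m -> 5 \notin m -> same c (F c).
Proof. by move=> fr h4 h5; have [f1 _ f3 f4 f5] := fr c; split=> //; apply: f5. Qed.

Lemma same_bb c c' : same c c' -> bb c' = bb c.
Proof. by case=> e1 _ _ e4 _; rewrite /bb (dm_ext e1 e4). Qed.

Lemma same_dg c c' x j : same c c' -> dg c' x j = dg c x j.
Proof. by move=> s; rewrite /dg (same_bb s); case: s => _ _ _ _ ->. Qed.

Lemma same_nw c c' : same c c' -> nw c' = nw c.
Proof. by case=> e1 _ e3 _ e5; rewrite /nw /okw /ndig /mulz e1 e3 e5. Qed.

Lemma same_ww c c' : same c c' -> ww c' = ww c.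
Proof. by move=> s; rewrite /ww (same_nw s). Qed.

Definition nd i := slots i * slots i + slots i * slots i + (slots i + slots i).

Lemma slots_mono i j : i <= j -> slots i <= slots j.
Proof. by rewrite /slots; lia. Qed.

Lemma nd_mono i j : i <= j -> nd i <= nd j.
Proof.
move/slots_mono; rewrite /nd; move: (slots i) (slots j) => a b h.
by have := leq_mul h h; lia.
Qed.

Lemma slots_nd i : slots i <= nd i.
Proof. by rewrite /nd; lia. Qed.

Lemma digits_out c j x : cZ c <= j -> cA (digits c) 5 j x = 0.
Proof.
move=> hj; rewrite /digits /seqc; set F := fun _ : nat => _.
set c0 := fillc 5 _ c.
pose P (t : nat) c' := cZ c' = cZ c /\ cA c' 5 j x = 0.
suff [] : P (cZ c0) (loopc cZ F c0) by [].
apply: (@loop_ind P); first by split=> //; rewrite /c0 /= ltnNge hj.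
by move=> t c' _ [h1 h2]; split=> //; rewrite /F /= h1 ltnNge hj.
Qed.

Section Env.
Variables (n : nat) (G : sgraph 'I_n).

Record env (c : ctx) : Prop := Env {
  en_n : cn c = n; en_G : cG c = adjn G; en_Z : n + n + 2 < cZ c;
  en_D : distok G c; en_P : digitsok c;
  en_0 : forall j x, cZ c <= j -> cA c 5 j x = 0 }.

Lemma env_same c c' : same c c' -> env c -> env c'.
Proof.
move=> s [h1 h2 h3 h4 h5 h6]; have eb := same_bb s; case: s => e1 e2 e3 e4 e5; split.
- by rewrite e1.
- by rewrite e2.
- by rewrite e3.
- by move=> x y; rewrite e4.
- by move=> j x hj hx; rewrite e5 eb h5 -?e3.
- by move=> j x; rewrite e3 e5; apply: h6.
Qed.

(** If the exponent reaches the budget, its row is missing from the table and reads 0; the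
    inequality then fails as well, because a power of a base above 1 exceeds its exponent. *)
Lemma okwP c i : env c -> okw c i = (n.+1 * bb c ^ nd i < cZ c).
Proof.
move=> ec; have b1 := bb_gt1 c.
have big : cZ c <= nd i -> (n.+1 * bb c ^ nd i < cZ c) = false.
  move=> h; apply/negbTE; rewrite -leqNgt.
  apply: leq_trans h (leq_trans (ltnW (ltn_expl (nd i) b1)) _).
  by rewrite leq_pmull.
rewrite /okw; case: (leqP (slots i) (cZ c)) => h /=; last first.
  by rewrite big //; apply: leq_trans (ltnW h) (slots_nd i).
have -> : ndig c i = nd i by rewrite /ndig !mulzE.
case: (ltnP (nd i) (cZ c)) => h2; last by rewrite big // (en_0 ec).
have Z1 : cZ c - 1 < cZ c by have := en_Z ec; lia.
rewrite (en_P ec) // (en_n ec) leq_divRL ?expn_gt0 ?(ltnW b1) //.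
by rewrite subn1 -ltnS prednK //; have := en_Z ec; lia.
Qed.

Lemma ww_ok c : env c -> 0 < nw c -> n.+1 * bb c ^ nd (ww c) < cZ c.
Proof.
move=> ec; rewrite -(okwP _ ec) /ww /nw firstE (en_n ec).
set m := find _ _ => m0; have lt : m - 1 < m by lia.
have mn : m <= n by rewrite -[X in _ <= X](size_iota 0 n) find_size.
have := before_find 0 lt; rewrite nth_iota ?(leq_trans lt) // add0n.
by move/negbFE.
Qed.

Lemma ww_ge c w : env c -> w < n -> n.+1 * bb c ^ nd w < cZ c -> w <= ww c /\ 0 < nw c.
Proof.
move=> ec wn ok; suff : w < nw c by rewrite /ww; lia.
rewrite ltnNge; apply/negP => le; set m := nw c in le.
have mE : m = find (fun i => ~~ okw c i) (iota 0 n) by rewrite /m /nw firstE (en_n ec).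
have mn : m < n by apply: leq_ltn_trans wn.
have : ~~ okw c (nth 0 (iota 0 n) m).
  by rewrite {1}mE; apply: (@nth_find _ 0 (fun i => ~~ okw c i)); rewrite has_find -mE size_iota.
rewrite nth_iota // add0n (okwP _ ec) => /negP; apply.
apply: leq_ltn_trans ok; rewrite leq_mul2l /= leq_pexp2l ?nd_mono //.
exact: ltnW (bb_gt1 c).
Qed.

End Env.

Lemma rank_lt n (P : nat -> bool) u v : u < n -> P u -> u < v ->
  Sm n (fun y => (y < u) && P y) < Sm n (fun y => (y < v) && P y).
Proof.
move=> un Pu uv; rewrite !SmE (bigD1 (Ordinal un)) //= ltnn add0n.
rewrite [X in _ < X](bigD1 (Ordinal un)) //= uv Pu add1n ltnS.
apply: leq_sum => y _; case: (ltnP y u) => //= yu.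
by rewrite (ltn_trans yu uv).
Qed.

Lemma rank_lt_card n (P : nat -> bool) u : u < n -> P u ->
  Sm n (fun y => (y < u) && P y) < Sm n (fun y => P y).
Proof.
move=> un Pu; apply: leq_trans (rank_lt un Pu un) _.
by apply: leq_sum => y _; rewrite ltn_ord.
Qed.

Lemma rank_inj n (P : nat -> bool) u v : u < n -> v < n -> P u -> P v ->
  Sm n (fun y => (y < u) && P y) = Sm n (fun y => (y < v) && P y) -> u = v.
Proof.
move=> un vn Pu Pv E; case: (ltngtP u v) => // h.
  by have := rank_lt un Pu h; rewrite E ltnn.
by have := rank_lt vn Pv h; rewrite E ltnn.
Qed.

Lemma Sm_card n (P : nat -> bool) : Sm n (fun y => P y) = #|[set u : 'I_n | P u]|.
Proof.
rewrite SmE -sum1_card big_mkcond [RHS]big_mkcond /=; apply: eq_bigr => u _.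
by rewrite inE; case: (P u).
Qed.

(** * The ordering phase *)

Lemma frame_trymask mu : frame [:: 1; 2; 3; 9; 10; 11; 12; 13] (trymask mu).
Proof.
apply: (@frame_sub ([:: 9] ++ [:: 1; 2; 3; 10; 11; 12] ++ [:: 13])); first by apply/allP.
apply: frame_seq; first exact: frame_fill.
by apply: frame_seq; [exact: frame_mincut | exact: frame_fill].
Qed.

Lemma frame_round r : frame [:: 1; 2; 3; 6; 7; 8; 9; 10; 11; 12; 13] (round r).
Proof.
apply: (@frame_sub ([:: 1] ++ [:: 2; 3] ++ [:: 7] ++ [:: 8] ++ [:: 13] ++
  [:: 1; 2; 3; 9; 10; 11; 12; 13] ++ [:: 6])); first by apply/allP.
do 5 (apply: frame_seq; [by [exact: frame_fill | exact: frame_apsp] | ]).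
by apply: frame_seq; [apply: frame_loop => mu; exact: frame_trymask | exact: frame_fill].
Qed.

Lemma frame_ordering : frame [:: 1; 2; 3; 6; 7; 8; 9; 10; 11; 12; 13] ordering.
Proof.
apply: (@frame_sub ([:: 6] ++ [:: 1; 2; 3; 6; 7; 8; 9; 10; 11; 12; 13])); first by apply/allP.
by apply: frame_seq; [exact: frame_fill | apply: frame_loop => r; exact: frame_round].
Qed.

Section Ordering.
Variables (n : nat) (G : sgraph 'I_n).
Local Notation T := 'I_n.

Definition setW c : {set T} := [set u : T | cA c 8 u 0 != 0].
Definition keys c : T -> nat := fun u => cA c 6 u 0.

Lemma mask_ex c (A : {set T}) m : env G c -> bb c ^ m <= cZ c -> m.+1 < cZ c -> #|setW c| <= m ->
  A \subset setW c -> exists mu, mu < cZ c /\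
    forall u, u \in setW c -> (dg c mu (rankW c u) == 1) = (u \in A).
Proof.
move=> ec hb hm hW /subsetP AW.
pose f j := nat_of_bool [exists u in A, rankW c (u : T) == j].
have [||mu [h1 _ h3]] := @digit_code (bb c) m f 0; first exact: ltnW (bb_gt1 c).
  by move=> j _; apply: leq_ltn_trans (leq_b1 _) (bb_gt1 c).
have muZ : mu < cZ c by apply: leq_trans h1 _; rewrite mul1n.
exists mu; split=> // u uW.
have Pu : cA c 8 u 0 != 0 by move: uW; rewrite inE.
have lt : rankW c u < m.
  rewrite /rankW (en_n ec); apply: leq_trans hW; rewrite /setW.
  rewrite -(Sm_card n (fun y => cA c 8 y 0 != 0)).
  exact: (@rank_lt_card n (fun y => cA c 8 y 0 != 0)).
rewrite (dgE (en_P ec)) ?h3 //; last by apply: leq_trans hm; rewrite ltnS ltnW.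
rewrite /f eqb1; apply/exists_inP/idP => [[u' uA /eqP E]|uA]; last by exists u.
have := AW _ uA; rewrite inE => Pu'.
suff <- : u' = u by [].
apply: val_inj; move: E; rewrite /rankW (en_n ec).
exact: (@rank_inj n (fun y => cA c 8 y 0 != 0)).
Qed.

Section Round.
Variables (c : ctx) (r : nat).
Hypotheses (ec : env G c) (nw0 : 0 < nw c) (tw : treewidth G <= ww c).
Local Notation w := (ww c).
Local Notation K := (keys c).
Hypothesis inv : ordinv G w r K.

Let c2 := apsp cn (fillc 1 (fun c i j => [&& cG c i j, cA c 6 i 0 == 0 & cA c 6 j 0 == 0]) c).
Let c3 := fillc 7 (fun c u j =>
  [&& u < cn c, cA c 6 u 0 == 0, fvx c < cn c & cA c 3 (fvx c) u < cn c]) c2.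
Let c4 := fillc 8 (fun c u j => (u < cn c) && ((u == fvx c) ||
    (cA c 6 u 0 != 0) && Ex (cn c) (fun y => (cA c 7 y 0 != 0) && cG c y u))) c3.
Let c5 := fillc 13 (fun c u j => 0) c4.

Let fr2 : frame ([:: 1] ++ [:: 2; 3]) ((fillc 1 (fun c i j =>
  [&& cG c i j, cA c 6 i 0 == 0 & cA c 6 j 0 == 0])) ;; apsp cn).
Proof. by apply: frame_seq; [exact: frame_fill | exact: frame_apsp]. Qed.

Let s2 : same c c2. Proof. exact: (frame_same c fr2). Qed.
Let k2 : cA c2 6 = cA c 6. Proof. by have [_ _ _ _ h] := fr2 c; apply: h. Qed.
Let s5 : same c c5.
Proof. by have [h1 h2 h3 h4 h5] := s2; split. Qed.
Let k5 : cA c5 6 = cA c 6. Proof. exact: k2. Qed.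

Let Z5 : cZ c5 = cZ c. Proof. by case: s5. Qed.
Let Z2 : cZ c2 = cZ c. Proof. by case: s2. Qed.
Let uZ (u : T) : u < cZ c. Proof. by have := en_Z ec; have := ltn_ord u; lia. Qed.
Let Z0 : 0 < cZ c. Proof. by have := en_Z ec; lia. Qed.

Let d2 (x y : T) : cA c2 3 x y = dd (rdel G (placed K)) x y.
Proof.
apply: apsp_ok => [//| ||x' y']; first by rewrite [cn _](en_n ec).
  by apply: leq_trans (ltnW (en_Z ec)); rewrite -addnA leq_addr.
rewrite fillE ?uZ // eqb0 negbK rdelE (en_G ec) adjnE /= !inE.
by rewrite !negbK.
Qed.

Let round_placed : (forall u, K u != 0) -> ordinv G w r.+1 (keys (round r c)).
Proof.
move=> al; set c6 := loopc cZ trymask c5.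
have fr : frame [:: 1; 2; 3; 9; 10; 11; 12; 13] (loopc cZ trymask).
  by apply: frame_loop => mu; exact: frame_trymask.
have [_ _ _ e4 e5] := fr c5.
have -> : keys (round r c) = K; last exact: ordinv_done.
apply/funext => u; rewrite /round /seqc /keys -/c2 -/c3 -/c4 -/c5 -/c6.
have E : cA c6 6 = cA c 6 by rewrite /c6 e5.
have Zu : u < cZ c6 by rewrite /c6 e4 Z5; exact: uZ.
have Z06 : 0 < cZ c6 by rewrite /c6 e4 Z5; exact: Z0.
by rewrite fillE // E /ite; have := al u; rewrite /keys => ->.
Qed.

Section First.
Variable v : T.
Hypotheses (v0 : K v = 0) (fv : first n (fun i => cA c 6 i 0 == 0) = v).

Let a7 (u : T) : cA c5 7 u 0 = (u \in ocomp G K v).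
Proof.
rewrite -[LHS]/(cA c3 7 u 0) /c3 fillE ?Z2 //.
have [e1 _ _ _ _] := s2.
rewrite /fvx k2 e1 (en_n ec) fv !ltn_ord d2 in_set /= -/(keys c u).
by rewrite -[X in _ < X](card_ord n) dd_connect.
Qed.

Let a8 : setW c5 = owall G K v.
Proof.
apply/setP => u; rewrite in_set -[cA c5 8 u 0]/(cA c4 8 u 0) /c4 fillE ?[cZ c3]Z2 //.
have [e1 e2 _ _ _] := s2.
rewrite eqb0 negbK [cn c3]e1 /fvx [cn c3]e1 [cA c3 6]k2 (en_n ec) ltn_ord fv in_setU1.
rewrite [cG c3]e2 (en_G ec) /nbr in_set in_set -/(keys c u); congr (_ || _ && _).
apply/existsP/existsP => -[z /andP[h1 h2]]; exists z.
  rewrite adjnE in h2; rewrite h2 andbT; move: h1; rewrite -[cA c3 7 z 0]/(cA c5 7 z 0) a7 eqb0 negbK.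
  by rewrite in_set => /andP[].
rewrite adjnE h2 andbT -[cA c3 7 z 0]/(cA c5 7 z 0) a7 eqb0 negbK in_set h1 andbT.
case: (eqVneq v z) => [<-|ne]; first by rewrite v0.
by have /andP[_] := connect_rdel_notin h1 ne; rewrite in_set negbK.
Qed.

Definition goodpair (A X : {set T}) := [/\ #|X| + #|A| <= 3 * w + 3,
  #|X| + #|owall G K v :\: A| <= 3 * w + 3 &
  forall a b, a \in A -> b \in owall G K v :\: A -> ~~ connect (rdel G X) a b].

Let maskset mu : {set T} := [set u in owall G K v | dg c mu (rankW c5 u) == 1].

(** Either array 13 holds a good cut for some side, or no mask tried so far admits one. A later mask
    overwrites the cut only by another good one. *)
Let I t c' := [/\ same c c', forall a, a \in [:: 6; 7; 8] -> cA c' a = cA c5 a &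
  (exists A, goodpair A [set u : T | cA c' 13 u 0 != 0]) \/
  forall mu, mu < t -> forall X, ~ goodpair (maskset mu) X].

(** The computed cut is minimum, so if any X is good for this side, the computed one passes the test
    too. *)
Let I_step mu c' : I mu c' -> I mu.+1 (trymask mu c').
Proof.
case=> s' k' hI; have fr := frame_trymask mu.
have st : same c (trymask mu c') by apply: same_trans s' _; apply: frame_same fr _ _.
split=> //.
  move=> a ha; have [_ _ _ _ h] := fr c'; rewrite h; first exact: k'.
  by move: ha; rewrite !inE => /or3P[] /eqP->.
set d1 := fillc 9 (fun c u j => (cA c 8 u 0 != 0) && (dg c mu (rankW c u) == 1)) c'.
have sd1 : same c d1 by case: s' => *; split.
have ed1 : env G d1 by apply: env_same sd1 ec.
have cd1 : cutctx G d1 by split; [exact: en_n ed1 | exact: en_G ed1 | exact: en_Z ed1].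
have [X0 Xsep Xmin] := mincut_ok cd1; set X := [set u : T | _] in X0 Xsep Xmin.
have e8 : cA c' 8 = cA c5 8 by apply: k'.
have Zc' : cZ c' = cZ c by case: s'.
have nc' : cn c' = n by case: s' => -> *; exact: en_n ec.
have rW u : rankW c' u = rankW c5 u by rewrite /rankW e8 nc' [cn c5](en_n (env_same s5 ec)).
have W8 u : (cA c' 8 (u : T) 0 != 0) = (u \in owall G K v) by rewrite -a8 in_set e8.
have A9 u : inA d1 (u : T) = (u \in maskset mu).
  rewrite /inA /d1 fillE ?Zc' ?uZ ?Z0 // eqb0 negbK W8 rW (same_dg _ _ s').
  by rewrite [RHS]in_set.
have B9 u : inB d1 (u : T) = (u \in owall G K v :\: maskset mu).
  rewrite in_setD -A9 /inB /inA negbK -[cA d1 8 u 0]/(cA c' 8 u 0) W8.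
  by rewrite andbC.
have EA : setA n d1 = maskset mu by apply/setP => u; rewrite in_set A9.
have EB : setB n d1 = owall G K v :\: maskset mu by apply/setP => u; rewrite in_set B9.
rewrite EA EB in Xsep Xmin.
have s1 : same c (mincut d1) by apply: same_trans sd1 _; apply: (frame_same _ frame_mincut).
have good : goodcut (mincut d1) =
    (#|X| + #|maskset mu| <= 3 * w + 3) && (#|X| + #|owall G K v :\: maskset mu| <= 3 * w + 3).
  have [_ _ _ _ f9] := frame_mincut d1.
  have nm : cn (mincut d1) = n by case: s1 => -> *; exact: en_n ec.
  rewrite /goodcut /w3 (same_ww s1) nm.
  have -> : Sm n (fun u => cA (mincut d1) 12 u 0) = #|X|.
    rewrite SmE (eq_bigr (fun u : T => nat_of_bool (u \in X))) => [|u _]; last exact: X0.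
    by rewrite -sum1_card [RHS]big_mkcond; apply: eq_bigr => u _; case: (u \in X).
  have -> : Sm n (fun u => inA (mincut d1) u) = #|maskset mu|.
    rewrite Sm_card; apply: eq_card => u; rewrite in_set -A9 /inA f9 //.
  have -> : Sm n (fun u => inB (mincut d1) u) = #|owall G K v :\: maskset mu|.
    by rewrite Sm_card; apply: eq_card => u; rewrite in_set -B9 /inB !f9.
  by rewrite !mulSn mul0n addn0 !addnA.
have E13 (u : T) : cA (trymask mu c') 13 u 0 = ite (goodcut (mincut d1)) (cA (mincut d1) 12 u 0) (cA c' 13 u 0).
  rewrite /trymask /seqc -/d1 fillE.
  - by have [_ _ _ _ f9] := frame_mincut d1; rewrite [cA (mincut d1) 13]f9.
  - by case: s1 => _ _ -> *; exact: uZ.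
  - by case: s1 => _ _ -> *; exact: Z0.
case: (boolP (goodcut (mincut d1))) => [g|ng].
  left; exists (maskset mu); move: (g); rewrite good => /andP[g1 g2].
  have -> : [set u : T | cA (trymask mu c') 13 u 0 != 0] = X.
    by apply/setP => u; rewrite !in_set E13 g /ite.
  by split.
have E13' : [set u : T | cA (trymask mu c') 13 u 0 != 0] = [set u : T | cA c' 13 u 0 != 0].
  by apply/setP => u; rewrite !in_set E13 (negbTE ng) /ite.
rewrite E13'; case: hI => [h|h]; [by left | right => mu'].
rewrite ltnS leq_eqVlt => /orP[/eqP->|lt] Y; last exact: h.
case=> g1 g2 g3; move/negP: ng; apply; rewrite good.
have le := Xmin Y g3.
by rewrite (leq_trans _ g1) ?leq_add2r // (leq_trans _ g2) ?leq_add2r.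
Qed.

Lemma round_first : ordinv G w r.+1 (keys (round r c)).
Proof.
set c6 := loopc cZ trymask c5.
have : I (cZ c5) c6.
  apply: (@loop_ind I) => [|t c' _]; last exact: I_step.
  by split; [exact: s5 | | right].
case=> s6 k6; rewrite Z5 => h6.
have [A [X0 gA]] : exists A X, goodpair A X /\ X = [set u : T | cA c6 13 u 0 != 0].
  case: h6 => [[A gA]|no]; first by exists A, [set u : T | cA c6 13 u 0 != 0].
  have [U [F [bag [td hb]]]] := treewidth_td G.
  have hb' u : #|bag u| <= w.+1 by apply: leq_trans (hb u) _; rewrite ltnS.
  have cW := owall_card inv v0.
  have [X [A [X1 AW A2 A3 sep]]] := balanced_split td hb' cW.
  have ok := ww_ok ec nw0; have b1 := bb_gt1 c.
  (* Masks have fewer digits than codes, so the budget that admits the width also admits every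
     mask. *)
  have lt : 3 * w + 4 < nd w by rewrite /nd /slots; move: (ww c); clear; nia.
  have hb2 : bb c ^ (3 * w + 4) <= cZ c.
    apply: leq_trans (ltnW ok); apply: leq_trans (leq_pmull _ _) => //.
    by apply: leq_pexp2l => //; [exact: ltnW | exact: ltnW].
  have hm : (3 * w + 4).+1 < cZ c.
    apply: leq_ltn_trans lt _; apply: leq_trans (ltn_expl _ b1) _.
    by apply: leq_trans (ltnW ok); apply: leq_pmull.
  have e5 := env_same s5 ec; have [_ _ Z5' _ _] := s5.
  have [||||mu [muZ hmu]] := @mask_ex c5 A (3 * w + 4) e5.
  - by rewrite (same_bb s5) Z5.
  - by rewrite Z5.
  - by rewrite a8.
  - by rewrite a8.
  have mA : maskset mu = A.
    apply/setP => u; rewrite in_set -(same_dg _ _ s5).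
    case uW : (u \in owall G K v) => /=; first by apply: hmu; rewrite a8.
    by apply/esym/negbTE; apply: contraFN uW => uA; apply: (subsetP AW).
  case: (no mu _ X); first by rewrite -Z5.
  rewrite mA; split=> //.
    by move: X1 A2; clear; lia.
  by move: X1 A3; clear; lia.
case: gA => -[g1 g2 g3] XE.
have -> : keys (round r c) = nextkey G r K v X0; last exact: ordinv_step inv v0 g1 g2 g3.
apply/funext => u; rewrite /round /seqc /keys -/c2 -/c3 -/c4 -/c5 -/c6.
have [e1 _ e3 _ _] := s6.
have q6 : cA c6 6 = cA c 6 by rewrite k6.
have q7 : cA c6 7 u 0 = (u \in ocomp G K v) by rewrite k6.
rewrite fillE ?e3 // /fvx e1 q6 q7 (en_n ec) fv /nextkey /ite.
have -> : (cA c6 13 u 0 != 0) = (u \in X0) by rewrite XE in_set.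
by rewrite eqb0 negbK.
Qed.

End First.

Lemma round_ok : ordinv G w r.+1 (keys (round r c)).
Proof.
case: (pickP (fun u : T => K u == 0)) => [u hu|al]; last first.
  by apply: round_placed => u; rewrite al.
have [v [fv /eqP v0]] := @first_ord n (fun i => cA c 6 i 0 == 0) u hu.
exact: (round_first v0 fv).
Qed.

End Round.

Lemma ordering_ok c : env G c -> 0 < nw c -> treewidth G <= ww c ->
  ordinv G (ww c) n (keys (ordering c)).
Proof.
move=> ec nw0 tw; rewrite /ordering /seqc; set c0 := fillc 6 _ c.
pose P t c' := same c c' /\ ordinv G (ww c) t (keys c').
have s0 : same c c0 by [].
have : P n (loopc cn round c0).
  have E : cn c0 = n by exact: en_n ec.
  rewrite -{1}E; apply: (@loop_ind P).
    split=> //; have -> : keys c0 = fun _ => 0; last exact: ordinv0.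
    by apply/funext => u; rewrite /keys /c0 /= if_same.
  move=> r c' _ [s' inv']; split.
    by apply: same_trans s' _; apply: frame_same (frame_round r) _ _.
  rewrite -(same_ww s') in inv' tw *.
  by apply: round_ok => //; [exact: env_same s' ec | rewrite (same_nw s')].
by case.
Qed.

End Ordering.

(** * Ranks, bags and their verification *)

Lemma frame_elim : frame [:: 1; 2; 3; 14; 15] elim.
Proof.
apply: (@frame_sub ([:: 14] ++ [:: 15] ++ ([:: 1] ++ [:: 2; 3] ++ [:: 15]))); first by apply/allP.
do 2 (apply: frame_seq; first exact: frame_fill).
apply: frame_loop => v; apply: frame_seq; first exact: frame_fill.
by apply: frame_seq; [exact: frame_apsp | exact: frame_fill].
Qed.

Section Elim.
Variables (n : nat) (G : sgraph 'I_n).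
Local Notation T := 'I_n.

Definition ranks c : T -> nat := fun u => rk c u.
Definition elimok c := (forall v u : T, cA c 15 v u = (u \in Sv G (ranks c) v)) /\
  forall u, cA c 15 n u = 0.

Lemma elim_ok c : env G c ->
  (forall u : T, ranks (elim c) u = #|[set y : T | keys c y < keys c u]|) /\ elimok (elim c).
Proof.
move=> ec; have nc := en_n ec.
have uZ (u : T) : u < cZ c by have := en_Z ec; have := ltn_ord u; lia.
have Z0 : 0 < cZ c by have := en_Z ec; lia.
have nZ : n <= cZ c by have := en_Z ec; lia.
rewrite /elim /seqc; set F := (fun (v : nat) c => _); set c1 := fillc 14 _ c.
set c2 := fillc 15 _ c1.
have r2 u : ranks c2 u = #|[set y : T | keys c y < keys c u]|.
  by rewrite -[LHS]/(cA c1 14 u 0) /c1 fillE // nc Sm_card.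
(* Row [n] of array 15 stays zero: it belongs to the empty bag above the roots. *)
pose P t c' := [/\ same c c', cA c' 14 = cA c2 14 &
  (forall v u : T, v < t -> cA c' 15 v u = (u \in Sv G (ranks c2) v)) /\
  forall u, cA c' 15 n u = 0].
suff [_ h14 [h15 h15n]] : P n (loopc cn F c2).
  have E : ranks (loopc cn F c2) = ranks c2 by apply/funext => u; rewrite /ranks /rk h14.
  by rewrite E; split=> //; split=> // v u; rewrite E; apply: h15.
have E : cn c2 = n by [].
rewrite -{1}E; apply: (@loop_ind P); first by split=> //; split=> // u; rewrite /c2 /= if_same.
move=> t c' tn [s' h14 [h15 h15n]]; rewrite E in tn.
have [e1 e2 e3 e4 e5] := s'.
set d1 := fillc 1 (fun c i j => [&& cG c i j, cA c 14 t 0 <= cA c 14 i 0 & cA c 14 t 0 <= cA c 14 j 0]) c'.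
set d2 := apsp cn d1.
have [f1 _ f3 f4 f5] := frame_apsp cn d1.
pose v := Ordinal tn.
have dd2 (x y : T) : cA d2 3 x y = dd (rdel G (bef (ranks c2) v)) x y.
  apply: apsp_ok => [//| | |x' y']; first by rewrite [cn _]e1.
    by rewrite [cZ _]e3.
  rewrite /d1 fillE ?e3 ?uZ // eqb0 negbK e2 (en_G ec) adjnE h14 rdelE !in_set.
  by rewrite -!leqNgt.
have s2 : same c d2.
  apply: same_trans s' _.
  apply: (@frame_same ([:: 1] ++ [:: 2; 3]) ((fillc 1 (fun c i j =>
    [&& cG c i j, cA c 14 t 0 <= cA c 14 i 0 & cA c 14 t 0 <= cA c 14 j 0])) ;; apsp cn)) => //.
  by apply: frame_seq; [exact: frame_fill | exact: frame_apsp].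
have [k1 k2 k3 _ _] := s2.
have d14 : cA d2 14 = cA c2 14 by rewrite f5.
have d15 : cA d2 15 = cA c' 15 by rewrite f5.
rewrite /F /seqc -/d1 -/d2; split.
- exact: s2.
- exact: d14.
split=> [x u xt|u]; last first.
  rewrite /= k3 d15 h15n /ite; case: eqP => [En|_]; last by rewrite if_same.
  by have := ltn_eqF tn; rewrite -En eqxx.
rewrite fillE ?k3 ?uZ // /ite d15 d14 k1 nc ltn_ord.
case: eqP => [xE|xN]; last by apply: h15; have := xt; lia.
have -> : x = v by apply: val_inj.
congr nat_of_bool; rewrite [RHS]in_set in_set -/(ranks c2 u) -/(ranks c2 v) /=; congr (_ && _).
apply: eq_existsb => z; rewrite -[t]/(val v) dd2 k2 (en_G ec) adjnE.
by rewrite -[X in _ < X](card_ord n) dd_connect.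
Qed.

(** The strict bound on [Sv] leaves room for the vertex itself, so positions in a bag are below
    [sc c]. *)
Definition checked c := [/\ 0 < nw c, injective (ranks c) & forall v, #|Sv G (ranks c) v| < sc c].

Lemma checksP c : env G c -> elimok c -> reflect (checked c) (checks c).
Proof.
move=> ec [el _]; rewrite /checks (en_n ec).
have SE v : Sm n (fun u => inS c (v : T) u) = #|Sv G (ranks c) v|.
  by rewrite Sm_card; apply: eq_card => u; rewrite in_set /inS el eqb0 negbK.
apply: (iffP and3P) => -[h1 h2 h3]; split=> //.
- move=> u v E; apply/eqP; have /AlP/(_ u)/AlP/(_ v) := h2; rewrite -/(ranks c u) -/(ranks c v) E.
  by rewrite eqxx implybF negbK => /eqP /val_inj->.
- by move=> v; rewrite -SE; have /AlP/(_ v) := h3.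
- apply/AlP => u; apply/AlP => v; apply/implyP; apply: contraNneq => E.
  by rewrite (h2 u v E).
- by apply/AlP => v; rewrite SE.
Qed.

Lemma ranks_lt c u : env G c -> ranks (elim c) u < n.
Proof.
move=> ec; have [-> _] := elim_ok ec; rewrite -[X in _ < X](card_ord n) -cardsT.
by apply: proper_card; apply/properP; split; [exact: subsetT | exists u; rewrite ?inE // ltnn].
Qed.

Lemma elim_checked c : env G c -> 0 < nw c -> ordinv G (ww c) n (keys c) -> checked (elim c).
Proof.
move=> ec nw0 inv; have [rE _] := elim_ok ec.
have s : same c (elim c) by apply: (frame_same c frame_elim).
have K0 := ordinv_final inv.
have lt u v : (ranks (elim c) u < ranks (elim c) v) = (keys c u < keys c v).
  rewrite !rE; case: (ltnP (keys c u) (keys c v)) => h.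
    apply: proper_card; apply/properP; split.
      by apply/subsetP => y; rewrite !inE => /ltn_trans; apply.
    by exists u; rewrite !inE // ltnn.
  apply/negbTE; rewrite -leqNgt; apply: subset_leq_card.
  by apply/subsetP => y; rewrite !inE => /leq_trans; apply.
split; first by rewrite (same_nw s).
  move=> u v E; apply: (ord_inj inv (K0 u)).
  by case: (ltngtP (keys c u) (keys c v)) => //; rewrite -lt E ltnn.
move=> v; rewrite /sc (same_ww s); apply: leq_ltn_trans (_ : 6 * ww c + 6 < _); last first.
  by rewrite /slots; lia.
have -> : Sv G (ranks (elim c)) v = nbr G (before (keys c) v) v.
  by congr nbr; apply/setP => u; rewrite !in_set lt K0.
exact: (ord_bag inv (K0 v)).
Qed.

End Elim.

(** * Codes represent interfaces *)

Section DP.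
Variables (n : nat) (G : sgraph 'I_n) (c : ctx).
Local Notation T := 'I_n.
Hypotheses (ec : env G c) (el : elimok G c) (ch : checked G c).
Local Notation rkf := (@ranks n c).
Local Notation b := (bb c).
Local Notation s := (sc c).
Local Notation Z := (cZ c).
Local Notation Sv := (Sv G rkf).
Local Notation Bv := (Bv G rkf).
Local Notation Bq := (Bq G rkf).
Local Notation Sem := (Sem G rkf b).
Local Notation m2 := (s * s + s * s).
Local Notation D := (m2 + (s + s)).

Definition row (q : option T) : nat := if q is Some v then v else n.

Let b1 : 1 < b. Proof. exact: bb_gt1. Qed.
Let bnd : n.+1 * b ^ D < Z. Proof. by apply: ww_ok ec _; case: ch. Qed.
Let bD : b ^ D < Z. Proof. by apply: leq_ltn_trans bnd; apply: leq_pmull. Qed.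
Let DZ : D.+1 < Z. Proof. by apply: leq_ltn_trans bD; apply: ltn_expl. Qed.
Let s0 : 0 < s. Proof. by rewrite /sc /slots addnS. Qed.
Let sZ : s <= Z. Proof. by apply: leq_trans (ltnW (ltnW DZ)); rewrite addnA leq_addl. Qed.
Let nZ : n < Z. Proof. by have := en_Z ec; move: Z; clear; lia. Qed.

Lemma sqE : sq c = s * s. Proof. exact: mulzE. Qed.

Lemma inSE v u : inS c (v : T) (u : T) = (u \in Sv v).
Proof. by case: el => h _; rewrite /inS h eqb0 negbK. Qed.

Lemma inBagE q (u : T) : inBag c (row q) u = (u \in Bq q).
Proof.
case: q => [v|] /=; first by rewrite in_setU1 -inSE.
by case: el => _ h; rewrite /inBag /inS h inE orbF; have := ltn_ord u; lia.
Qed.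

Lemma ixE v u : ix c v u = Sm n (fun y => (y < u) && inBag c v y).
Proof. by rewrite /ix (en_n ec). Qed.

Lemma ix_lt q (u : T) : u \in Bq q -> ix c (row q) u < s.
Proof.
move=> uB; have hu : inBag c (row q) u by rewrite inBagE.
rewrite ixE; apply: leq_trans (rank_lt_card (ltn_ord u) hu) _.
rewrite Sm_card; case: q uB hu => [v|]; last by rewrite inE.
move=> _ _; have -> : [set u : T | inBag c (row (Some v)) u] = Bv v.
  by apply/setP => y; rewrite in_set inBagE.
by case: ch => _ _ /(_ v) h; rewrite cardsU1; apply: leq_trans h; rewrite -add1n leq_add2r leq_b1.
Qed.

Lemma ix_inj q (u z : T) : u \in Bq q -> z \in Bq q -> ix c (row q) u = ix c (row q) z -> u = z.
Proof.
move=> uB zB; rewrite !ixE => E; apply: val_inj.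
by apply: (rank_inj (ltn_ord u) (ltn_ord z) _ _ E); rewrite inBagE.
Qed.

Lemma dg_lt tau j : j < D -> tau < Z -> dg c tau j < b.
Proof.
move=> jD tZ; rewrite (dgE (en_P ec)) //; last exact: leq_ltn_trans jD (ltnW DZ).
by rewrite ltn_pmod // ltnW.
Qed.

Lemma dXE tau v u z : ix c v u <= n -> dX c tau v u z = dg c tau (ix c v u * s + ix c v z).
Proof. by move=> h; rewrite /dX mulzE // (leq_trans h) // ltnW. Qed.

Lemma ix_le v u : ix c v u <= n.
Proof.
rewrite ixE SmE -[X in _ <= X]card_ord -sum1_card; apply: leq_sum => i _; exact: leq_b1.
Qed.

Lemma pos_lt i j : i < s -> j < s -> i * s + j < s * s.
Proof.
move=> hi hj; have lt : i * s + j < i.+1 * s by rewrite mulSn addnC ltn_add2r.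
by apply: leq_trans lt _; rewrite leq_mul2r hi orbT.
Qed.

Definition dec (q : option T) (tau : nat) : astate T :=
  AState (fun u z : T => dX c tau (row q) u z) (fun u z : T => dE c tau (row q) u z)
    (fun u : T => dI c tau (row q) u) (fun u : T => dO c tau (row q) u) (dK c tau).

Definition slot q i : option T := [pick u : T | (u \in Bq q) && (ix c (row q) u == i)].

Lemma slotK q u : u \in Bq q -> slot q (ix c (row q) u) = Some u.
Proof.
move=> uB; rewrite /slot; case: pickP => [z /andP[zB /eqP E]|/(_ u)]; last by rewrite uB eqxx.
by rewrite (ix_inj zB uB E).
Qed.

Lemma dKE tau : tau < Z -> dK c tau = tau %/ b ^ D.
Proof. by move=> h; rewrite /dK sqE (en_P ec) // ltnW. Qed.

Lemma encode q h (i o : T -> nat) k : (forall j, j < m2 -> h j < b) ->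
  (forall u, u \in Bq q -> i u <= 1 /\ o u <= 1) -> k <= n ->
  exists tau, [/\ tau < Z, forall j, j < m2 -> dg c tau j = h j, dK c tau = k &
    forall u, u \in Bq q -> dI c tau (row q) u = i u /\ dO c tau (row q) u = o u].
Proof.
move=> hb io kn.
pose bit (f : T -> nat) (x : option T) := if x is Some u then minn (f u) 1 else 0.
have bitb f x : bit f x < b by apply: leq_ltn_trans b1; case: x => //= u; apply: geq_minr.
pose f j := if j < m2 then h j else if j < m2 + s then bit i (slot q (j - m2))
            else bit o (slot q (j - m2 - s)).
have fb j : j < D -> f j < b by rewrite /f; case: ifP => [/hb //|]; case: ifP.
have [tau [t1 t2 t3]] := digit_code k (ltnW b1) fb.
have tZ : tau < Z by apply: leq_trans t1 (leq_trans _ (ltnW bnd)); rewrite leq_mul2r ltnS kn orbT.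
have dgf j : j < D -> dg c tau j = f j.
  move=> jD; rewrite (dgE (en_P ec)) // ?t3 //; exact: leq_ltn_trans jD (ltnW DZ).
exists tau; split=> //.
- by move=> j jm; rewrite dgf ?/f ?jm // (leq_trans jm) // leq_addr.
- by rewrite dKE.
move=> u uB; have lt := ix_lt uB; have [i1 o1] := io u uB; split.
  rewrite /dI sqE dgf; last by rewrite ltn_add2l (leq_trans lt) // leq_addr.
  rewrite /f ltnNge leq_addr /= ltn_add2l lt addKn slotK //=.
  by apply/minn_idPl.
rewrite /dO sqE dgf; last by rewrite !ltn_add2l.
rewrite /f ltnNge leq_addr /= ltn_add2l ltnNge leq_addr /= addKn addKn slotK //=.
by apply/minn_idPl.
Qed.

(** Truncation by [b.-1] makes every digit legal without a hypothesis on [x]; positions that belong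
    to no bag vertex get 0. *)
Definition hxe q (x : T -> T -> nat) (e : T -> T -> bool) j :=
  let g j f := if slot q (j %/ s) is Some u then if slot q (j %% s) is Some z then f u z else 0 else 0 in
  if j < s * s then g j (fun u z => minn (x u z) b.-1) else g (j - s * s) (fun u z => e u z : nat).

Lemma hxe_lt q x e j : hxe q x e j < b.
Proof.
have h0 : 0 < b by apply: ltnW.
rewrite /hxe; case: ifP => _; case: (slot q _) => // u; case: (slot q _) => // z.
  by rewrite -[X in _ < X](prednK h0) ltnS geq_minr.
by apply: leq_ltn_trans (leq_b1 _) b1.
Qed.

Lemma decX q tau (u z : T) : u \in Bq q -> z \in Bq q ->
  dX c tau (row q) u z = dg c tau (ix c (row q) u * s + ix c (row q) z).
Proof. by move=> _ _; rewrite dXE // ix_le. Qed.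

Lemma decE q tau (u z : T) : u \in Bq q -> z \in Bq q ->
  dE c tau (row q) u z = (dg c tau (s * s + (ix c (row q) u * s + ix c (row q) z)) != 0).
Proof.
by move=> _ _; rewrite /dE sqE mulzE // (leq_trans (ix_le _ _)) // ltnW.
Qed.

Lemma hxeP q x e tau : (forall j, j < m2 -> dg c tau j = hxe q x e j) ->
  forall u z, u \in Bq q -> z \in Bq q -> x u z < b ->
  dX c tau (row q) u z = x u z /\ dE c tau (row q) u z = e u z.
Proof.
move=> h u z uB zB xb; have hu := ix_lt uB; have hz := ix_lt zB; have lt := pos_lt hu hz.
have h0 : 0 < b by apply: ltnW.
have dv : (ix c (row q) u * s + ix c (row q) z) %/ s = ix c (row q) u.
  by rewrite divnMDl // divn_small // addn0.
have md : (ix c (row q) u * s + ix c (row q) z) %% s = ix c (row q) z.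
  by rewrite modnMDl modn_small.
rewrite decX // decE // !h; [|by rewrite ltn_add2l|by rewrite (leq_trans lt) // leq_addr].
rewrite /hxe lt ltnNge leq_addr /= addKn dv md !slotK // eqb0 negbK; split=> //.
by apply/minn_idPl; rewrite -ltnS prednK.
Qed.

Lemma encode_full q x e (i o : T -> nat) k :
  (forall u z, u \in Bq q -> z \in Bq q -> x u z < b) ->
  (forall u, u \in Bq q -> i u <= 1 /\ o u <= 1) -> k <= n ->
  exists tau, [/\ tau < Z, dK c tau = k,
    forall u z, u \in Bq q -> z \in Bq q ->
      dX c tau (row q) u z = x u z /\ dE c tau (row q) u z = e u z &
    forall u, u \in Bq q -> dI c tau (row q) u = i u /\ dO c tau (row q) u = o u].
Proof.
move=> xb io kn; have [|tau [h1 h2 h3 h4]] := @encode q (hxe q x e) i o k _ io kn.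
  by move=> j _; apply: hxe_lt.
exists tau; split=> // u z uB zB; exact: hxeP h2 _ _ uB zB (xb _ _ uB zB).
Qed.

Lemma AlBP v (P : nat -> bool) :
  reflect (forall u : T, u \in Bv v -> P u) (AlB c (v : T) P).
Proof.
rewrite /AlB (en_n ec); apply: (iffP (AlP _ _)) => h u.
  by move=> uB; have := h u; rewrite (inBagE (Some v)) uB.
by apply/implyP; rewrite (inBagE (Some v)); apply: h.
Qed.

Lemma localvP v tau : localv c (v : T) tau <->
  [/\ forall u, u \in Bv v -> dE c tau v u u,
      forall u z, u \in Bv v -> z \in Bv v -> dE c tau v u z -> dE c tau v z u &
      forall u z y, u \in Bv v -> z \in Bv v -> y \in Bv v ->
       [/\ dE c tau v u z -> dE c tau v z y -> dE c tau v u y,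
           dE c tau v u z -> dX c tau v u y = dX c tau v z y &
           dX c tau v u y <= dX c tau v u z + dd G z y]].
Proof.
split=> [/AlBP h|[h1 h2 h3]].
  split=> [u uB|u z uB zB|u z y uB zB yB].
  - by have /andP[] := h u uB.
  - by have /andP[_ /AlBP/(_ z zB)/andP[/implyP]] := h u uB.
  - have /andP[_ /AlBP/(_ z zB)/andP[_ /AlBP/(_ y yB)/and3P[g1 g2 g3]]] := h u uB.
    split; last by rewrite -(en_D ec).
      by move=> e1 e2; move: g1; rewrite e1 e2.
    by move=> e1; move: g2; rewrite e1 => /eqP.
apply/AlBP => u uB; rewrite h1 //=; apply/AlBP => z zB; apply/andP; split.
  by apply/implyP; apply: h2.
apply/AlBP => y yB; have [g1 g2 g3] := h3 u z y uB zB yB; apply/and3P; split.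
- by apply/implyP => /andP[]; apply: g1.
- by apply/implyP => /g2->.
- by rewrite (en_D ec).
Qed.

Lemma dX_lt q tau (u z : T) : tau < Z -> u \in Bq q -> z \in Bq q -> dX c tau (row q) u z < b.
Proof.
move=> tZ uB zB; rewrite decX //; apply: dg_lt => //.
by apply: leq_trans (pos_lt (ix_lt uB) (ix_lt zB)) _; rewrite -addnA leq_addr.
Qed.

Lemma initP v tau : tau < Z ->
  (dK c tau == 0) && initv c (v : T) tau <-> Sem (Some v) set0 (dec (Some v) tau).
Proof.
move=> tZ; rewrite Sem_init /=.
(* Numbers up to [n] stand for optional vertices, with [n] itself for [None]. *)
pose on (p : nat) : option T := insub p.
have onE (p : nat) (u : T) : (on p == Some u) = (u == p :> nat).
  rewrite /on; case: insubP => [p' _ <-|/negbTE h]; first by rewrite eq_sym.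
  by apply/esym/negbTE; apply: contraFneq h => <-.
have onS p : isSome (on p) = (p < n) by rewrite /on; case: insubP => [u ->|/negbTE->].
have onP p u : on p = Some u -> p = u by move/eqP; rewrite onE => /eqP.
pose flagok p q := AlB c v (fun u =>
  (dI c tau v u == bexp ((u == v) && (p < n)) + bexp (u == q)) &&
  (dO c tau v u == bexp ((u == v) && (q < n)) + bexp (u == p))).
pose okP p := (p < n) ==> [&& inS c v p, cG c v p, dE c tau v p v & dX c tau v v v == (dX c tau v p p).+1].
pose okQ q := (q < n) ==> [&& inS c v q, cG c v q, dE c tau v v q & dX c tau v q q == (dX c tau v v v).+1].
have okPP p : okP p <-> forall p', on p = Some p' ->
    [/\ p' \in Sv v, G v p', dE c tau v p' v & dX c tau v v v = (dX c tau v p' p').+1].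
  split=> [/implyP h p' E|h].
    have pE := onP _ _ E; have lt : p < n by rewrite pE.
    have := h lt; rewrite pE inSE (en_G ec) adjnE => /and4P[h1 h2 h3 /eqP h4].
    by split.
  apply/implyP => lt; have E : on p = Some (Ordinal lt) by apply/eqP; rewrite onE.
  have [h1 h2 h3 h4] := h _ E.
  rewrite (en_G ec) -[p]/(val (Ordinal lt)) inSE adjnE; apply/and4P; split=> //.
  by apply/eqP.
have okQP q : okQ q <-> forall q', on q = Some q' ->
    [/\ q' \in Sv v, G v q', dE c tau v v q' & dX c tau v q' q' = (dX c tau v v v).+1].
  split=> [/implyP h p' E|h].
    have pE := onP _ _ E; have lt : q < n by rewrite pE.
    have := h lt; rewrite pE inSE (en_G ec) adjnE => /and4P[h1 h2 h3 /eqP h4].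
    by split.
  apply/implyP => lt; have E : on q = Some (Ordinal lt) by apply/eqP; rewrite onE.
  have [h1 h2 h3 h4] := h _ E.
  rewrite (en_G ec) -[q]/(val (Ordinal lt)) inSE adjnE; apply/and4P; split=> //.
  by apply/eqP.
have flP p q : flagok p q <-> forall u, u \in Bv v ->
    dI c tau v u = (u == v) && isSome (on p) + (on q == Some u) /\
    dO c tau v u = (u == v) && isSome (on q) + (on p == Some u).
  split=> [/AlBP h u uB|h].
    by have /andP[/eqP-> /eqP->] := h u uB; rewrite !onE !onS.
  by apply/AlBP => u uB; have [-> ->] := h u uB; rewrite !onE !onS !eqxx.
have iE : initv c v tau = localv c v tau &&
    [exists p : 'I_n.+1, [exists q : 'I_n.+1, [&& okP p, okQ q & flagok p q]]].
  by rewrite /initv /Ex /okP /okQ /flagok (en_n ec).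
rewrite iE; split.
  case/andP => /eqP k0 /andP[/localvP[l1 l2 l3] /existsP[p /existsP[q /and3P[h1 h2 h3]]]].
  split=> //; exists (on p), (on q); split; last by apply/flP.
  split=> //.
  - by move=> u z y uB zB yB; have [] := l3 u z y uB zB yB.
  - by move=> u z y uB zB yB; have [] := l3 u z y uB zB yB.
  - by move=> u z y uB zB yB; have [] := l3 u z y uB zB yB.
  - by move=> u z uB zB; apply: (@dX_lt (Some v)).
  - exact/okPP.
  - exact/okQP.
case=> k0 [P [Q [[l1 l2 l3 l4 l5 l6 l7 l8] fl]]]; rewrite k0 eqxx andTb.
pose ad (x : option T) : 'I_n.+1 := if x is Some u then widen_ord (leqnSn n) u else ord_max.
have adK x : on (ad x) = x.
  by case: x => [u|] /=; [apply/eqP; rewrite onE | rewrite /on insubF // ltnn].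
apply/andP; split.
  apply/localvP; split; [exact: l1 | exact: l2 | move=> u z y uB zB yB].
  by split; [exact: l3 | exact: l4 | exact: l5].
apply/existsP; exists (ad P); apply/existsP; exists (ad Q); apply/and3P; split.
- by apply/okPP; rewrite adK => p' /l7.
- by apply/okQP; rewrite adK => p' /l8.
- by apply/flP; rewrite !adK.
Qed.

(** Every realizable interface is small enough to have a code, so nothing is lost by running through
    codes only. *)
Lemma Sem_small q Ts a : Sem q Ts a ->
  (forall u, u \in Bq q -> si a u <= 1 /\ so a u <= 1) /\ sk a <= n.
Proof.
case=> dt [_ [_ h1 h2 ->]]; split; last by rewrite -[X in _ <= X](card_ord n) max_card.
by move=> u uB; split; [have [] := h1 u uB | have [] := h2 u uB].
Qed.

Lemma same_xe q t1 t2 : (forall j, j < m2 -> dg c t1 j = dg c t2 j) ->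
  forall u z, u \in Bq q -> z \in Bq q ->
  dX c t1 (row q) u z = dX c t2 (row q) u z /\ dE c t1 (row q) u z = dE c t2 (row q) u z.
Proof.
move=> h u z uB zB; have lt := pos_lt (ix_lt uB) (ix_lt zB).
by rewrite !decX // !decE // !h ?ltn_add2l // (leq_trans lt) // leq_addr.
Qed.

Definition set16 (A : nat -> nat -> nat) : ctx :=
  Ctx (cn c) (ck c) (cG c) (cZ c) (fun a => if a == 16 then A else cA c a).

Lemma set16E c' : [/\ cn c' = cn c, ck c' = ck c, cG c' = cG c, cZ c' = cZ c &
  forall a, a \notin [:: 16] -> cA c' a = cA c a] -> c' = set16 (cA c' 16).
Proof.
case: c' => n' k' G' Z' A' /= [-> -> -> -> h]; congr Ctx; apply/funext => a.
by case: eqP => [->//|/eqP ne]; apply: h; rewrite inE.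
Qed.

Lemma samedigitsP t1 t2 : samedigits c t1 t2 <-> forall j, j < m2 -> dg c t1 j = dg c t2 j.
Proof.
rewrite /samedigits sqE; split=> [/AlP h j jm|h].
  have jZ : j < Z by apply: leq_trans jm (leq_trans (leq_addr _ _) (ltnW (ltnW DZ))).
  by have := h (Ordinal jZ); rewrite /= jm => /eqP.
by apply/AlP => j; apply/implyP => jm; apply/eqP; apply: h.
Qed.

Lemma AlSP v (P : nat -> bool) :
  reflect (forall u : T, u \in Sv v -> P u) (Al (cn c) (fun u => inS c (v : T) u ==> P u)).
Proof.
rewrite (en_n ec); apply: (iffP (AlP _ _)) => h u.
  by move=> uB; have := h u; rewrite inSE uB.
by apply/implyP; rewrite inSE; apply: h.
Qed.

Lemma compatP v p tv tp : compat c (v : T) p tv tp <-> forall u z : T, u \in Sv v -> z \in Sv v ->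
  dX c tv v u z = dX c tp p u z /\ dE c tv v u z = dE c tp p u z.
Proof.
pose F u := Al (cn c) (fun z => inS c v z ==>
  (dX c tv v u z == dX c tp p u z) && (dE c tv v u z == dE c tp p u z)).
have -> : compat c v p tv tp = Al (cn c) (fun u => inS c v u ==> F u) by [].
split=> [/AlSP h u z uS zS|h].
  by have := h u uS; rewrite /F => /AlSP/(_ z zS)/andP[/eqP-> /eqP->].
by apply/AlSP => u uS; rewrite /F; apply/AlSP => z zS; have [-> ->] := h u z uS zS; rewrite !eqxx.
Qed.

Section Step.
Variable cs : nat -> T.
Hypothesis csP : forall t, t < n -> rkf (cs t) = n - t.+1.
Hypothesis rlt : forall u : T, rkf u < n.
Local Notation subtree := (subtree G rkf cs).
Let rinj : injective rkf. Proof. by case: ch. Qed.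

Lemma curE A t : t < n -> cur (set16 A) t = cs t.
Proof.
move=> tn; rewrite /cur [cn _](en_n ec).
have h : rk (set16 A) (cs t) == n - t.+1 by apply/eqP; apply: csP.
have [j [-> /eqP E]] := @first_ord n (fun i => rk (set16 A) i == n - t.+1) (cs t) h.
by congr val; apply: rinj; rewrite csP.
Qed.

Lemma isparentE A v q : isparent (set16 A) (v : T) (row q) = isparb G rkf v q.
Proof.
have rE : isroot (set16 A) v = (Sv v == set0).
  have -> : isroot (set16 A) v = Al n (fun u => ~~ inS c v u) by rewrite /isroot [cn _](en_n ec).
  apply/AlP/eqP => [h|h u]; last by rewrite inSE h inE.
  by apply/setP => u; rewrite in_set0 -inSE; apply/negbTE.
rewrite /isparent rE [cn _](en_n ec); case: q => [p|] /=; last by rewrite ltnn eqxx.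
rewrite ltn_ord (ltn_eqF (ltn_ord p)) /= orbF -[inS _ _ _]/(inS c v p) inSE; congr (_ && _).
apply/idP/forall_inP => [/AlP h u uS|h].
  by have := h u; rewrite -[inS _ _ _]/(inS c v u) inSE uS.
by apply/AlP => u; apply/implyP; rewrite -[inS _ _ _]/(inS c v u) inSE; apply: h.
Qed.

Section Merge.
Variables (t : nat) (q : option T) (tau : nat) (A : nat -> nat -> nat).
Hypotheses (tn : t < n) (tZ : tau < Z) (act : active rkf n t.+1 q) (qpar : isparb G rkf (cs t) q).
Local Notation v := (cs t).
Hypothesis hA : forall q tau, active rkf n t q -> tau < Z ->
  (A (row q) tau != 0) <-> Sem q (subtree t q) (dec q tau).

Let Sub_ u : u \in Sv v -> u \in Bq q.
Proof.
case: q qpar => [p|] /= h; last by rewrite (eqP h) inE.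
by apply/subsetP; apply: (Sv_par rinj); exact: (isparP G rkf v (Some p) h).
Qed.

Let actq : active rkf n t q.
Proof. by case: q act => //= p; lia. Qed.

Let actv : active rkf n t (Some v).
Proof. by rewrite /= csP //; lia. Qed.

Lemma merge_step : merge (set16 A) v (row q) tau <->
  exists a1 a2, [/\ Sem q (subtree t q) a1, Sem (Some v) (subtree t (Some v)) a2 &
    mergeable G rkf q v (dec q tau) a1 a2].
Proof.
have mE : merge (set16 A) v (row q) tau = Ex Z (fun tp => Ex Z (fun tv =>
  [&& A (row q) tp != 0, A v tv != 0, samedigits c tau tp, compat c v (row q) tv tp,
      closed1 c v tv, flags c v (row q) tv tp tau &
      dK c tau == dK c tp + dK c tv + bexp (dI c tv v v == 0)])) by [].
have vB : v \in Bv v by rewrite in_setU1 eqxx.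
have SB u : u \in Sv v -> u \in Bv v by move=> h; rewrite in_setU1 h orbT.
have xp tp : (forall j, j < m2 -> dg c tau j = dg c tp j) -> forall u z, u \in Bq q -> z \in Bq q ->
    dX c tau (row q) u z = dX c tp (row q) u z /\ dE c tau (row q) u z = dE c tp (row q) u z.
  exact: same_xe.
have flP tv tp : flags c v (row q) tv tp tau <-> forall u : T, u \in Bq q ->
   [/\ dI c tau (row q) u = dI c tp (row q) u + (if u \in Sv v then dI c tv v u else 0),
       dI c tau (row q) u <= 1,
       dO c tau (row q) u = dO c tp (row q) u + (if u \in Sv v then dO c tv v u else 0) &
       dO c tau (row q) u <= 1].
  rewrite /flags (en_n ec); split=> [/AlP h u uB|h].
    by have := h u; rewrite inBagE uB inSE /ite => /and4P[/eqP h1 h2 /eqP h3 h4]; split.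
  apply/AlP => u; apply/implyP; rewrite inBagE => /h[h1 h2 h3 h4].
  by rewrite inSE /ite h2 h4 -h1 -h3 !eqxx.
rewrite mE; split.
  case/ExP => tp /ExP[tv /and5P[h1 h2 /samedigitsP h3 /compatP h4 /and3P[/and3P[h5 h6 h7] /flP h8 /eqP h9]]].
  exists (dec q tp), (dec (Some v) tv); split.
  - by apply/hA.
  - exact/(hA (q := Some v)).
  split=> //=.
  - by move=> v' qE u z uB zB; have := xp tp h3 u z; rewrite qE /=; apply.
  - by split=> // d0; move: h7; rewrite d0 => /eqP.
case=> a1 [a2 [s1 s2 [m1 m2 [m3 m4 m5] m6 m7]]].
have [io1 k1] := Sem_small s1; have [io2 k2] := Sem_small s2.
(* The first digits are copied from [tau] verbatim, because [samedigits] also compares positions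
   that no bag vertex uses. *)
have [|tp [p1 p2 p3 p4]] := @encode q (dg c tau) (si a1) (so a1) (sk a1) _ io1 k1.
  by move=> j jm; apply: dg_lt => //; apply: leq_trans jm _; rewrite leq_addr.
have [|tv [v1 v2 v3 v4]] := @encode_full (Some v) (sx a2) (se a2) (si a2) (so a2) (sk a2) _ io2 k2.
  by move=> u z uB zB; apply: Sem_bnd s2 uB zB.
have p2' j : j < D - (s + s) -> dg c tau j = dg c tp j by rewrite addnK => /p2.
have X1 u z : u \in Bq q -> z \in Bq q -> sx a1 u z = dX c tp (row q) u z /\ se a1 u z = dE c tp (row q) u z.
  move=> uB zB; rewrite addnK in p2'; have [<- <-] := xp tp p2' u z uB zB.
  by case: q m1 uB zB => [p|] m1 uB zB; [have [<- <-] := m1 p erefl u z uB zB | rewrite inE in uB].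
apply/ExP; exists (Ordinal p1); apply/ExP; exists (Ordinal v1) => /=.
apply/and5P; split.
- apply/hA => //; apply: Sem_ext s1; [exact: X1 | move=> u uB | by rewrite /= p3].
  by rewrite /=; have [-> ->] := p4 u uB.
- apply/(hA (q := Some v)) => //; apply: Sem_ext s2; [move=> u z uB zB | move=> u uB | by rewrite /= v2].
    by rewrite /=; have [-> ->] := v3 u z uB zB.
  by rewrite /=; have [-> ->] := v4 u uB.
- by apply/samedigitsP => j jm; rewrite p2.
- apply/compatP => u z uS zS.
  have [e1 e2] := m2 u z uS zS; have [f1 f2] := v3 u z (SB u uS) (SB z zS).
  have [g1 g2] := X1 u z (Sub_ uS) (Sub_ zS); rewrite /= in f1 f2.
  by rewrite f1 f2 e1 e2 g1 g2.
have [iv ov] := v4 v vB; have [xv _] := v3 v v vB vB; rewrite /= in iv ov xv.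
apply/and3P; split.
- by rewrite /closed1 iv ov xv m3 m4; apply/implyP => /eqP/m5->.
- apply/flP => u uB; have [f1 f2 f3 f4] := m6 u uB; have [g1 g2] := p4 u uB.
  rewrite /= in f1 f2 f3 f4.
  have vv : u \in Sv v -> dI c tv v u = si a2 u /\ dO c tv v u = so a2 u by move/SB/v4.
  rewrite g1 g2; split; [rewrite f1 | exact: f2 | rewrite f3 | exact: f4];
    case: ifP => [/vv[vi vo]|]; by rewrite ?vi ?vo.
- by rewrite -[dK c tau]/(sk (dec q tau)) m7 p3 v2 iv.
Qed.

End Merge.

Definition dpinv t c' := exists2 A, c' = set16 A & forall q tau, active rkf n t q -> tau < Z ->
  (A (row q) tau != 0) <-> Sem q (subtree t q) (dec q tau).

Let rowZ q : row q < Z.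
Proof. by case: q => [v|] //=; apply: ltn_trans nZ. Qed.

Lemma dpinv0 : dpinv 0 (fillc 16 (fun c v tau => (dK c tau == 0) &&
    (((v < cn c) && initv c v tau) || (v == cn c))) c).
Proof.
eexists; first exact: (set16E (frame_fill 16 _ c)).
move=> q tau _ tZ; rewrite fillE ?rowZ // eqb0 negbK (en_n ec).
case: q => [v|]; first by rewrite ltn_ord (ltn_eqF (ltn_ord v)) orbF; exact: initP.
rewrite ltnn eqxx andbT Sem_root_init; by split=> /eqP.
Qed.

Lemma dpinv_step t c' : t < n -> dpinv t c' -> dpinv t.+1
  (fillc 16 (fun c p tau => ite (isparent c (cur c t) p) (merge c (cur c t) p tau) (cA c 16 p tau)) c').
Proof.
move=> tn [A -> hA]; eexists.
  apply: set16E; have [f1 f2 f3 f4 f5] := frame_fill 16 (fun c p tau =>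
    ite (isparent c (cur c t) p) (merge c (cur c t) p tau) (cA c 16 p tau)) (set16 A).
  split=> //; move=> a ha; rewrite f5 //.
  by rewrite /=; move: ha; rewrite inE => /negbTE->.
move=> q tau act tZ; rewrite fillE ?rowZ // curE // isparentE.
rewrite (Sem_step G b rinj rlt csP _ tn act) /ite; case: ifP => h.
  by rewrite eqb0 negbK; exact: merge_step tn tZ act h hA.
apply: hA => //; by have [] := active_step csP tn act.
Qed.

Lemma dynprog_sem tau : tau < Z ->
  (cA (dynprog c) 16 n tau != 0) <-> isometric_path_partition G (dK c tau).
Proof.
move=> tZ; rewrite /dynprog /seqc; set c0 := fillc 16 _ c; set F := fun t : nat => _.
have [A -> hA] : dpinv n (loopc cn F c0).
  have E : cn c0 = n by exact: en_n ec.
  rewrite -{1}E; apply: (@loop_ind dpinv); first exact: dpinv0.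
  by move=> t c' tn; apply: dpinv_step; rewrite -E.
have := hA None tau isT tZ; rewrite (subtree_full G rinj rlt csP) => ->.
rewrite Sem_root //; move=> u z cuz; rewrite /bb addn2 ltnS; apply: leqW.
exact: dm_max (en_n ec) (en_D ec) _ _ cuz.
Qed.

End Step.

Lemma ranks_onto : (forall u : T, rkf u < n) -> forall i, i < n -> exists u, rkf u = i.
Proof.
move=> rlt i lt; pose f u := Ordinal (rlt u).
have fi : injective f by move=> u v /(congr1 val) /=; case: ch => _ h _; apply: h.
have [g _ gK] := injF_bij fi.
by exists (g (Ordinal lt)); have /(congr1 val) := gK (Ordinal lt).
Qed.

Lemma dynprog_ok (x0 : T) : (forall u : T, rkf u < n) -> forall k,
  Ex Z (fun tau => (cA (dynprog c) 16 n tau != 0) && (dK c tau == k)) = `[<isometric_path_partition G k>].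
Proof.
move=> rlt k; have [cs csP] : {cs : nat -> T | forall t, t < n -> rkf (cs t) = n - t.+1}.
  exists (fun t => odflt x0 [pick u : T | rkf u == n - t.+1]) => t tn.
  have [|u hu] := @ranks_onto rlt (n - t.+1); first by lia.
  by case: pickP => [z /eqP //|/(_ u)]; rewrite hu eqxx.
apply/ExP/asboolP => [[tau /andP[/(dynprog_sem csP rlt (ltn_ord tau)) h /eqP <-]]//|h].
have kn : k <= n.
  have [P [Pp <- _]] := h.
  by rewrite -[X in _ <= X](card_ord n) -cardsT partition_card_le.
have [||tau [h1 _ h2 _]] := @encode None (fun _ => 0) (fun _ => 0) (fun _ => 0) k _ _ kn => //.
  by move=> j _; apply: ltnW.
by exists (Ordinal h1); rewrite /= h2 eqxx andbT; apply/(dynprog_sem csP rlt h1); rewrite h2.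
Qed.

End DP.

(** One bag with all vertices. The program tries only widths below n, and this shows that the
    treewidth is among them. *)
Lemma treewidth_lt (n : nat) (G : sgraph 'I_n) : 0 < n -> treewidth G < n.
Proof.
move=> n0; rewrite /treewidth; case: ex_minnP => w _ /(_ n.-1) h.
rewrite -(prednK n0) ltnS; apply: h; apply/asboolP.
have sy : symmetric (fun _ _ : unit => false) by [].
have ir : irreflexive (fun _ _ : unit => false) by [].
exists unit, (SGraph sy ir), (fun=> [set: 'I_n]); split; last first.
  rewrite /width; congr _.-1; apply/eqP; rewrite eqn_leq; apply/andP; split.
    by apply/bigmax_leqP => _ _; rewrite cardsT card_ord.
  by apply: leq_trans (leq_bigmax tt); rewrite cardsT card_ord.
split=> [|v|v w' _|v [] [] _ _]; last exact: connect0.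
- split=> [|[] []|]; [by rewrite card_unit | exact: connect0 |].
  by case=> [|[] [|[] c]] //= _; rewrite /ucycle.
- by exists tt; rewrite inE.
- by exists tt; rewrite !inE.
Qed.

Lemma count_double m n : m <= n -> Sm n (fun i => i + i < m) = uphalf m.
Proof.
move=> mn; rewrite SmE.
have T i : (i < \sum_(i < n) (i + i < m)) = (i < uphalf m).
  rewrite (@sum_threshold n (fun i => i + i < m) i); last first.
    by move=> i1 i2 h12; apply: leq_ltn_trans; rewrite leq_add.
  by rewrite [in RHS]ltnNge leq_uphalf_double -ltnNge -addnn; case: (ltnP (i + i) m) => h; rewrite ?andbF // andbT; lia.
by case: (ltngtP (\sum_(i < n) (i + i < m)) (uphalf m)) => // h; [have := T (\sum_(i < n) (i + i < m)) | have := T (uphalf m)]; rewrite ltnn h.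
Qed.

(** * Correctness of a complete run *)

Section Answer.
Variables (n : nat) (G : sgraph 'I_n).
Local Notation T := 'I_n.

Lemma cliques_ok c : cn c = n -> distok G c -> dm c <= 1 -> forall k,
  (cliques c <= k) && (k <= n) = `[<isometric_path_partition G k>].
Proof.
move=> nc dc d1 k; pose Ld := [set v : T | leader c v].
have ld v : (v \in Ld) = [forall u : T, (u < v) ==> ~~ connect G v u].
  rewrite in_set /leader /Al nc; apply: eq_forallb => u.
  by rewrite dc -dd_connect card_ord -leqNgt.
have cC : connect_sym G by apply: sym_connect_sym; apply: adj_sym.
have diam1 x y : connect G x y -> dd G x y <= 1.
  by move=> h; apply: leq_trans d1; apply: dm_max.
have Lex u : exists2 v, v \in Ld & connect G v u.
  have [v hv vmin] := @arg_minnP _ u (fun v => connect G v u) val (connect0 _ _).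
  exists v => //; rewrite ld; apply/forallP => z; apply/implyP; rewrite ltnNge; apply: contra => vz.
  by apply: vmin; apply: connect_trans hv; rewrite cC.
have Luniq v v' : v \in Ld -> v' \in Ld -> connect G v v' -> v = v'.
  rewrite !ld => /forallP/(_ v') h /forallP/(_ v) h' cvv; apply: val_inj.
  rewrite cvv implybF -leqNgt in h; rewrite cC cvv implybF -leqNgt in h'.
  by apply/eqP; rewrite eqn_leq h h'.
have E : cliques c = \sum_(v in Ld) uphalf #|cls G v|.
  rewrite /cliques nc SmE [RHS]big_mkcond; apply: eq_bigr => v _.
  rewrite in_set /ite; case: (leader c v) => //.
  have -> : clsize c v = #|cls G v|.
    rewrite /clsize nc Sm_card; apply: eq_card => u.
    by rewrite !in_set dc -[X in _ < X](card_ord n) dd_connect.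
  by apply: count_double; rewrite -[X in _ <= X](card_ord n) max_card.
rewrite E -[X in _ && (k <= X)](card_ord n); apply/idP/asboolP.
  by move/(clique_partition diam1 Lex Luniq).
by move/(clique_partition diam1 Lex Luniq).
Qed.

Lemma frame_dynprog : frame [:: 16] dynprog.
Proof.
apply: (@frame_sub ([:: 16] ++ [:: 16])); first by apply/allP.
by apply: frame_seq; [exact: frame_fill | apply: frame_loop => t; exact: frame_fill].
Qed.

Lemma answer_set16 c A : answer (set16 c A) =
  ite (dm c <= 1) ((cliques c <= ck c) && (ck c <= cn c))
    (Ex (cZ c) (fun tau => (A (cn c) tau != 0) && (dK c tau == ck c))).
Proof. by []. Qed.

Lemma done_set16 c A : done (set16 c A) = done c.
Proof. by []. Qed.

Section Run.
Variables (k Z : nat) (A : nat -> nat -> nat -> nat).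
Let c := Ctx n k (adjn G) Z A.
Hypothesis bigZ : n + n + 2 < Z.
Let c1 := digits (apsp_graph c).
Let c2 := ordering c1.
Let c3 := elim c2.
Let c4 := dynprog c3.
Let solveE : solve c = c4. Proof. by []. Qed.

Let env1 : env G c1.
Proof.
have fa := frame_apsp_graph c; have [a1 a2 a3 a4 a5] := fa.
have [f1 f2 f3 f4 f5] := frame_digits (apsp_graph c).
split.
- by rewrite f1 a1.
- by rewrite f3 a3.
- by rewrite f4 a4.
- move=> x y; rewrite f5 //; apply: apsp_graph_ok => //=.
  by move: bigZ; clear; lia.
- exact: digits_ok.
- by move=> j x; rewrite f4; apply: digits_out.
Qed.

Let env2 : env G c2.
Proof. by apply: env_same env1; apply: (frame_same _ frame_ordering). Qed.
Let env3 : env G c3.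
Proof. by apply: env_same env2; apply: (frame_same _ frame_elim). Qed.
Let el3 : elimok G c3.
Proof. by case: (elim_ok env2). Qed.
Let rlt u : ranks c3 (u : T) < n.
Proof. exact: ranks_lt env2. Qed.
Let ck3 : ck c3 = k.
Proof.
rewrite /c3 /c2 /c1; case: (frame_elim (ordering (digits (apsp_graph c)))) => _ -> _ _ _.
case: (frame_ordering (digits (apsp_graph c))) => _ -> _ _ _.
by case: (frame_digits (apsp_graph c)) => _ -> _ _ _; case: (frame_apsp_graph c).
Qed.
Let c4E : c4 = set16 c3 (cA c4 16).
Proof. by apply: set16E; exact: frame_dynprog. Qed.

Lemma solve_sound : done (solve c) -> answer (solve c) = `[<isometric_path_partition G k>].
Proof.
rewrite solveE c4E done_set16 answer_set16 (en_n env3) ck3 /done /ite.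
case: (leqP (dm c3) 1) => d1 /= => [_|].
  by rewrite (cliques_ok (en_n env3) (en_D env3) d1 k).
case/andP => _ /(checksP env3 el3) ch.
have [x0 _] : exists x : T, true.
  case: n G env3 d1 => [|m] G' e3; last by exists ord0.
  by rewrite /dm (en_n e3) SmE big_ord0.
by rewrite -(dynprog_ok env3 el3 ch x0 rlt k).
Qed.

Lemma solve_complete : (1 < diam G -> n.+1 * (diam G + 2) ^ nd (treewidth G) < Z) -> done (solve c).
Proof.
move=> h; rewrite solveE c4E done_set16.
rewrite /done /big /nnode (en_n env3) (en_Z env3) /=.
case: (leqP (dm c3) 1) => //= d1.
have dle := dm_diam (en_n env3) (en_D env3).
have n0 : 0 < n.
  case: n G env3 d1 => [|m] G' e3 //.
  by rewrite /dm (en_n e3) SmE big_ord0.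
apply/(checksP env3 el3).
have s12 : same c1 c2 by apply: (frame_same _ frame_ordering).
have s23 : same c2 c3 by apply: (frame_same _ frame_elim).
have dm1 : bb c3 = bb c1 by rewrite (same_bb s23) (same_bb s12).
have Z1 : cZ c1 = Z.
  by case: (frame_digits (apsp_graph c)) => _ _ _ -> _; case: (frame_apsp_graph c).
have [|wle nw0] := ww_ge env1 (treewidth_lt G n0).
  rewrite Z1; apply: leq_ltn_trans (h (leq_trans d1 dle)).
  rewrite leq_mul2l; apply/orP; right; rewrite leq_exp2r; last by rewrite /nd /slots !addnS.
  by rewrite -dm1 /bb leq_add2r.
have inv := ordering_ok env1 nw0 wle; rewrite -(same_ww s12) in inv.
by apply: elim_checked => //; rewrite (same_nw s12).
Qed.

End Run.
End Answer.

(** * The sufficient budget and the running time *)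

Lemma treewidth_diam0 n (G : sgraph 'I_n) : diam G = 0 -> treewidth G = 0.
Proof.
move=> d0; apply: treewidth_edgeless => x y; apply/negP => Gxy.
have := dd_le_diam (connect1 Gxy); rewrite d0 leqn0 => /eqP /dd_eq0 xy.
by move: Gxy; rewrite xy adj_irr.
Qed.

Lemma diam_edgeless n (G : sgraph 'I_n) : (forall x y, ~~ G x y) -> diam G = 0.
Proof.
move=> no; apply/eqP; rewrite -leqn0; apply/bigmax_leqP => x _; apply/bigmax_leqP => y.
case/connectP => -[_ ->|z p] /=; last by rewrite (negbTE (no _ _)).
rewrite leqn0 /dist; have : 0 < #|'I_n| by apply/card_gt0P; exists x.
case: #|_| => //= m _; case: existsP => // -[]; exists [tuple] => /=.
by rewrite /gpath eqxx.
Qed.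

(** For positive w, [slots w] is at most 14 w, so [nd w] is at most 392 w^2 + 28 w. *)
Lemma nd_le w : 0 < w -> nd w <= 420 * w ^ 2.
Proof. by rewrite /nd /slots expnS expn1; nia. Qed.

(** From diameter 2 on, [d + 2 <= d ^ 2], which doubles 420 to 840, and there is an edge, so the
    treewidth is positive. For diameter 0 the treewidth is 0 and the power on the right is 1. *)
Lemma budget_le n (G : sgraph 'I_n) :
  n + n + 3 + (if 1 < diam G then n.+1 * (diam G + 2) ^ nd (treewidth G) else 0)
    <= 4 * n.+1 * diam G ^ (840 * treewidth G ^ 2).
Proof.
set d := diam G; set w := treewidth G.
have Y0 : 0 < d ^ (840 * w ^ 2).
  by rewrite expn_gt0; case E : d => //=; rewrite /w treewidth_diam0.
case: ifP => d1; last first.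
  by rewrite addn0; move: (d ^ _) Y0; clear; nia.
have w0 : 0 < w.
  case: (pickP (fun xy : 'I_n * 'I_n => G xy.1 xy.2)) => [[x y] /treewidth_edge //|no].
  by move: d1; rewrite /d diam_edgeless // => x y; rewrite (no (x, y)).
have le : (d + 2) ^ nd w <= d ^ (840 * w ^ 2).
  apply: (@leq_trans ((d ^ 2) ^ nd w)).
    by rewrite leq_exp2r; [rewrite expnS expn1; move: d1; clear; nia | rewrite /nd /slots !addnS].
  rewrite -expnM leq_exp2l //.
  by have := nd_le w0; clear; lia.
move: (d ^ _) Y0 le => Y; move: (_ ^ nd w); clear; nia.
Qed.

Lemma verdict_ok c n Z Z0 (q : nat) : cn c = n -> cZ c = Z -> n + n + 3 <= Z0 ->
  (n + n + 2 < Z -> done c -> answer c = q) -> (n + n + 2 < Z -> Z0 <= Z -> done c) ->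
  (cA (verdict c) 0 0 0 != 0 -> cA (verdict c) 0 0 1 = q) /\
  (Z0 <= Z -> cA (verdict c) 0 0 0 != 0).
Proof.
move=> <- <- hZ sound complete.
have e0 : (cA (verdict c) 0 0 0 != 0) = (0 < cZ c) && done c.
  by rewrite /=; case: (ltnP 0 (cZ c)) => //= _; rewrite eqb0 negbK.
rewrite e0; split=> [/andP[Z1 dn]|le].
  have bigZ : cn c + cn c + 2 < cZ c by case/andP: dn.
  have Z2 : 1 < cZ c by apply: leq_ltn_trans bigZ; rewrite addn2.
  by rewrite /verdict fillE // ?(ltnW Z2) //; apply: sound.
have bigZ : cn c + cn c + 2 < cZ c by apply: leq_trans le; rewrite -addnS.
by rewrite (leq_ltn_trans _ bigZ) //; apply: complete.
Qed.

Lemma frame_solve : frame ([:: 1; 2; 3; 4] ++ [:: 5] ++ [:: 1; 2; 3; 6; 7; 8; 9; 10; 11; 12; 13] ++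
  [:: 1; 2; 3; 14; 15] ++ [:: 16]) solve.
Proof.
exact: (frame_seq frame_apsp_graph (frame_seq frame_digits (frame_seq frame_ordering
  (frame_seq frame_elim frame_dynprog)))).
Qed.

Lemma run_ok n (G : sgraph 'I_n) k Z A : let c := run (Ctx n k (adjn G) Z A) in
  (cA c 0 0 0 != 0 -> cA c 0 0 1 = `[<isometric_path_partition G k>]) /\
  (n + n + 3 + (if 1 < diam G then n.+1 * (diam G + 2) ^ nd (treewidth G) else 0) <= Z ->
   cA c 0 0 0 != 0).
Proof.
have [nE _ _ ZE _] := frame_solve (Ctx n k (adjn G) Z A).
apply: (verdict_ok nE ZE (leq_addr _ _)); first exact: solve_sound.
move=> bigZ le; apply: solve_complete bigZ _ => d1; rewrite d1 in le.
by move: le; move: (n.+1 * _) => m; clear; lia.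
Qed.

Lemma leq_expW m n e : m <= n -> m ^ e <= n ^ e.
Proof. by case: e => // e h; rewrite leq_exp2r. Qed.

Theorem theorem3 :
  exists (p : com) (a b c : nat),
    forall (n : nat) (G : sgraph 'I_n) (k : nat),
      exists t : nat,
        decides_in p (input G k) (isometric_path_partition G k) t /\
        t <= a * (diam G ^ (b * treewidth G ^ 2) * n ^ c).+1.
Proof.
have [p [D hp]] := ram_main Scomp_run.
(* For positive n the bound [Z0 <= 4 * n.+1 * Y] gives [2 * Z0 + n + 4 <= 24 * (Y * n)]. *)
exists p, (24 ^ D), (840 * D), D => n G k.
have [t [ht le]] := hp n G k _ _ (@run_ok n G k).
exists t; split=> //; apply: leq_trans le _.
have := budget_le G; set Y := _ ^ (840 * _); set Z0 := _ + _ => hZ.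
have -> : diam G ^ (840 * D * treewidth G ^ 2) = Y ^ D by rewrite -expnM mulnAC.
have Y0 : 0 < Y by rewrite expn_gt0; case E : (diam G) => //=; rewrite treewidth_diam0.
have Y1 : n = 0 -> Y = 1.
  move=> n0; have d0 : diam G = 0.
    by apply: diam_edgeless => x; have := ltn_ord x; rewrite [X in _ < X]n0.
  by rewrite /Y treewidth_diam0.
(* Without vertices [n ^ D] may vanish; the successor in the bound then leaves the constant. *)
clearbody Y Z0; case: (posnP n) => [n0|n1].
  apply: (@leq_trans (24 ^ D)); last exact: leq_pmulr.
  by apply: leq_expW; move: hZ; rewrite (Y1 n0) n0; clear; lia.
apply: (@leq_trans (24 ^ D * (Y ^ D * n ^ D))); last by rewrite leq_mul2l leqnSn orbT.
by rewrite -!expnMn; apply: leq_expW; move: hZ Y0 n1; clear; nia.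
Qed.
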